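(* Let $k\in\mathbb N_0$ and let $f:Y\to X$ be a definable $C^1$-map of definable $C^1$-manifolds. (1) For every $\omega\in\Omega^k_{\mathrm{def}(0)}(X)$ we have $f^*\omega\in\Omega^k_{\mathrm{def}(0)}(Y)$ and $D(f^*\omega)=f^*(D\omega)$. (2) If $\mathcal{M}=\mathbb R_{\mathrm{an}}$, then for every $\omega\in\Omega^k_{\mathrm{con}(0)}(X)$ we have $f^*\omega\in\Omega^k_{\mathrm{con}(0)}(Y)$ and $D(f^*\omega)=f^*(D\omega)$.
   Context: $\mathcal{M}$ is a fixed o-minimal expansion of the ordered field of real numbers; ''definable'' means definable with real parameters in $\mathcal{M}$; $\mathbb R_{\mathrm{an}}$ is the o-minimal structure of the real field with restricted analytic functions (its definable sets are the globally subanalytic ones). A definable $C^1$-manifold of dimension $n$ is a Hausdorff space with (an equivalence class of) a finite atlas of homeomorphisms onto definable open subsets of $\mathbb R^n$ with definable $C^1$ transition maps; definable maps are defined chartwise. A constructible function on a globally subanalytic set is a finite sum of terms $f\prod_j\log g_j$ with $f$ globally subanalytic and $g_j$ positive globally subanalytic; on a manifold, constructibility is checked in charts. $\mathcal{E}^k_{\mathrm{def}(0)}(X)$ (resp. $\mathcal{E}^k_{\mathrm{con}(0)}(X)$) is the space of continuous $k$-forms on $X$ whose coefficient functions in all charts are definable (resp. constructible). $\Omega^k_{\mathrm{def}(0)}(X)$ is the set of $\omega\in\mathcal{E}^k_{\mathrm{def}(0)}(X)$ for which there exist a dense open definable $U\subset X$ on which $\omega$ is $C^1$ and some $\eta\in\mathcal{E}^{k+1}_{\mathrm{def}(0)}(X)$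 with $d(\omega|_U)=\eta|_U$; this $\eta$ is unique and $D\omega:=\eta$. $\Omega^k_{\mathrm{con}(0)}(X)$ and $D$ are defined in the same way using globally subanalytic $U$ and $\eta\in\mathcal{E}^{k+1}_{\mathrm{con}(0)}(X)$. *)

(* Defs.v *)
From HB Require Import structures.
From mathcomp Require Import all_boot all_order all_algebra.
From mathcomp Require Import all_classical all_reals all_analysis.

Set Implicit Arguments.
Unset Strict Implicit.
Unset Printing Implicit Defensive.

Import Order.TTheory GRing.Theory Num.Theory.
Import numFieldNormedType.Exports.

Local Open Scope classical_set_scope.
Local Open Scope ring_scope.

(* A set of primitive relations on R.  The ordered field structure is always
   added by [definable] below, so this denotes an expansion of the ordered
   field R. *)
Definition structure (R : realType) : Type := forall n, set (set 'rV[R]_n).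

(* First-order definability with parameters: the clauses are atomic formulas,
   substitution of variables for variables, Boolean connectives and the
   existential quantifier (over the last coordinate). *)
Inductive definable (R : realType) (M : structure R) :
    forall n, set 'rV[R]_n -> Prop :=
| definable_prim n (A : set 'rV[R]_n) : M n A -> definable M A
| definable_eq : definable M [set x : 'rV[R]_2 | x 0 0 = x 0 1]
| definable_lt : definable M [set x : 'rV[R]_2 | x 0 0 < x 0 1]
| definable_cst (a : R) : definable M [set x : 'rV[R]_1 | x 0 0 = a]
| definable_add :
    definable M [set x : 'rV[R]_3 | x 0 0 + x 0 1 = x 0 (inord 2)]
| definable_mul :
    definable M [set x : 'rV[R]_3 | x 0 0 * x 0 1 = x 0 (inord 2)]
| definable_subst m n (s : 'I_m -> 'I_n) (A : set 'rV[R]_m) :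
    definable M A -> definable M [set x : 'rV[R]_n | A (\row_i x 0 (s i))]
| definable_setC n (A : set 'rV[R]_n) : definable M A -> definable M (~` A)
| definable_setI n (A B : set 'rV[R]_n) :
    definable M A -> definable M B -> definable M (A `&` B)
| definable_exists n (A : set 'rV[R]_(n + 1)) :
    definable M A ->
    definable M [set x : 'rV[R]_n | exists t : R, A (row_mx x (const_mx t))].

Definition o_minimal (R : realType) (M : structure R) : Prop :=
  forall A : set 'rV[R]_1, definable M A ->
  exists s : seq (interval R),
    forall x, A x <-> exists2 J : interval R, J \in s & x 0 0 \in J.

Definition graph_on (R : realType) n m (U : set 'rV[R]_n)
    (f : 'rV[R]_n -> 'rV[R]_m) : set 'rV[R]_(n + m) :=
  [set z | U (lsubmx z) /\ rsubmx z = f (lsubmx z)].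

Definition definable_map (R : realType) (M : structure R) n m
    (U : set 'rV[R]_n) (f : 'rV[R]_n -> 'rV[R]_m) : Prop :=
  definable M (graph_on U f).

Definition definable_fun (R : realType) (M : structure R) n
    (U : set 'rV[R]_n) (f : 'rV[R]_n -> R) : Prop :=
  definable_map M U (fun x => const_mx (f x) : 'rV[R]_1).

(* g is, near a, the sum of an absolutely convergent power series centred at a;
   the partial sums are taken over the multi-indices in {0, ..., N-1}^n. *)
Definition analytic_at (R : realType) n (g : 'rV[R]_n -> R) (a : 'rV[R]_n) :
    Prop :=
  exists c : {ffun 'I_n -> nat} -> R, exists2 r : R, 0 < r &
    forall x : 'rV[R]_n, `|x - a| < r ->
      let term (N : nat) (e : {ffun 'I_n -> 'I_N}) : R :=
        c [ffun i => val (e i)] * \prod_i (x - a) 0 i ^+ e i in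
      cvgn (fun N => \sum_(e : {ffun 'I_n -> 'I_N}) `|term N e|) /\
      (\sum_(e : {ffun 'I_n -> 'I_N}) term N e) @[N --> \oo] --> g x.

Definition unit_cube (R : realType) n : set 'rV[R]_n :=
  [set x | forall i, -1 <= x 0 i <= 1].

Definition restricted_analytic (R : realType) n (f : 'rV[R]_n -> R) : Prop :=
  (exists g : 'rV[R]_n -> R,
    (forall a, unit_cube a -> analytic_at g a) /\
    (forall x, unit_cube x -> f x = g x)) /\
  (forall x, ~ unit_cube x -> f x = 0).

Inductive restricted_analytic_graph (R : realType) :
    forall n, set 'rV[R]_n -> Prop :=
| RestrictedAnalyticGraph n (f : 'rV[R]_n -> R) : restricted_analytic f ->
    restricted_analytic_graph
      (graph_on setT (fun x => const_mx (f x) : 'rV[R]_1)).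

(* The sets definable in R_an are the globally subanalytic ones. *)
Definition R_an (R : realType) : structure R :=
  @restricted_analytic_graph R.
Arguments R_an : clear implicits.

Definition constructible (R : realType) n (A : set 'rV[R]_n)
    (F : 'rV[R]_n -> R) : Prop :=
  exists (N : nat) (L : 'I_N -> nat) (f : 'I_N -> 'rV[R]_n -> R)
         (g : forall i : 'I_N, 'I_(L i) -> 'rV[R]_n -> R),
    [/\ forall i, definable_fun (R_an R) A (f i),
        forall i j, definable_fun (R_an R) A (g i j),
        forall i j x, A x -> 0 < g i j x &
        forall x, A x -> F x = \sum_i f i x * \prod_j ln (g i j x)].

(* Intended for open U. *)
Definition C1_on (R : realType) n (W : normedModType R) (U : set 'rV[R]_n)
    (f : 'rV[R]_n -> W) : Prop :=
  (forall u, U u -> differentiable f u) /\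
  (forall v, {within U, continuous (fun u => 'd f u v)}).

(* The values of chart_map outside chart_dom, and of chart_inv outside
   chart_img, are irrelevant. *)
Record chart (R : realType) (M : structure R) (X : topologicalType) (n : nat) :=
  Chart {
    chart_dom : set X;
    chart_img : set 'rV[R]_n;
    chart_map : X -> 'rV[R]_n;
    chart_inv : 'rV[R]_n -> X;
    chart_dom_open : open chart_dom;
    chart_img_open : open chart_img;
    chart_img_definable : definable M chart_img;
    chart_map_img : forall x, chart_dom x -> chart_img (chart_map x);
    chart_inv_dom : forall u, chart_img u -> chart_dom (chart_inv u);
    chart_mapK : forall x, chart_dom x -> chart_inv (chart_map x) = x;
    chart_invK : forall u, chart_img u -> chart_map (chart_inv u) = u;
    chart_map_continuous : {within chart_dom, continuous chart_map};
    chart_inv_continuous : {within chart_img, continuous chart_inv}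
  }.

(* Two atlases are equivalent when their union is an atlas; a manifold is given
   by one representative, and "in all charts" below means in its charts.
   chart_inv is total, so a chart forces the space to be nonempty; the empty
   manifold is given by the empty atlas. *)
Record manifold (R : realType) (M : structure R) := Manifold {
  mspace :> topologicalType;
  mdim : nat;
  msize : nat;
  mchart : 'I_msize -> chart M mspace mdim;
  mspace_hausdorff : hausdorff_space mspace;
  mchart_cover : forall x, exists i, chart_dom (mchart i) x;
  mchart_transition : forall i j,
    let V := chart_img (mchart i) `&`
             chart_inv (mchart i) @^-1` chart_dom (mchart j) in
    let h := chart_map (mchart j) \o chart_inv (mchart i) in
    definable_map M V h /\ C1_on V h
}.

Definition definable_C1_map (R : realType) (M : structure R)
    (Y X : manifold M) (f : Y -> X) : Prop :=
  continuous f /\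
  forall (j : 'I_(msize Y)) (i : 'I_(msize X)),
    let V := chart_img (mchart j) `&`
             (f \o chart_inv (mchart j)) @^-1` chart_dom (mchart i) in
    let h := chart_map (mchart i) \o f \o chart_inv (mchart j) in
    definable_map M V h /\ C1_on V h.

Definition definable_subset (R : realType) (M : structure R) (N : structure R)
    (X : manifold M) (U : set X) : Prop :=
  forall i : 'I_(msize X),
    definable N (chart_img (mchart i) `&` chart_inv (mchart i) @^-1` U).

(* Alternating k-linear forms on R^n; the k arguments are the rows of a matrix,
   as for the determinant. *)
Record alt (R : realType) (n k : nat) := Alt {
  alt_fun :> 'M[R]_(k, n) -> R;
  alt_multilinear : forall (A B C : 'M[R]_(k, n)) (i : 'I_k) (b c : R),
    row i A = b *: row i B + c *: row i C ->
    row' i B = row' i A -> row' i C = row' i A ->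
    alt_fun A = b * alt_fun B + c * alt_fun C;
  alt_alternating : forall (A : 'M[R]_(k, n)) (i j : 'I_k),
    i != j -> A i =1 A j -> alt_fun A = 0
}.

HB.instance Definition _ (R : realType) n k := gen_eqMixin (alt R n k).
HB.instance Definition _ (R : realType) n k := gen_choiceMixin (alt R n k).

Program Definition alt0 (R : realType) n k : alt R n k := @Alt R n k (fun=> 0) _ _.
Next Obligation. by move=> *; rewrite !mulr0 addr0. Qed.
Next Obligation. by []. Qed.

(* Pullback of an alternating form along the linear map v |-> v *m J. *)
Program Definition alt_pull (R : realType) m n k (J : 'M[R]_(m, n))
    (t : alt R n k) : alt R m k := @Alt R m k (fun A => t (A *m J)) _ _.
Next Obligation.
move=> R m n k J t A B C i b c hA hB hC.
apply: (@alt_multilinear _ _ _ t _ _ _ i).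
- by rewrite !row_mul hA mulmxDl !scalemxAl.
- by rewrite !row'Esub -!mul_rowsub_mx -!row'Esub hB.
- by rewrite !row'Esub -!mul_rowsub_mx -!row'Esub hC.
Qed.
Next Obligation.
move=> R m n k J t A i j ij hA; apply: (@alt_alternating _ _ _ t _ _ _ ij) => l.
by rewrite !mxE; apply: eq_bigr => p _; rewrite hA.
Qed.

Definition tchart (R : realType) (M : structure R) (X : manifold M) (x : X) :
    chart M X (mdim X) :=
  mchart (sval (cid (mchart_cover x))).

(* The tangent space at x is R^n, a tangent vector being given by its
   coordinates in the chart tchart x; so a (not necessarily continuous) k-form
   is an arbitrary function to alternating forms on R^n. *)
Definition kform (R : realType) (M : structure R) (X : manifold M) (k : nat) :
    Type := X -> alt R (mdim X) k.

(* The matrix of T_y f, in the above identifications. *)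
Definition tangent_mx (R : realType) (M : structure R) (Y X : manifold M)
    (f : Y -> X) (y : Y) : 'M[R]_(mdim Y, mdim X) :=
  jacobian (chart_map (tchart (f y)) \o f \o chart_inv (tchart y))
    (chart_map (tchart y) y).

Definition pullback (R : realType) (M : structure R) (Y X : manifold M)
    (f : Y -> X) (k : nat) (w : kform X k) : kform Y k :=
  fun y => alt_pull (tangent_mx f y) (w (f y)).

(* The expression of w in the i-th chart, i.e. its pullback by the i-th inverse
   chart; meaningful on chart_img (mchart i). *)
Definition in_chart (R : realType) (M : structure R) (X : manifold M) k
    (w : kform X k) (i : 'I_(msize X)) (u : 'rV[R]_(mdim X)) :
    alt R (mdim X) k :=
  let x := chart_inv (mchart i) u in
  alt_pull (jacobian (chart_map (tchart x) \o chart_inv (mchart i)) u) (w x).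

(* The coefficient of du_(I 0) /\ ... /\ du_(I (k-1)) in the i-th chart. *)
Definition coef (R : realType) (M : structure R) (X : manifold M) k
    (w : kform X k) (i : 'I_(msize X)) (I : 'I_k -> 'I_(mdim X))
    (u : 'rV[R]_(mdim X)) : R :=
  in_chart w i u (rowsub I 1%:M).

Definition increasing k n (I : 'I_k -> 'I_n) : Prop :=
  forall a b : 'I_k, (a < b)%N -> (I a < I b)%N.

(* A class of functions on subsets of the spaces R^n, here the definable or the
   constructible ones. *)
Definition funclass (R : realType) : Type :=
  forall n, set 'rV[R]_n -> ('rV[R]_n -> R) -> Prop.

Definition E0 (R : realType) (M : structure R) (F : funclass R)
    (X : manifold M) k : set (kform X k) :=
  [set w | forall i I, increasing I ->
    {within chart_img (mchart i), continuous (coef w i I)} /\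
    F _ (chart_img (mchart i)) (coef w i I)].

(* The exterior derivative of a form on an open set of R^n, evaluated at u on
   the vectors row 0 A, ..., row k A. *)
Definition ext_deriv (R : realType) n k (w : 'rV[R]_n -> alt R n k)
    (u : 'rV[R]_n) (A : 'M[R]_(k.+1, n)) : R :=
  \sum_(r < k.+1)
    (-1) ^+ r * 'D_(row r A) (fun u' => w u' (row' r A) : R^o) u.

(* eta is the D of w: the coefficients of eta lie in the class F and the
   dense open set U is definable in N.  Since the transition maps are only C^1,
   being C^1 on U is required of the coefficients in each chart of the atlas. *)
Definition is_D (R : realType) (M N : structure R) (F : funclass R)
    (X : manifold M) k (w : kform X k) (eta : kform X k.+1) : Prop :=
  @E0 _ _ F X k.+1 eta /\
  exists U : set X,
    [/\ open U, dense U, definable_subset N U &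
      forall i : 'I_(msize X),
        let V := chart_img (mchart i) `&` chart_inv (mchart i) @^-1` U in
        (forall I, increasing I -> C1_on V (coef w i I : _ -> R^o)) /\
        (forall u, V u -> forall A, ext_deriv (in_chart w i) u A =
                                    in_chart eta i u A)].

Definition Omega0 (R : realType) (M N : structure R) (F : funclass R)
    (X : manifold M) k : set (kform X k) :=
  [set w | @E0 _ _ F X k w /\ exists eta, is_D N F w eta].

(* On Omega0 the chosen eta is the unique one; elsewhere D0 w is zero. *)
Definition D0 (R : realType) (M N : structure R) (F : funclass R)
    (X : manifold M) k (w : kform X k) : kform X k.+1 :=
  xget ((fun=> alt0 R (mdim X) k.+1) : kform X k.+1)
    [set eta | is_D N F w eta].

Definition Omega_def (R : realType) (M : structure R) (X : manifold M) k :
    set (kform X k) := @Omega0 R M M (@definable_fun R M) X k.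

Definition D_def (R : realType) (M : structure R) (X : manifold M) k :
    kform X k -> kform X k.+1 := @D0 R M M (@definable_fun R M) X k.

Definition Omega_con (R : realType) (M : structure R) (X : manifold M) k :
    set (kform X k) := @Omega0 R M (R_an R) (@constructible R) X k.

Definition D_con (R : realType) (M : structure R) (X : manifold M) k :
    kform X k -> kform X k.+1 := @D0 R M (R_an R) (@constructible R) X k.

(* Main.v *)
(* The identity [d (f^* w) = f^* (dw)] is local, and it is the chain rule and the
   symmetry of second derivatives wherever [f] is C^2 and maps into the set [O]
   where [w] is C^1.  Definable functions are C^2 on a dense open set, so only the
   second condition matters: the image of [f] may avoid [O].  As the complement of
   [O] is definable and nowhere dense, o-minimality provides, near a dense set of
   points, arbitrarily small constant translations [v] such that [f + v] maps a
   fixed ball into [O].  The identity holds for [f + v], whose Jacobian is that of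
   [f]; letting [v] tend to 0, both sides converge uniformly, and a continuous form
   which is the uniform limit of the exterior derivatives is the exterior
   derivative of the limit.  By continuity the identity then holds wherever [f^* w]
   is C^1.  Only the stability properties of [tame_class] are used of the class of
   coefficients, so the definable and the constructible cases are the same. *)
Require Import Defs.
From HB Require Import structures.
From mathcomp Require Import all_boot all_order all_algebra.
From mathcomp Require Import all_classical all_reals all_analysis.
From mathcomp Require Import perm.
From mathcomp Require Import ring lra zify.

Set Implicit Arguments.
Unset Strict Implicit.
Unset Printing Implicit Defensive.

Import Order.TTheory GRing.Theory Num.Theory.
Import numFieldNormedType.Exports.

Local Open Scope classical_set_scope.
Local Open Scope ring_scope.

(** * Definable predicates and functions *)

Section Definability.
Context (R : realType) (M : structure R).

(** Neither cell decomposition nor the monotonicity theorem is developed. O-minimality enters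
    through one fact: a definable predicate on the line has a constant truth value just to the right
    of each point. With rational parameters and Baire category this shows that every definable set,
    or its complement, contains an open part of any given open set, so that dense definable sets
    contain dense open ones. Continuity and C^1 regularity are therefore written with epsilons and
    deltas: as first-order conditions they are definable, and finding one good point in each open
    set is enough. Translations are chosen as perturbations because the Jacobian is unchanged: only
    the point at which the continuous forms [w] and [D w] are evaluated moves, so uniform closeness
    asks for no derivative of [w] near the image of [f]. The limit argument uses no integration:
    evaluated on [k + 1] vectors, an exterior derivative is a divergence on an affine image of
    R^(k+1), and a sum over a grid takes the place of Stokes' theorem. *)

Definition dpred n (P : 'rV[R]_n -> Prop) : Prop := definable M [set x | P x].

Lemma dpred_ext n (P Q : 'rV[R]_n -> Prop) :
  (forall x, P x <-> Q x) -> dpred P -> dpred Q.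
Proof.
by move=> PQ; rewrite /dpred (_ : [set x | P x] = [set x | Q x])//;
  apply/seteqP; split=> x /PQ.
Qed.

Lemma dpred_not n (P : 'rV[R]_n -> Prop) : dpred P -> dpred (fun x => ~ P x).
Proof. exact: definable_setC. Qed.

Lemma dpred_and n (P Q : 'rV[R]_n -> Prop) :
  dpred P -> dpred Q -> dpred (fun x => P x /\ Q x).
Proof. exact: definable_setI. Qed.

Lemma dpred_or n (P Q : 'rV[R]_n -> Prop) :
  dpred P -> dpred Q -> dpred (fun x => P x \/ Q x).
Proof.
move=> hP hQ; apply: (@dpred_ext _ (fun x => ~ (~ P x /\ ~ Q x))).
  by move=> x; rewrite not_andE !notK.
by apply: dpred_not; apply: dpred_and; apply: dpred_not.
Qed.

Lemma dpred_imp n (P Q : 'rV[R]_n -> Prop) :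
  dpred P -> dpred Q -> dpred (fun x => P x -> Q x).
Proof.
move=> hP hQ; apply: (@dpred_ext _ (fun x => ~ P x \/ Q x)).
  by move=> x; rewrite implyE.
by apply: dpred_or => //; apply: dpred_not.
Qed.

Lemma dpred_subst m n (s : 'I_m -> 'I_n) (P : 'rV[R]_m -> Prop) :
  dpred P -> dpred (fun x : 'rV[R]_n => P (\row_i x 0 (s i))).
Proof. exact: definable_subst. Qed.

Lemma dpred_ex n (P : 'rV[R]_n -> R -> Prop) :
  dpred (fun z : 'rV[R]_(n + 1) => P (lsubmx z) (rsubmx z 0 0)) ->
  dpred (fun x => exists t, P x t).
Proof.
move=> /definable_exists; apply: dpred_ext => x.
by split=> -[t] /=; rewrite ?row_mxKl ?row_mxKr ?mxE => ?; exists t;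
  rewrite ?row_mxKl ?row_mxKr ?mxE.
Qed.

Lemma dpred_all n (P : 'rV[R]_n -> R -> Prop) :
  dpred (fun z : 'rV[R]_(n + 1) => P (lsubmx z) (rsubmx z 0 0)) ->
  dpred (fun x => forall t, P x t).
Proof.
move=> /dpred_not /(@dpred_ex n (fun x t => ~ P x t))/dpred_not.
by apply: dpred_ext => x; rewrite -forallNE; split=> h t; have := h t;
  rewrite ?notK.
Qed.

Lemma dpred_true n : dpred (fun _ : 'rV[R]_n => True).
Proof.
apply: (@dpred_ext _ (fun=> exists t : R, t = 0)).
  by move=> _; split=> // _; exists 0.
apply: (@dpred_ex _ (fun _ t => t = 0)).
apply: dpred_ext (dpred_subst (fun=> rshift n ord0) (definable_cst M 0)) => x.
by rewrite /= !mxE.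
Qed.

Lemma dpred_const n (P : Prop) : dpred (fun _ : 'rV[R]_n => P).
Proof.
have [p|p] := pselect P; first by apply: dpred_ext (dpred_true n).
by apply: dpred_ext (dpred_not (dpred_true n)) => x; split.
Qed.

Lemma dpred_all_fin n (T : finType) (P : T -> 'rV[R]_n -> Prop) :
  (forall i, dpred (P i)) -> dpred (fun x => forall i, P i x).
Proof.
move=> hP; apply: (@dpred_ext _ (fun x => forall i, i \in enum T -> P i x)).
  by move=> x; split=> h i => [|_]; apply: h; rewrite ?mem_enum.
elim: (enum T) => [|a s ih]; first by apply: dpred_ext (dpred_true n).
apply: dpred_ext (dpred_and (hP a) ih) => x; split.
  by move=> [pa h] i; rewrite inE => /predU1P[->|/h].
move=> h; split; first by apply: h; rewrite mem_head.
by move=> i si; apply: h; rewrite inE si orbT.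
Qed.

Lemma dpred_ex_fin n (T : finType) (P : T -> 'rV[R]_n -> Prop) :
  (forall i, dpred (P i)) -> dpred (fun x => exists i, P i x).
Proof.
move=> hP; apply: dpred_ext (dpred_not (dpred_all_fin (fun i => dpred_not (hP i)))) => x.
split=> [/existsNP[i /contrapT Pi]|[i Pi] h]; first by exists i.
exact: h i Pi.
Qed.

Lemma dpred_exv n m (P : 'rV[R]_n -> 'rV[R]_m -> Prop) :
  dpred (fun z : 'rV[R]_(n + m) => P (lsubmx z) (rsubmx z)) ->
  dpred (fun x => exists y, P x y).
Proof.
elim: m P => [|m ih] P hP.
  apply: dpred_ext (dpred_subst (fun i => cast_ord (addn0 n) i) hP) => x.
  set z := \row_i _; have -> : lsubmx z = x.
    by apply/rowP => i; rewrite !mxE; congr (x _ _); apply: val_inj.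
  split=> [h|[y]]; first by exists (rsubmx z).
  by congr P; apply/rowP; case.
pose c (y : 'rV[R]_m) t : 'rV[R]_m.+1 := \row_i oapp (y 0) t (unlift ord0 i).
apply: (@dpred_ext _ (fun x => exists y', exists t, P x (c y' t))).
  move=> x; split=> [[y' [t h]]|[y h]]; first by exists (c y' t).
  exists (\row_i y 0 (lift ord0 i)), (y 0 0).
  rewrite (_ : c _ _ = y)//; apply/rowP => i; rewrite mxE.
  by case: unliftP => [j|] ->//=; rewrite mxE.
apply: ih; apply: (@dpred_ex _ (fun z t => P (lsubmx z) (c (rsubmx z) t))).
(* Only the last variable can be quantified, whereas [c] makes the new coordinate the first one of
   [y]: [s] renumbers the variables accordingly. *)
pose s (i : 'I_(n + m.+1)) : 'I_(n + m + 1) := match fintype.split i with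
  | inl j => lshift 1 (lshift m j)
  | inr j => oapp (fun k => lshift 1 (rshift n k)) (rshift _ 0) (unlift ord0 j)
  end.
apply: dpred_ext (dpred_subst s hP) => x.
set z := \row_i _; have -> : lsubmx z = lsubmx (lsubmx x).
  by apply/rowP => i; rewrite !mxE /s (unsplitK (inl i)).
suff -> : rsubmx z = c (rsubmx (lsubmx x)) (rsubmx x 0 0) by [].
apply/rowP => i; rewrite !mxE /s (unsplitK (inr i)).
by case: unliftP => [j _|_] /=; rewrite ?mxE.
Qed.

Lemma dpred_allv n m (P : 'rV[R]_n -> 'rV[R]_m -> Prop) :
  dpred (fun z : 'rV[R]_(n + m) => P (lsubmx z) (rsubmx z)) ->
  dpred (fun x => forall y, P x y).
Proof.
move=> /dpred_not /(@dpred_exv n m (fun x t => ~ P x t))/dpred_not.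
by apply: dpred_ext => x; rewrite -forallNE; split=> h t; have := h t;
  rewrite ?notK.
Qed.

(** Functions are total here, with a definable graph over the whole space, so that terms compose
    without side conditions on domains. Partial functions come in later through their extension by
    zero. *)
Definition dfun n (t : 'rV[R]_n -> R) : Prop :=
  dpred (fun z : 'rV[R]_(n + 1) => t (lsubmx z) = rsubmx z 0 0).

Definition dmap n m (h : 'rV[R]_n -> 'rV[R]_m) : Prop :=
  forall i, dfun (fun x => h x 0 i).

Lemma dfun_ext n (t u : 'rV[R]_n -> R) : t =1 u -> dfun t -> dfun u.
Proof. by move=> /funext ->. Qed.

Lemma dmap_coord n m (h : 'rV[R]_n -> 'rV[R]_m) i j :
  dmap h -> dfun (fun x => h x j i).
Proof. by rewrite (ord1 j). Qed.

(** [definable] only substitutes variables for variables; a map [h] is substituted by quantifying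
    over its value [y]. *)
Lemma dpred_comp n m (P : 'rV[R]_m -> Prop) (h : 'rV[R]_n -> 'rV[R]_m) :
  dpred P -> dmap h -> dpred (fun x => P (h x)).
Proof.
move=> hP hh.
apply: (@dpred_ext _
  (fun x => exists y : 'rV[R]_m, (forall i, h x 0 i = y 0 i) /\ P y)).
  move=> x; split=> [[y [/rowP <-]]//|Px]; by exists (h x).
apply: dpred_exv; apply: dpred_and; last first.
  have := dpred_subst (@rshift n m) hP; apply: dpred_ext => x.
  by rewrite (_ : \row_i _ = rsubmx x)//; apply/rowP => i; rewrite !mxE.
apply: dpred_all_fin => i.
pose s (j : 'I_(n + 1)) : 'I_(n + m) := match fintype.split j with
  | inl j => lshift m j | inr j => rshift n i end.
apply: dpred_ext (dpred_subst s (hh i)) => x.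
rewrite !mxE /s (unsplitK (inr _)) (_ : lsubmx _ = lsubmx x)//.
by apply/rowP => j; rewrite !mxE (unsplitK (inl _)).
Qed.

Lemma dmap_id n : dmap (fun x : 'rV[R]_n => x).
Proof.
move=> i; pose s (j : 'I_2) : 'I_(n + 1) :=
  if j == 0 then lshift 1 i else rshift n 0.
apply: dpred_ext (dpred_subst s (definable_eq M)) => x.
by rewrite /= !mxE.
Qed.

Lemma dfun_subst m n (s : 'I_m -> 'I_n) (t : 'rV[R]_m -> R) :
  dfun t -> dfun (fun x : 'rV[R]_n => t (\row_i x 0 (s i))).
Proof.
move=> ht; pose s' (j : 'I_(m + 1)) : 'I_(n + 1) := match fintype.split j with
  | inl j => lshift 1 (s j) | inr j => rshift n j end.
apply: dpred_ext (dpred_subst s' ht) => x.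
rewrite !mxE /s' (unsplitK (inr _)) (_ : lsubmx _ = \row_i (lsubmx x) 0 (s i))//.
by apply/rowP => i; rewrite !mxE (unsplitK (inl _)).
Qed.

Lemma dmap_lsub0 n m : dmap (@lsubmx R 1 n m).
Proof.
move=> i; apply: dfun_ext (dfun_subst (fun=> lshift m i) (@dmap_id 1 0)) => x.
by rewrite !mxE.
Qed.

Lemma dmap_rsub0 n m : dmap (@rsubmx R 1 n m).
Proof.
move=> i; apply: dfun_ext (dfun_subst (fun=> rshift n i) (@dmap_id 1 0)) => x.
by rewrite !mxE.
Qed.

Lemma dfun_weak n m (t : 'rV[R]_n -> R) :
  dfun t -> dfun (fun z : 'rV[R]_(n + m) => t (lsubmx z)).
Proof.
move=> /(dfun_subst (lshift m)); apply: dfun_ext => x; congr t.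
by apply/rowP => i; rewrite !mxE.
Qed.

Lemma dfun_comp n m (g : 'rV[R]_m -> R) (h : 'rV[R]_n -> 'rV[R]_m) :
  dfun g -> dmap h -> dfun (fun x => g (h x)).
Proof.
move=> hg hh.
have hz : dmap (fun z : 'rV[R]_(n + 1) => row_mx (h (lsubmx z)) (rsubmx z)).
  move=> i; case: (split_ordP i) => j ->.
    by apply: dfun_ext (dfun_weak 1 (hh j)) => x; rewrite row_mxEl.
  by apply: dfun_ext (@dmap_rsub0 n 1 j) => x; rewrite row_mxEr.
by have := dpred_comp hg hz; apply: dpred_ext => x; rewrite row_mxKl row_mxKr.
Qed.

Lemma dmap_comp n m p (g : 'rV[R]_m -> 'rV[R]_p) (h : 'rV[R]_n -> 'rV[R]_m) :
  dmap g -> dmap h -> dmap (fun x => g (h x)).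
Proof. by move=> hg hh i; exact: dfun_comp (hg i) hh. Qed.

Lemma dmap_lsub n m p (h : 'rV[R]_p -> 'rV[R]_(n + m)) :
  dmap h -> dmap (fun x => lsubmx (h x)).
Proof. exact: dmap_comp (@dmap_lsub0 n m). Qed.

Lemma dmap_rsub n m p (h : 'rV[R]_p -> 'rV[R]_(n + m)) :
  dmap h -> dmap (fun x => rsubmx (h x)).
Proof. exact: dmap_comp (@dmap_rsub0 n m). Qed.

Lemma dmap_row n m (t : 'I_m -> 'rV[R]_n -> R) :
  (forall i, dfun (t i)) -> dmap (fun x => \row_i t i x).
Proof. by move=> ht i; apply: dfun_ext (ht i) => x; rewrite mxE. Qed.

Lemma dmap_row_mx n m p (g : 'rV[R]_n -> 'rV[R]_m) (h : 'rV[R]_n -> 'rV[R]_p) :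
  dmap g -> dmap h -> dmap (fun x => row_mx (g x) (h x)).
Proof.
move=> hg hh i; case: (split_ordP i) => j ->.
  by apply: dfun_ext (hg j) => x; rewrite row_mxEl.
by apply: dfun_ext (hh j) => x; rewrite row_mxEr.
Qed.

Lemma dfun_cst n (a : R) : dfun (fun _ : 'rV[R]_n => a).
Proof.
apply: dpred_ext (dpred_subst (fun=> rshift n ord0) (definable_cst M a)) => x.
by rewrite /= !mxE; split.
Qed.

Lemma dmap_cst n m (a : 'rV[R]_m) : dmap (fun _ : 'rV[R]_n => a).
Proof. by move=> i; exact: dfun_cst. Qed.

Lemma dpred_fun2 n (P : R -> R -> Prop) (t u : 'rV[R]_n -> R) :
  dpred (fun x : 'rV[R]_2 => P (x 0 0) (x 0 1)) -> dfun t -> dfun u ->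
  dpred (fun x => P (t x) (u x)).
Proof.
move=> hP ht hu.
pose h x : 'rV[R]_2 := \row_i (if i == 0 then t x else u x).
have hh : dmap h by apply: dmap_row => i; case: (i == 0).
by apply: dpred_ext (dpred_comp hP hh) => x; rewrite /h !mxE.
Qed.

Lemma dpred_eq n (t u : 'rV[R]_n -> R) :
  dfun t -> dfun u -> dpred (fun x => t x = u x).
Proof. exact: (@dpred_fun2 _ eq _ _ (definable_eq M)). Qed.

Lemma dpred_lt n (t u : 'rV[R]_n -> R) :
  dfun t -> dfun u -> dpred (fun x => t x < u x).
Proof. exact: (@dpred_fun2 _ (fun a b => a < b) _ _ (definable_lt M)). Qed.

Lemma dpred_le n (t u : 'rV[R]_n -> R) :
  dfun t -> dfun u -> dpred (fun x => t x <= u x).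
Proof.
move=> ht hu; apply: dpred_ext (dpred_not (dpred_lt hu ht)) => x.
by split; [move=> /negP; rewrite -leNgt | rewrite leNgt => /negP].
Qed.

Lemma dfun_op2 n (o : R -> R -> R) (t u : 'rV[R]_n -> R) :
  dpred (fun x : 'rV[R]_3 => o (x 0 0) (x 0 1) = x 0 (inord 2)) ->
  dfun t -> dfun u -> dfun (fun x => o (t x) (u x)).
Proof.
move=> ho ht hu.
pose h (z : 'rV[R]_(n + 1)) : 'rV[R]_3 := \row_(i < 3)
  (if i == 0 then t (lsubmx z) else if i == 1 then u (lsubmx z) else rsubmx z 0 0).
have hh : dmap h.
  apply: dmap_row => i; case: (i == 0); first exact: dfun_weak.
  by case: (i == 1); [exact: dfun_weak|exact: dmap_rsub0].
apply: dpred_ext (dpred_comp ho hh) => x; rewrite /h !mxE !eqxx /=.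
by rewrite -!val_eqE /= inordK.
Qed.

Lemma dfun_add n (t u : 'rV[R]_n -> R) :
  dfun t -> dfun u -> dfun (fun x => t x + u x).
Proof. exact: (@dfun_op2 n _ t u (definable_add M)). Qed.

Lemma dfun_mul n (t u : 'rV[R]_n -> R) :
  dfun t -> dfun u -> dfun (fun x => t x * u x).
Proof. exact: (@dfun_op2 n _ t u (definable_mul M)). Qed.

Lemma dfun_opp n (t : 'rV[R]_n -> R) : dfun t -> dfun (fun x => - t x).
Proof.
move=> ht; apply: dfun_ext (dfun_mul (dfun_cst n (-1)) ht) => x.
by rewrite mulN1r.
Qed.

Lemma dfun_sub n (t u : 'rV[R]_n -> R) :
  dfun t -> dfun u -> dfun (fun x => t x - u x).
Proof. by move=> ht hu; apply: dfun_add => //; apply: dfun_opp. Qed.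

Lemma dfun_if n (P : 'rV[R]_n -> Prop) (t u : 'rV[R]_n -> R) :
  dpred P -> dfun t -> dfun u -> dfun (fun x => if `[< P x >] then t x else u x).
Proof.
move=> hP ht hu.
have hP' : dpred (fun z : 'rV[R]_(n + 1) => P (lsubmx z)).
  by apply: dpred_comp => //; exact: dmap_lsub0.
apply: (@dpred_ext _ (fun z => (P (lsubmx z) /\ t (lsubmx z) = rsubmx z 0 0) \/
   (~ P (lsubmx z) /\ u (lsubmx z) = rsubmx z 0 0))).
  by move=> x; case: asboolP => h; tauto.
by apply: dpred_or; apply: dpred_and => //; apply: dpred_not.
Qed.

Lemma dfun_abs n (t : 'rV[R]_n -> R) : dfun t -> dfun (fun x => `|t x|).
Proof.
move=> ht.
have h : dpred (fun x => t x < 0) by apply: dpred_lt => //; exact: dfun_cst.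
apply: dfun_ext (dfun_if h (dfun_opp ht) ht) => x.
case: asboolP => [/ltr0_norm->//|/negP]; rewrite -leNgt; by move/ger0_norm ->.
Qed.

Lemma dmap_add n m (g h : 'rV[R]_n -> 'rV[R]_m) :
  dmap g -> dmap h -> dmap (fun x => g x + h x).
Proof.
by move=> hg hh i; apply: dfun_ext (dfun_add (hg i) (hh i)) => x; rewrite mxE.
Qed.

Lemma dmap_scale n m (t : 'rV[R]_n -> R) (h : 'rV[R]_n -> 'rV[R]_m) :
  dfun t -> dmap h -> dmap (fun x => t x *: h x).
Proof.
by move=> ht hh i; apply: dfun_ext (dfun_mul ht (hh i)) => x; rewrite mxE.
Qed.

Lemma dmap_opp n m (h : 'rV[R]_n -> 'rV[R]_m) :
  dmap h -> dmap (fun x => - h x).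
Proof. by move=> hh i; apply: dfun_ext (dfun_opp (hh i)) => x; rewrite mxE. Qed.

Lemma dmap_const n m (t : 'rV[R]_n -> R) :
  dfun t -> dmap (fun x => const_mx (t x) : 'rV[R]_m).
Proof. by move=> ht i; apply: dfun_ext ht => x; rewrite mxE. Qed.

Lemma dfun_comp1 n (g : R -> R) (t : 'rV[R]_n -> R) :
  dfun (fun x : 'rV[R]_1 => g (x 0 0)) -> dfun t -> dfun (fun x => g (t x)).
Proof.
move=> hg ht; have := dfun_comp hg (@dmap_const n 1 t ht).
by apply: dfun_ext => x; rewrite !mxE.
Qed.

Lemma dpred_comp1 n (P : R -> Prop) (t : 'rV[R]_n -> R) :
  dpred (fun x : 'rV[R]_1 => P (x 0 0)) -> dfun t -> dpred (fun x => P (t x)).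
Proof.
move=> hP ht; have := dpred_comp hP (@dmap_const n 1 t ht).
by apply: dpred_ext => x; rewrite !mxE.
Qed.

(** Entrywise inequalities make balls definable. The conjunct [0 < e] does not follow from them when
    the matrix has no entries. *)
Lemma ballE m n (x y : 'M[R]_(m, n)) (e : R) :
  ball x e y <-> 0 < e /\ forall i j, `|x i j - y i j| < e.
Proof. by split=> -[]. Qed.

Lemma dpred_ball n m (g h : 'rV[R]_n -> 'rV[R]_m) (t : 'rV[R]_n -> R) :
  dmap g -> dmap h -> dfun t -> dpred (fun x => ball (g x) (t x) (h x)).
Proof.
move=> hg hh ht.
apply: (@dpred_ext _ (fun x => 0 < t x /\ forall i : 'I_1, forall j, `|g x i j - h x i j| < t x)).
  by move=> x; rewrite ballE.
apply: dpred_and; first by apply: dpred_lt => //; exact: dfun_cst.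
apply: dpred_all_fin => i; rewrite (ord1 i); apply: dpred_all_fin => j.
by apply: dpred_lt => //; apply: dfun_abs; apply: dfun_sub.
Qed.

End Definability.

(** One rule per closure property of first-order formulas and terms. The rules for constants fit
    every goal of their kind and fail when the bound variable occurs; the closure hypotheses of the
    context come after them. *)
Ltac dtac := repeat (cbv beta delta [mkset]; match goal with
  | |- dpred _ (fun x => _ /\ _) => eapply dpred_and
  | |- dpred _ (fun x => _ \/ _) => eapply dpred_or
  | |- dpred _ (fun x => ~ _) => eapply dpred_not
  | |- dpred _ (fun x => exists t : Num.NumDomain.sort _, _) => eapply dpred_ex
  | |- dpred _ (fun x => exists y : 'rV[_]_(_), _) => eapply dpred_exv
  | |- dpred _ (fun x => exists i : 'I__, _) => eapply dpred_ex_fin; intro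
  | |- dpred _ (fun x => forall y : 'rV[_]_(_), _) => eapply dpred_allv
  | |- dpred _ (fun x => forall i : 'I__, _) => eapply dpred_all_fin; intro
  | |- dpred _ (fun x => ball _ _ _) => eapply dpred_ball
  | |- dpred _ (fun x => is_true (_ < _)) => eapply dpred_lt
  | |- dpred _ (fun x => is_true (_ <= _)) => eapply dpred_le
  | |- dpred _ (fun x => @eq (_ _) _ _) => eapply dpred_eq
  | |- dpred _ (fun x => _ -> _) => eapply dpred_imp
  | |- dpred _ (fun x => exists t, _) => (eapply dpred_ex || eapply dpred_exv)
  | |- dpred _ (fun x => forall t, _) => (eapply dpred_all || eapply dpred_allv)
  | |- dfun _ (fun x => (_ : 'rV[_]_(_)) _ _) => eapply dmap_coord
  | |- dfun _ (fun x => _ + _) => eapply dfun_add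
  | |- dfun _ (fun x => - _) => eapply dfun_opp
  | |- dfun _ (fun x => _ * _) => eapply dfun_mul
  | |- dfun _ (fun x => `|_|) => eapply dfun_abs
  | |- dfun _ (fun x => _) => eapply dfun_cst
  | |- dmap _ (fun x => x) => eapply dmap_id
  | |- dmap _ (@lsubmx _ _ _ _) => eapply dmap_lsub0
  | |- dmap _ (@rsubmx _ _ _ _) => eapply dmap_rsub0
  | |- dmap _ (fun x => lsubmx _) => eapply dmap_lsub
  | |- dmap _ (fun x => rsubmx _) => eapply dmap_rsub
  | |- dmap _ (fun x => row_mx _ _) => eapply dmap_row_mx
  | |- dmap _ (fun x => const_mx _) => eapply dmap_const
  | |- dmap _ (fun x => _ + _) => eapply dmap_add
  | |- dmap _ (fun x => - _) => eapply dmap_opp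
  | |- dmap _ (fun x => _ *: _) => eapply dmap_scale
  | |- dmap _ (fun x => _) => eapply dmap_cst
  | H : dfun _ (fun x => ?g (fun_of_matrix x _ _)) |- dfun _ (fun x => ?g _) => eapply (dfun_comp1 H)
  | H : dpred _ (fun x => ?g (fun_of_matrix x _ _)) |- dpred _ (fun x => ?g _) => eapply (dpred_comp1 H)
  | H : dfun _ ?g |- dfun _ (fun x => ?g _) => eapply (dfun_comp H)
  | H : dmap _ ?g |- dmap _ (fun x => ?g _) => eapply (dmap_comp H)
  | H : dpred _ ?P |- dpred _ (fun x => ?P _) => eapply (dpred_comp H)
  | |- _ => eassumption
  end).

(** * Generic sets and germs *)

Section Generic.

(** Containing a dense open set is stable under finite intersections, which density alone is not,
    and countable intersections remain dense by Baire's theorem. *)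
Definition generic (T : topologicalType) (P : set T) : Prop := dense P°.

Context (T : topologicalType).
Implicit Types P Q O : set T.

Lemma genericP P : generic P <-> forall O, open O -> O !=set0 ->
  exists V, [/\ open V, V !=set0, V `<=` O & V `<=` P].
Proof.
split=> [gP O oO O0|h O O0 oO].
  exists (O `&` P°); split; first by apply: openI => //; exact: open_interior.
  - exact: gP.
  - by move=> x [].
  - by move=> x [_ /interior_subset].
have [V [oV [x Vx] VO VP]] := h O oO O0.
exists x; split; first exact: VO.
by apply: filterS VP _; exact: open_nbhs_nbhs.
Qed.

Lemma generic_sub P Q : P `<=` Q -> generic P -> generic Q.
Proof.
move=> PQ /genericP h; apply/genericP => O oO O0.
have [V [? ? ? ?]] := h O oO O0; exists V; split => //.
exact: subset_trans PQ.
Qed.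

Lemma generic_and P Q : generic P -> generic Q -> generic (P `&` Q).
Proof.
move=> /genericP hP /genericP hQ; apply/genericP => O oO O0.
have [V [oV nV VO VP]] := hP O oO O0.
have [W [oW nW WV WQ]] := hQ V oV nV.
exists W; split => //; first exact: subset_trans VO.
by move=> x Wx; split; [exact/VP/WV|exact: WQ].
Qed.

Lemma genericT : generic [set: T].
Proof. by apply/genericP => O oO O0; exists O; split. Qed.

Lemma generic_all_fin (I : finType) (P : I -> set T) :
  (forall i, generic (P i)) -> generic [set x | forall i, P i x].
Proof.
move=> hP.
apply: (@generic_sub [set x | forall i, i \in enum I -> P i x]).
  by move=> x h i; apply: h; rewrite mem_enum.
elim: (enum I) => [|a s ih]; first by refine (generic_sub _ genericT) => x _ i.
apply: generic_sub (generic_and (hP a) ih) => x [pa h] i.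
by rewrite inE => /predU1P[->|/h].
Qed.

Lemma generic_interior P : generic P -> generic P°.
Proof. by rewrite /generic; have /interior_id -> := @open_interior _ P. Qed.

Lemma generic_nonempty P O : generic P -> open O -> O !=set0 ->
  exists x, O x /\ P x.
Proof.
by move=> /genericP h oO O0; have [V [_ [x ?] ? ?]] := h O oO O0; exists x; auto.
Qed.

End Generic.

HB.instance Definition _ (R : realType) m n := Complete.on 'M[R]_(m, n).

Section Matrices.
Context (R : realType).

Lemma ball_open_nbhs m n (x : 'M[R]_(m, n)) e : 0 < e -> open (ball x e) /\ ball x e x.
Proof. by move=> e0; split; [exact: ball_open|exact: ballxx]. Qed.

Lemma open_ballP m n (O : set 'M[R]_(m, n)) x : open O -> O x ->
  exists2 e, 0 < e & ball x e `<=` O.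
Proof. by move=> oO Ox; apply/nbhs_ballP; exact: open_nbhs_nbhs. Qed.

Lemma continuous_lsubmx n m : continuous (@lsubmx R 1 n m).
Proof. by move=> v; exact/differentiable_continuous/differentiable_lsubmx. Qed.

Lemma continuous_rsubmx n m : continuous (@rsubmx R 1 n m).
Proof. by move=> v; exact/differentiable_continuous/differentiable_rsubmx. Qed.

(** Used with rational parameters: a condition on all reals is reduced to countably many definable
    ones, which then hold simultaneously at some point of any open set. *)
Lemma Baire_count n (J : countType) (F : J -> set 'rV[R]_n) :
  (forall i, generic (F i)) -> dense [set x | forall i, F i x].
Proof.
move=> hF; pose F' k := if unpickle k is Some i then (F i)° else setT.
have : forall k, open (F' k) /\ dense (F' k).
  move=> k; rewrite /F'; case: unpickle => [i|].
    by split; [exact: open_interior|exact: hF].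
  by split; [exact: openT|move=> O O0 _; rewrite setIT].
move=> /(@Baire R 'rV[R]_n) h O O0 oO.
have [x [Ox Fx]] := h O O0 oO; exists x; split => // i.
by have := Fx (pickle i) I; rewrite /F' pickleK => /interior_subset.
Qed.

End Matrices.

Section Germs.
Context (R : realType) (a : R).

Definition right_germ (P : R -> Prop) : Prop :=
  exists2 d, 0 < d & forall t, a < t < a + d -> P t.

Lemma right_germ_and (P Q : R -> Prop) :
  right_germ P -> right_germ Q -> right_germ (fun t => P t /\ Q t).
Proof.
move=> [d d0 hd] [e e0 he]; exists (Num.min d e); first by rewrite lt_min d0.
move=> t /andP[at0 td]; split; [apply: hd|apply: he]; rewrite at0/=;
  by apply: lt_le_trans td _; rewrite lerD2l ge_min lexx ?orbT.
Qed.

Lemma right_germ_sub (P Q : R -> Prop) :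
  (forall t, P t -> Q t) -> right_germ P -> right_germ Q.
Proof. by move=> h [d d0 hd]; exists d => // t /hd/h. Qed.

Lemma right_germ_ge (b : R) : a < b -> right_germ (fun t => t < b).
Proof.
move=> ab; exists (b - a); first by rewrite subr_gt0.
by move=> t; rewrite addrC subrK => /andP[].
Qed.

Lemma right_germ_gt (b : R) : b <= a -> right_germ (fun t => b < t).
Proof. by move=> ba; exists 1 => // t /andP[/(le_lt_trans ba)]. Qed.

(** The truth value of [P] is constant on some interval to the right of [a]. This weak consequence
    of being a finite union of intervals is what o-minimality is used for, and it passes easily
    through Boolean operations. *)
Definition tame_at (P : R -> Prop) : Prop :=
  right_germ P \/ right_germ (fun t => ~ P t).

Lemma tame_or (P Q : R -> Prop) :
  tame_at P -> tame_at Q -> tame_at (fun t => P t \/ Q t).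
Proof.
move=> [hP|hP]; first by left; apply: right_germ_sub hP; left.
move=> [hQ|hQ]; first by left; apply: right_germ_sub hQ; right.
by right; apply: right_germ_sub (right_germ_and hP hQ) => t []; tauto.
Qed.

Lemma tame_not (P : R -> Prop) : tame_at P -> tame_at (fun t => ~ P t).
Proof.
by move=> [|] h; [right|left] => //; apply: right_germ_sub h => t Pt nPt.
Qed.

Lemma tame_ext (P Q : R -> Prop) :
  (forall t, P t <-> Q t) -> tame_at P -> tame_at Q.
Proof.
move=> PQ [h|h]; [left|right]; apply: right_germ_sub h => t; first by rewrite PQ.
by rewrite -PQ.
Qed.

Lemma tame_and (P Q : R -> Prop) :
  tame_at P -> tame_at Q -> tame_at (fun t => P t /\ Q t).
Proof.
move=> hP hQ; apply: tame_ext (tame_not (tame_or (tame_not hP) (tame_not hQ))).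
by move=> t; rewrite not_orE !notK.
Qed.

Lemma tame_const (P : Prop) : tame_at (fun=> P).
Proof. by have [p|p] := pselect P; [left|right]; exists 1. Qed.

Lemma tame_lt (b : R) : tame_at (fun t => t < b).
Proof.
have [ab|ba] := ltP a b; first by left; exact: right_germ_ge.
right; apply: right_germ_sub (right_germ_gt ba) => t /ltW.
by rewrite leNgt => /negP.
Qed.

Lemma tame_gt (b : R) : tame_at (fun t => b < t).
Proof.
have [ab|ba] := ltP a b; last by left; exact: right_germ_gt.
right; apply: right_germ_sub (right_germ_ge ab) => t /ltW.
by rewrite leNgt => /negP.
Qed.

Lemma tame_itv (J : interval R) : tame_at (fun t => t \in J).
Proof.
case: J => l r.
apply: (@tame_ext (fun t => (l <= BLeft t)%O /\ (BRight t <= r)%O)).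
  by move=> t; rewrite itv_boundlr; split=> [[-> ->]|/andP[]].
apply: tame_and.
  case: l => [[] x|[]].
  - apply: tame_ext (tame_not (tame_lt x)) => t; rewrite bnd_simp leNgt.
    by split=> /negP.
  - by apply: tame_ext (tame_gt x) => t; rewrite bnd_simp.
  - by apply: tame_ext (tame_const True) => t; rewrite bnd_simp.
  - by apply: tame_ext (tame_const False) => t; rewrite bnd_simp.
case: r => [[] x|[]].
- by apply: tame_ext (tame_lt x) => t; rewrite bnd_simp.
- apply: tame_ext (tame_not (tame_gt x)) => t; rewrite bnd_simp leNgt.
  by split=> /negP.
- by apply: tame_ext (tame_const False) => t; rewrite bnd_simp.
- by apply: tame_ext (tame_const True) => t; rewrite bnd_simp.
Qed.

End Germs.

(** * Consequences of o-minimality *)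

Section OMinimal.
Context (R : realType) (M : structure R) (hM : o_minimal M).

Lemma definable_tame (P : R -> Prop) (a : R) :
  dpred M (fun x : 'rV[R]_1 => P (x 0 0)) -> tame_at a P.
Proof.
move=> /hM [s hs].
apply: (@tame_ext _ _ (fun t => exists2 J : interval R, J \in s & t \in J)).
  move=> t; rewrite -(_ : (const_mx t : 'rV[R]_1) 0 0 = t); last by rewrite mxE.
  by split=> /hs.
elim: s {hs} => [|J s ih].
  by apply: tame_ext (tame_const a False) => t; split=> // -[].
apply: tame_ext (tame_or (tame_itv a J) ih) => t; split.
  move=> [tJ|[K sK tK]]; first by exists J => //; rewrite mem_head.
  by exists K => //; rewrite inE sK orbT.
move=> [K]; rewrite inE => /predU1P[->|sK] tK; first by left.
by right; exists K.
Qed.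

(* Substitute for cell decomposition: a definable set has nowhere dense boundary.
   By induction on the dimension, the first coordinate is handled by
   o-minimality, with rational bounds for its intervals, and the remaining ones
   by the Baire category theorem. *)
Definition dichotomic n : Prop := forall (A : 'rV[R]_n -> Prop) (O : set 'rV[R]_n),
  dpred M A -> open O -> O !=set0 -> exists V, [/\ open V, V !=set0, V `<=` O &
    (forall x, V x -> A x) \/ (forall x, V x -> ~ A x)].

(** The dichotomy is a hypothesis because its own proof by induction uses this lemma one dimension
    lower. If no [S i] contained an open part of [O], the complement of each [S i] in [O] would be
    generic there, and Baire's theorem would give a point of [O] lying in none of them. *)
Lemma definable_category_of n (J : countType) (S : J -> 'rV[R]_n -> Prop)
    (O : set 'rV[R]_n) :
  dichotomic n -> (forall i, dpred M (S i)) -> open O -> O !=set0 ->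
  (forall x, O x -> exists i, S i x) ->
  exists i V, [/\ open V, V !=set0, V `<=` O & forall x, V x -> S i x].
Proof.
move=> hn hS oO O0 OS; apply: contrapT => h.
have hg i : generic [set x | ~ (O x /\ S i x)].
  apply/genericP => W oW W0.
  have [[x [Wx Ox]]|WO] := pselect (W `&` O !=set0); last first.
    by exists W; split => // x Wx [Ox _]; apply: WO; exists x.
  have [V [oV V0 VW [VS|VS]]] : exists V, [/\ open V, V !=set0, V `<=` W `&` O &
    (forall x, V x -> S i x) \/ (forall x, V x -> ~ S i x)].
  - by apply: hn => //; [exact: openI|exists x].
  - by exfalso; apply: h; exists i, V; split => // y /VW[].
  exists V; split => //; first by move=> y /VW[].
  by move=> y Vy [_ Sy]; exact: VS Vy Sy.
have [x [Ox hx]] := Baire_count hg O0 oO.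
by have [i Si] := OS x Ox; exact: hx i (conj Ox Si).
Qed.

Lemma dichotomy n : dichotomic n.
Proof.
elim: n => [|n ih] A O hA oO [x Ox].
  have xE (y : 'rV[R]_0) : y = x by apply/rowP; case.
  exists O; split => //; first by exists x.
  by have [Ax|Ax] := pselect (A x); [left|right] => y _; rewrite (xE y).
have [e e0 xeO] := open_ballP oO Ox.
change n.+1 with (1 + n)%N in A, O, x, hA, oO, Ox, xeO.
pose t0 := lsubmx x 0 0.
(* [S (p, q, b)] collects the [y] over which membership in [A] has the truth value [b] on the whole
   of ]p, q[, an interval within [e] of [t0]. O-minimality at [t0] puts each [y] in one of these
   countably many definable sets; one of them contains an open [V], and ]p, q[ times [V] is the open
   set sought. *)
pose S (k : rat * rat * bool) (y : 'rV[R]_n) : Prop :=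
  (t0 - e < ratr k.1.1 /\ ratr k.1.1 < ratr k.1.2 :> R /\ ratr k.1.2 < t0 + e) /\
  forall t : R, ratr k.1.1 < t /\ t < ratr k.1.2 ->
    if k.2 then A (row_mx (const_mx t) y) else ~ A (row_mx (const_mx t) y).
have hS k : dpred M (S k).
  apply: dpred_and; first exact: dpred_const.
  by rewrite /S; case: k.2; dtac.
have [oB Bx] := ball_open_nbhs (rsubmx x) e0.
have := @definable_category_of n _ S _ ih hS oB (ex_intro _ _ Bx).
case.
  move=> y yB.
  have ht : tame_at t0 (fun t => A (row_mx (const_mx t) y)).
    by apply: definable_tame; dtac.
  have {ht} [b [d d0 hd]] : exists b : bool, right_germ t0
      (fun t => if b then A (row_mx (const_mx t) y) else ~ A (row_mx (const_mx t) y)).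
    by case: ht => h; [exists true|exists false].
  have m0 : t0 < t0 + Num.min d e by rewrite ltrDl lt_min d0.
  have [q] := rat_in_itvoo m0; rewrite in_itv/= => /andP[q0 q1].
  have [p] := rat_in_itvoo q0; rewrite in_itv/= => /andP[p0 p1].
  exists (p, q, b); split => /=.
    split; first by apply: lt_trans p0; rewrite ltrBlDr ltrDl.
    by split => //; apply: lt_le_trans q1 _; rewrite lerD2l ge_min lexx orbT.
  move=> t [pt tq]; apply: hd; rewrite (lt_trans p0 pt)/=.
  apply: lt_trans tq (lt_le_trans q1 _).
  by rewrite lerD2l ge_min lexx.
move=> [[p q] b] [V [oV [y Vy] VO VS]].
exists [set z : 'rV[R]_(1 + n) | (ratr p < lsubmx z 0 0 /\ lsubmx z 0 0 < ratr q) /\ V (rsubmx z)].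
have [[pe [pq qe]] _] := VS y Vy; rewrite /= in pe pq qe.
have cl : continuous (fun z : 'rV[R]_(1 + n) => lsubmx z 0 0).
  move=> z; apply: (@continuous_comp _ _ _ _ (fun v : 'rV[R]_1 => v 0 0)).
    exact: continuous_lsubmx.
  exact: coord_continuous.
split.
- apply: openI; last exact: (open_comp (fun z _ => @continuous_rsubmx R 1 n z) oV).
  apply: openI.
  + exact: (open_comp (fun z _ => cl z) (@open_gt R (ratr p))).
  + exact: (open_comp (fun z _ => cl z) (@open_lt R (ratr q))).
- have [t] := rat_in_itvoo pq; rewrite in_itv/= => /andP[t1 t2].
  exists (row_mx (const_mx (ratr t) : 'rV[R]_1) y : 'rV[R]_(1 + n)).
  by split; rewrite /= ?row_mxKl ?row_mxKr ?mxE.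
- move=> z [[z1 z2] Vz]; apply: xeO; apply/ballE; split => // i j.
  rewrite (ord1 i); case: (split_ordP j) => k -> /=.
    rewrite (ord1 k); move: z1 z2 pe qe; rewrite /t0 !mxE => z1 z2 pe qe.
    by rewrite ltr_distl; apply/andP; split; lra.
  by have /ballE[_ /(_ 0 k)] := VO _ Vz; rewrite !mxE.
have AE z : A z = A (row_mx (const_mx (lsubmx z 0 0)) (rsubmx z)).
  congr A; rewrite -[LHS]hsubmxK; congr row_mx.
  by apply/rowP => i; rewrite !mxE (ord1 i).
case: b {VO} VS => VS; [left|right] => z [zpq Vz]; rewrite AE.
  by have [_ /(_ _ zpq)] := VS _ Vz.
by have [_ /(_ _ zpq)] := VS _ Vz.
Qed.

Lemma definable_category n (J : countType) (S : J -> 'rV[R]_n -> Prop)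
    (O : set 'rV[R]_n) :
  (forall i, dpred M (S i)) -> open O -> O !=set0 ->
  (forall x, O x -> exists i, S i x) ->
  exists i V, [/\ open V, V !=set0, V `<=` O & forall x, V x -> S i x].
Proof. exact: definable_category_of (@dichotomy n). Qed.

Lemma generic_loc n (A : 'rV[R]_n -> Prop) : dpred M A ->
  generic [set x | (\forall y \near x, A y) \/ (\forall y \near x, ~ A y)].
Proof.
move=> hA; apply/genericP => O oO O0.
have [V [oV V0 VO VA]] := dichotomy hA oO O0.
exists V; split => // x Vx; have nV : nbhs x V by exact: open_nbhs_nbhs.
by case: VA => h; [left|right]; apply: filterS nV.
Qed.

(** Density excludes the second alternative of the dichotomy. This reduces every genericity
    statement below to finding one point in each open set. *)
Lemma definable_generic n (A : 'rV[R]_n -> Prop) : dpred M A ->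
  (forall O : set 'rV[R]_n, open O -> O !=set0 -> exists x, O x /\ A x) ->
  generic [set x | A x].
Proof.
move=> hA hd; apply/genericP => O oO O0.
have [V [oV V0 VO [VA|VA]]] := dichotomy hA oO O0; first by exists V.
by have [x [Vx Ax]] := hd V oV V0; case: (VA x Vx Ax).
Qed.

End OMinimal.

(** * Slopes and derivatives of functions of one variable *)

Section OneVariable.
Context (R : realType).

(** The right-hand side is a first-order formula, which makes the set of continuity points of a
    definable function definable. *)
Lemma continuous_atP (V : pseudoMetricType R) (g : V -> R) (x : V) :
  {for x, continuous g} <->
  forall e, 0 < e -> exists d, 0 < d /\ forall y, ball x d y -> `|g x - g y| < e.
Proof.
split=> [/cvgrPdist_lt h e e0|h].
  by have /nbhs_ballP[d d0 hd] := h e e0; exists d; split => // y /hd.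
apply/cvgrPdist_lt => e e0; have [d [d0 hd]] := h e e0.
by apply/nbhs_ballP; exists d.
Qed.

Lemma continuous_at1P (g : R -> R) x : {for x, continuous g} <->
  forall e, 0 < e -> exists d, 0 < d /\ forall y, `|x - y| < d -> `|g x - g y| < e.
Proof. exact: continuous_atP. Qed.

(** A mean value inequality from right slopes alone. The supremum of the points up to which the
    inequality holds satisfies it by continuity, and if it were less than [v] the right slope there
    would carry the inequality further. *)
Lemma slope_ge_of_right (g : R -> R) (a b c : R) :
  (forall t, a < t < b -> {for t, continuous g}) ->
  (forall t, a < t < b -> exists d, 0 < d /\
    forall h, 0 < h -> h < d -> c * h <= g (t + h) - g t) ->
  forall u v, a < u -> u < v -> v < b -> c * (v - u) <= g v - g u.
Proof.
move=> cg hg u v au uv vb.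
pose S := [set w | u <= w <= v /\ c * (w - u) <= g w - g u].
have Su : S u by split; rewrite ?lexx ?(ltW uv)// !subrr mulr0.
have ubS : ubound S v by move=> w [/andP[]].
have hS : has_sup S by split; [exists u|exists v].
have us : u <= sup S by apply: ub_le_sup => //; exists v.
have sv : sup S <= v by apply: ge_sup => //; exists u.
have abs : a < sup S < b by rewrite (lt_le_trans au us) (le_lt_trans sv vb).
have Ss : c * (sup S - u) <= g (sup S) - g u.
  rewrite leNgt; apply/negP => hlt.
  have e0 : 0 < c * (sup S - u) - (g (sup S) - g u) by lra.
  have e1 : 0 < (c * (sup S - u) - (g (sup S) - g u)) / 2 by lra.
  have [d [d0 hd]] := (continuous_at1P _ _).1 (cg _ abs) _ e1.
  (* Within distance [k] of the supremum, the change of [g] and that of the linear term each use up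
     at most half of the defect. The 1 in the denominator avoids a division by zero. *)
  pose k := Num.min d ((c * (sup S - u) - (g (sup S) - g u)) / 2 / (1 + `|c|)).
  have c1 : 0 < 1 + `|c| by rewrite ltr_pwDl.
  have k0 : 0 < k by rewrite lt_min d0 divr_gt0.
  have [w Sw ws] := sup_adherent k0 hS.
  have sw : w <= sup S by apply: ub_le_sup => //; exists v.
  have wk : `|sup S - w| < k by rewrite ger0_norm ?subr_ge0//; lra.
  have /hd : `|sup S - w| < d by apply: lt_le_trans wk _; rewrite ge_min lexx.
  have : `|c| * `|sup S - w| <= (c * (sup S - u) - (g (sup S) - g u)) / 2.
    apply: (@le_trans _ _ ((1 + `|c|) * `|sup S - w|)).
      by apply: ler_wpM2r => //; lra.
    rewrite mulrC -ler_pdivlMr//; apply: ltW; apply: lt_le_trans wk _.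
    by rewrite ge_min lexx orbT.
  rewrite -normrM ler_norml ltr_distl => /andP[h1 h2] /andP[h3 h4].
  by case: Sw => _ h5; nra.
have [->//|sv'] := eqVneq v (sup S).
have {}sv' : sup S < v by rewrite lt_neqAle eq_sym sv' sv.
have [d [d0 hd]] := hg _ abs.
pose h := Num.min d (v - sup S) / 2.
have m0 : 0 < Num.min d (v - sup S) by rewrite lt_min d0 subr_gt0.
have md : Num.min d (v - sup S) <= d by rewrite ge_min lexx.
have mv : Num.min d (v - sup S) <= v - sup S by rewrite ge_min lexx orbT.
have h0 : 0 < h by rewrite /h; lra.
have hh : c * h <= g (sup S + h) - g (sup S) by apply: hd => //; rewrite /h; lra.
have : sup S + h <= sup S.
  apply: ub_le_sup; first by exists v.
  by split; [rewrite /h; apply/andP; split; lra|lra].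
by lra.
Qed.

(** Without quotient or limit, so that it is a first-order condition on [g], [x] and [s]. *)
Definition has_deriv (g : R -> R) (x s : R) : Prop :=
  forall e : R, 0 < e -> exists d : R, 0 < d /\
    forall h : R, `|h| < d -> `|g (x + h) - g x - s * h| <= e * `|h|.

Lemma has_derivP (g : R -> R) x s : has_deriv g x s <-> is_derive x 1 g s.
Proof.
have E : (fun h => h^-1 *: ((g \o shift x) (h *: 1) - g x)) =
         (fun h => h^-1 * (g (x + h) - g x)).
  by apply/funext => h /=; rewrite [h%:A]mulr1 [h + x]addrC.
split=> [h|[hd hs] e e0].
  have cv : (fun h => h^-1 *: ((g \o shift x) (h *: 1) - g x)) @ 0^' --> s.
    rewrite E; apply/cvgrPdist_le => e e0; have [d [d0 hd]] := h e e0.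
    apply/nbhs_ballP; exists d => //= k kd k0; rewrite /= in kd.
    have {}kd : `|k| < d by move: kd; rewrite /ball/= sub0r normrN.
    have := hd k kd; rewrite -ler_pdivrMr ?normr_gt0// -normfV -normrM.
    rewrite distrC; congr (`|_| <= _); field.
    exact: k0.
  by apply: DeriveDef; [apply/cvg_ex; exists s|exact: cvg_lim].
move: hd; rewrite /derivable => /cvgP/[dup]; rewrite -hs /derive.
move=> _; rewrite E => /cvgrPdist_le /(_ e e0) /nbhs_ballP[d /= d0 hd].
exists d; split => // k kd.
have [->|k0] := eqVneq k 0; first by rewrite addr0 subrr mulr0 subrr normr0 mulr0.
have := hd k; rewrite /ball/= sub0r normrN => /(_ kd k0).
rewrite -ler_pdivrMr ?normr_gt0// -normfV -normrM distrC.
by congr (`|_| <= _); field.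
Qed.

End OneVariable.

Section GenericDerivative.
Context (R : realType) (M : structure R) (hM : o_minimal M).

(** For each rational [q], the comparisons of [g] with [q] are locally constant at generic points.
    At a point where this holds for all [q] at once, [g] is squeezed between rationals arbitrarily
    close to its value. *)
Lemma generic_continuous n (g : 'rV[R]_n -> R) : dfun M g ->
  generic [set x | {for x, continuous g}].
Proof.
move=> hg.
apply: (@generic_sub _ [set x | forall e : R, 0 < e -> exists d : R, 0 < d /\
    forall y : 'rV[R]_n, ball x d y -> `|g x - g y| < e]); first by move=> x /continuous_atP.
apply: (definable_generic hM); first by dtac.
move=> O oO O0.
have hF (k : rat * bool) : generic [set x |
    (\forall y \near x, if k.2 then g y < ratr k.1 else ratr k.1 < g y) \/
    (\forall y \near x, ~ if k.2 then g y < ratr k.1 else ratr k.1 < g y)].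
  by case: k => q [] /=; apply: (generic_loc hM); dtac.
have [x [Ox hx]] := Baire_count hF O0 oO; exists x; split => // e e0.
have l1 : g x < g x + e by rewrite ltrDl.
have l2 : g x - e < g x by rewrite ltrBlDr ltrDl.
have [q] := rat_in_itvoo l1; rewrite in_itv/= => /andP[q1 q2].
have [p] := rat_in_itvoo l2; rewrite in_itv/= => /andP[p1 p2].
have n1 : \forall y \near x, g y < ratr q.
  by case: (hx (q, true)) => //= /nbhs_singleton.
have n2 : \forall y \near x, ratr p < g y.
  by case: (hx (p, false)) => //= /nbhs_singleton.
have /nbhs_ballP[d d0 hd] : nbhs x [set y | g y < ratr q /\ ratr p < g y].
  exact: filterI.
exists d; split => // y /hd[/= gq pg]; rewrite distrC ltr_distl.
by apply/andP; split; lra.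
Qed.

Lemma generic_itv (A : R -> Prop) (a b : R) :
  generic [set x : 'rV[R]_1 | A (x 0 0)] -> a < b ->
  exists a' b', [/\ a <= a', a' < b', b' <= b & forall t, a' < t < b' -> A t].
Proof.
move=> gA ab.
have cc : continuous (fun x : 'rV[R]_1 => x 0 0) by exact: coord_continuous.
have oO : open [set x : 'rV[R]_1 | a < x 0 0 /\ x 0 0 < b].
  apply: openI.
  + exact: (open_comp (fun z _ => cc z) (@open_gt R a)).
  + exact: (open_comp (fun z _ => cc z) (@open_lt R b)).
have O0 : [set x : 'rV[R]_1 | a < x 0 0 /\ x 0 0 < b] !=set0.
  by exists (const_mx ((a + b) / 2)); split; rewrite /= mxE; lra.
have [V [oV [x Vx] VO VA]] := (genericP _).1 gA _ oO O0.
have [e e0 xe] := open_ballP oV Vx.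
have [xa xb] := VO _ Vx.
have bl t : x 0 0 - e < t < x 0 0 + e -> V (const_mx t).
  move=> /andP[t1 t2]; apply/xe/ballE; split=> // i j.
  by rewrite (ord1 i) (ord1 j) !mxE ltr_distl; apply/andP; split; lra.
exists (Num.max a (x 0 0 - e)), (Num.min b (x 0 0 + e)); split.
- by rewrite le_max lexx.
- by rewrite gt_max !lt_min; apply/andP; split; apply/andP; split; lra.
- by rewrite ge_min lexx.
move=> t; rewrite gt_max lt_min => /andP[/andP[ta te] /andP[tb te']].
have /bl/VA : x 0 0 - e < t < x 0 0 + e by rewrite te te'.
by rewrite /= mxE.
Qed.

Definition right_slope_ge (g : R -> R) (c t : R) : Prop :=
  exists d : R, 0 < d /\ forall h : R, 0 < h -> h < d -> c * h <= g (t + h) - g t.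

Lemma dpred_right_slope_ge n (g : R -> R) (c t : 'rV[R]_n -> R) :
  dfun M (fun x : 'rV[R]_1 => g (x 0 0)) -> dfun M c -> dfun M t ->
  dpred M (fun x => right_slope_ge g (c x) (t x)).
Proof. by move=> hg hc ht; rewrite /right_slope_ge; dtac. Qed.

(** The negation only yields arbitrarily small [h] with slope below [c]; o-minimality makes the
    inequality hold for all small [h]. *)
Lemma right_slope_le (g : R -> R) (c t : R) :
  dfun M (fun x : 'rV[R]_1 => g (x 0 0)) ->
  ~ right_slope_ge g c t -> right_slope_ge (fun x => - g x) (- c) t.
Proof.
move=> hg hn.
have : tame_at 0 (fun h => c * h <= g (t + h) - g t).
  by apply: (definable_tame hM); dtac.
case=> -[d d0 hd]; first by case: hn; exists d; split => // h h0 h1; apply: hd;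
  rewrite h0 add0r.
exists d; split => // h h0 h1.
have /hd /negP : 0 < h < 0 + d by rewrite h0 add0r.
by rewrite -ltNge => /ltW; lra.
Qed.

(** A substitute for the monotonicity theorem. With [k] above the mean slope between two inner
    points, right slopes at least [k] cannot occur everywhere; tameness then makes them fail
    throughout some interval, where the mean value inequality is applied to the opposite of [g]. *)
Lemma slopes_bounded_above (g : R -> R) (a b : R) :
  dfun M (fun x : 'rV[R]_1 => g (x 0 0)) ->
  (forall t, a < t < b -> {for t, continuous g}) -> a < b ->
  exists k a' b', [/\ a <= a', a' < b', b' <= b &
    forall u v, a' < u -> u < v -> v < b' -> g v - g u <= k * (v - u)].
Proof.
move=> hg cg ab.
pose u := a + (b - a) / 3; pose v := a + 2 * (b - a) / 3.
pose k := (g v - g u) / (v - u) + 1.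
have au : a < u by rewrite /u; lra.
have uv : u < v by rewrite /u /v; lra.
have vb : v < b by rewrite /v; lra.
have [[a' [b' [aa ab' bb hN]]]|hP] := pselect (exists a' b',
    [/\ a <= a', a' < b', b' <= b & forall t, a' < t < b' -> ~ right_slope_ge g k t]).
  exists k, a', b'; split => // x y ax xy yb.
  have cN t : a' < t < b' -> {for t, continuous (fun x => - g x)}.
    move=> /andP[t1 t2]; apply: (@continuousN R R^o); apply: cg.
    by rewrite (le_lt_trans aa t1) (lt_le_trans t2 bb).
  have := slope_ge_of_right cN (fun t ht => right_slope_le hg (hN t ht)) ax xy yb.
  by lra.
(* Otherwise every right slope is at least [k], which exceeds a mean slope. *)
exfalso.
have hr t : a < t < b -> right_slope_ge g k t.
  move=> /andP[at0 tb].
  have : tame_at t (right_slope_ge g k).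
    by apply: (definable_tame hM); apply: dpred_right_slope_ge => //; dtac.
  case=> -[d d0 hd]; last first.
    case: hP; exists t, (Num.min b (t + d)); split => //; first exact: ltW.
    - by rewrite lt_min tb ltrDl.
    - by rewrite ge_min lexx.
    - by move=> x /andP[tx]; rewrite lt_min => /andP[_ xd]; apply: hd; rewrite tx.
  pose m := Num.min b (t + d).
  have mb : m <= b by rewrite ge_min lexx.
  have md : m <= t + d by rewrite ge_min lexx orbT.
  have tm : t < m by rewrite lt_min tb ltrDl.
  have sl x y : t < x -> x < y -> y < m -> k * (y - x) <= g y - g x.
    move=> tx xy ym; apply: (@slope_ge_of_right R g t m k) => // z /andP[z1 z2].
      by apply: cg; rewrite (lt_trans at0 z1) (lt_le_trans z2 mb).
    by apply: hd; rewrite z1 (lt_le_trans z2 md).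
  exists (m - t); split; first by rewrite subr_gt0.
  move=> h h0 hm; rewrite leNgt; apply/negP => hlt.
  have e0 : 0 < (k * h - (g (t + h) - g t)) / 2 by lra.
  have atb : a < t < b by rewrite at0.
  have [e [e0' he]] := (continuous_at1P _ _).1 (cg t atb) _ e0.
  have k1 : 0 < 1 + `|k| by rewrite ltr_pwDl.
  (* The inequality is known from [t + w] on. Moving its left end back to [t] costs at most half of
     the defect for [g] and half for [k * w]. *)
  pose w := Num.min (Num.min e h) ((k * h - (g (t + h) - g t)) / 2 / (1 + `|k|)) / 2.
  have w0 : 0 < Num.min (Num.min e h) ((k * h - (g (t + h) - g t)) / 2 / (1 + `|k|)).
    by rewrite !lt_min e0' h0 divr_gt0.
  have we : Num.min (Num.min e h) ((k * h - (g (t + h) - g t)) / 2 / (1 + `|k|)) <= e.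
    by rewrite !ge_min lexx.
  have wh : Num.min (Num.min e h) ((k * h - (g (t + h) - g t)) / 2 / (1 + `|k|)) <= h.
    by rewrite !ge_min lexx orbT.
  have wk : w <= (k * h - (g (t + h) - g t)) / 2 / (1 + `|k|).
    apply: (@le_trans _ _ (Num.min (Num.min e h) ((k * h - (g (t + h) - g t)) / 2 / (1 + `|k|)))).
      by rewrite /w; lra.
    by rewrite !ge_min lexx !orbT.
  have w1 : 0 < w by rewrite /w; lra.
  have /he : `|t - (t + w)| < e by rewrite opprD addNKr normrN gtr0_norm// /w; lra.
  have tw : t < t + w by lra.
  have twh : t + w < t + h by rewrite /w; lra.
  have thm : t + h < m by lra.
  have := sl _ _ tw twh thm.
  move=> h1; rewrite ltr_distl => /andP[h2 h3].
  have : `|k| * w <= (k * h - (g (t + h) - g t)) / 2.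
    apply: (@le_trans _ _ ((1 + `|k|) * w)); first by apply: ler_wpM2r; lra.
    by rewrite mulrC -ler_pdivlMr.
  have : k * w <= `|k| * w by apply: ler_wpM2r; [lra|exact: ler_norm].
  by lra.
have := @slope_ge_of_right R g a b k cg hr u v au uv vb.
rewrite /k mulrDl divfK; first lra.
by apply: lt0r_neq0; lra.
Qed.

End GenericDerivative.

Section DerivablePoint.
Context (R : realType) (M : structure R) (hM : o_minimal M).

Lemma generic_continuous1 (g : R -> R) :
  dfun M (fun x : 'rV[R]_1 => g (x 0 0)) ->
  generic [set x : 'rV[R]_1 | {for x 0 0, continuous g}].
Proof.
move=> hg; apply: generic_sub (generic_continuous hM hg) => x /= /continuous_atP h.
apply/continuous_at1P => e e0; have [d [d0 hd]] := h e e0; exists d; split => // y yd.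
have := hd (const_mx y); rewrite mxE; apply; apply/ballE; split => // i j.
by rewrite (ord1 i) (ord1 j) mxE.
Qed.

(** The derivative is the supremum of the slopes that bound [g] from below near [c], finite because
    of [k1] and [k2]. By the last hypothesis every rational is a lower or an upper slope bound; one
    just below the supremum must be a lower bound and one just above it an upper bound. *)
Lemma has_deriv_of_slopes (g : R -> R) (c k1 k2 r : R) : 0 < r ->
  (forall u v, c - r < u -> u < v -> v < c + r -> g v - g u <= k1 * (v - u)) ->
  (forall u v, c - r < u -> u < v -> v < c + r -> k2 * (v - u) <= g v - g u) ->
  (forall q : rat, exists d, 0 < d /\
    ((forall u v, c - d < u -> u < v -> v < c + d -> ratr q * (v - u) <= g v - g u) \/
     (forall u v, c - d < u -> u < v -> v < c + d -> g v - g u <= ratr q * (v - u)))) ->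
  exists s, has_deriv g c s.
Proof.
move=> r0 hk1 hk2 hq.
pose S := [set m | exists d, 0 < d /\
  forall u v, c - d < u -> u < v -> v < c + d -> m * (v - u) <= g v - g u].
have Sk2 : S k2 by exists r.
have contra (m1 m2 d1 d2 : R) : 0 < d1 -> 0 < d2 -> m1 < m2 ->
    (forall u v, c - d1 < u -> u < v -> v < c + d1 -> g v - g u <= m1 * (v - u)) ->
    (forall u v, c - d2 < u -> u < v -> v < c + d2 -> m2 * (v - u) <= g v - g u) ->
    False.
  move=> d10 d20 m12 h1 h2; pose d := Num.min d1 d2.
  have dd0 : 0 < d by rewrite lt_min d10.
  have dd1 : d <= d1 by rewrite ge_min lexx.
  have dd2 : d <= d2 by rewrite ge_min lexx orbT.
  have := h1 c (c + d / 2); have := h2 c (c + d / 2).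
  have -> : c + d / 2 - c = d / 2 by lra.
  move=> /(_ _ _ _) h2' /(_ _ _ _) h1'.
  have : m2 * (d / 2) <= m1 * (d / 2) by apply: le_trans (h2' _ _ _) (h1' _ _ _); lra.
  by rewrite ler_pM2r; lra.
have ubS : ubound S k1.
  move=> m [d [d0 hd]]; rewrite leNgt; apply/negP => km.
  exact: contra r0 d0 km hk1 hd.
have hS : has_sup S by split; [exists k2|exists k1].
exists (sup S) => e e0.
have l1 : sup S - e < sup S by rewrite ltrBlDr ltrDl.
have l2 : sup S < sup S + e by rewrite ltrDl.
have [p] := rat_in_itvoo l1; rewrite in_itv/= => /andP[p1 p2].
have [q] := rat_in_itvoo l2; rewrite in_itv/= => /andP[q1 q2].
have [d1 [d10 h1]] : exists d, 0 < d /\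
    forall u v, c - d < u -> u < v -> v < c + d -> ratr p * (v - u) <= g v - g u.
  have [d [d0 [h|h]]] := hq p; first by exists d.
  have e1 : 0 < sup S - ratr p by rewrite subr_gt0.
  have [m [d' [d'0 hm]] pm] := sup_adherent e1 hS.
  by exfalso; apply: (contra (ratr p) m _ _ d0 d'0) => //; lra.
have [d2 [d20 h2]] : exists d, 0 < d /\
    forall u v, c - d < u -> u < v -> v < c + d -> g v - g u <= ratr q * (v - u).
  have [d [d0 [h|h]]] := hq q; last by exists d.
  have : ratr q <= sup S by apply: ub_le_sup; [exists k1|exists d].
  by move/(lt_le_trans q1); rewrite ltxx.
exists (Num.min d1 d2); split; first by rewrite lt_min d10.
move=> h; rewrite lt_min => /andP[hd1 hd2].
move: (hd1) (hd2); rewrite !ltr_norml => /andP[? ?] /andP[? ?].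
have [h0|h0|->] := ltgtP h 0; last by rewrite addr0 subrr mulr0 subrr normr0 mulr0.
- have := h1 (c + h) c; have := h2 (c + h) c.
  have -> : c - (c + h) = - h by lra.
  move=> /(_ _ _ _) h2' /(_ _ _ _) h1'.
  have A : ratr p * - h <= g c - g (c + h) by apply: h1'; lra.
  have B : g c - g (c + h) <= ratr q * - h by apply: h2'; lra.
  have C : (sup S - e) * - h <= ratr p * - h by apply: ler_wpM2r; lra.
  have D : ratr q * - h <= (sup S + e) * - h by apply: ler_wpM2r; lra.
  by rewrite (ltr0_norm h0) ler_norml; apply/andP; split; lra.
- have := h1 c (c + h); have := h2 c (c + h).
  have -> : c + h - c = h by lra.
  move=> /(_ _ _ _) h2' /(_ _ _ _) h1'.
  have A : ratr p * h <= g (c + h) - g c by apply: h1'; lra.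
  have B : g (c + h) - g c <= ratr q * h by apply: h2'; lra.
  have C : (sup S - e) * h <= ratr p * h by apply: ler_wpM2r; lra.
  have D : ratr q * h <= (sup S + e) * h by apply: ler_wpM2r; lra.
  by rewrite (gtr0_norm h0) ler_norml; apply/andP; split; lra.
Qed.

(** The interval shrinks three times: to make [g] continuous, then to bound its slopes from above,
    then from below. Baire's theorem gives a point near which, for each rational [q], the comparison
    of right slopes with [q] has a constant answer. *)
Lemma derivable_point (g : R -> R) (a b : R) :
  dfun M (fun x : 'rV[R]_1 => g (x 0 0)) -> a < b ->
  exists c s, a < c < b /\ has_deriv g c s.
Proof.
move=> hg ab.
have [a1 [b1 [aa1 ab1 bb1 cg]]] := @generic_itv R (fun t => {for t, continuous g}) a b
  (@generic_continuous1 g hg) ab.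
have [k1 [a2 [b2 [aa2 ab2 bb2 hk1]]]] := @slopes_bounded_above _ _ hM g _ _ hg cg ab1.
have hNg : dfun M (fun x : 'rV[R]_1 => - g (x 0 0)) by dtac.
have cNg t : a2 < t < b2 -> {for t, continuous (fun x => - g x)}.
  move=> /andP[t1 t2]; apply: (@continuousN R R^o); apply: cg.
  by rewrite (le_lt_trans aa2 t1) (lt_le_trans t2 bb2).
have [k2 [a3 [b3 [aa3 ab3 bb3 hk2]]]] := @slopes_bounded_above _ _ hM (fun x => - g x) _ _ hNg cNg ab2.
have hF (q : rat) : generic [set x : 'rV[R]_1 |
    nbhs x [set y : 'rV[R]_1 | right_slope_ge g (ratr q) (y 0 0)] \/
    nbhs x [set y : 'rV[R]_1 | ~ right_slope_ge g (ratr q) (y 0 0)]].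
  by apply: (generic_loc hM); apply: dpred_right_slope_ge => //; dtac.
have cc : continuous (fun x : 'rV[R]_1 => x 0 0) by exact: coord_continuous.
have oO : open [set x : 'rV[R]_1 | a3 < x 0 0 /\ x 0 0 < b3].
  apply: openI.
  + exact: (open_comp (fun z _ => cc z) (@open_gt R a3)).
  + exact: (open_comp (fun z _ => cc z) (@open_lt R b3)).
have O0 : [set x : 'rV[R]_1 | a3 < x 0 0 /\ x 0 0 < b3] !=set0.
  by exists (const_mx ((a3 + b3) / 2)); split; rewrite /= mxE; lra.
have [x [[xa xb] hx]] := Baire_count hF O0 oO.
have near_itv (A : R -> Prop) : nbhs x [set y : 'rV[R]_1 | A (y 0 0)] ->
    exists d, 0 < d /\ forall t, x 0 0 - d < t < x 0 0 + d -> A t.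
  move=> /nbhs_ballP[d d0 hd]; exists d; split => // t /andP[t1 t2].
  have /hd : ball x d (const_mx t).
    apply/ballE; split => // i j.
    by rewrite (ord1 i) (ord1 j) mxE ltr_distl; apply/andP; split; lra.
  by rewrite /= mxE.
pose r := Num.min (x 0 0 - a3) (b3 - x 0 0).
have r0 : 0 < r by rewrite lt_min; apply/andP; split; lra.
have ra : r <= x 0 0 - a3 by rewrite ge_min lexx.
have rb : r <= b3 - x 0 0 by rewrite ge_min lexx orbT.
have [s hs] : exists s, has_deriv g (x 0 0) s.
  apply: (@has_deriv_of_slopes g (x 0 0) k1 (- k2) r) => //.
  - by move=> u v ? ? ?; apply: hk1; lra.
  - move=> u v u1 uv v1; have : - g v - - g u <= k2 * (v - u) by apply: hk2; lra.
    by lra.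
  move=> q.
  have [/(near_itv (right_slope_ge g (ratr q)))[d [d0 hd]]
    |/(near_itv (fun t => ~ right_slope_ge g (ratr q) t))[d [d0 hd]]] := hx q.
    pose m := Num.min d r.
    have m0 : 0 < m by rewrite lt_min d0.
    have md : m <= d by rewrite ge_min lexx.
    have mr : m <= r by rewrite ge_min lexx orbT.
    exists m; split => //; left => u v.
    apply: slope_ge_of_right => t /andP[t1 t2].
      by apply: cg; apply/andP; split; lra.
    by apply: hd; apply/andP; split; lra.
  pose m := Num.min d r.
  have m0 : 0 < m by rewrite lt_min d0.
  have md : m <= d by rewrite ge_min lexx.
  have mr : m <= r by rewrite ge_min lexx orbT.
  exists m; split => //; right => u v u1 uv v1.
  have : - ratr q * (v - u) <= - g v - - g u.
    apply: (@slope_ge_of_right R (fun x => - g x) (x 0 0 - m) (x 0 0 + m)) => //.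
      by move=> t /andP[t1 t2]; apply: cNg; apply/andP; split; lra.
    move=> t /andP[t1 t2]; apply: (@right_slope_le _ _ hM g _ _ hg); apply: hd.
    by apply/andP; split; lra.
  by lra.
exists (x 0 0), s; split => //; apply/andP; split; lra.
Qed.

End DerivablePoint.

(** * Partial derivatives and differentiability in several variables *)

Section Differentiability.
Context (R : realType).

Lemma is_derive_line (V : normedModType R) (g : V -> R^o) (x v : V) (s : R) (l : R) :
  is_derive (x + s *: v) v g l <-> is_derive s 1 (fun t : R => g (x + t *: v)) l.
Proof.
suff E : (fun h => h^-1 *: ((g \o shift (x + s *: v)) (h *: v) - g (x + s *: v))) =
    (fun h => h^-1 *: (((fun t : R => g (x + t *: v)) \o shift s) (h *: 1)
       - g (x + s *: v))).
  by split=> -[h1 h2]; apply: DeriveDef; move: h1 h2; rewrite /derivable /derive /= E.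
apply/funext => h /=; rewrite [h%:A]mulr1 scalerDl.
by rewrite addrCA.
Qed.

Lemma MVT_dir (V : normedModType R) (g : V -> R^o) (x v : V) (t : R) :
  (forall s : R, `|s| <= `|t| -> derivable g (x + s *: v) v) ->
  exists s : R, `|s| <= `|t| /\ g (x + t *: v) - g x = t * 'D_v g (x + s *: v).
Proof.
move=> hd; pose f (s : R) : R := g (x + s *: v).
have dfs (s : R) : `|s| <= `|t| -> is_derive s 1 f ('D_v g (x + s *: v)).
  by move=> /hd /derivableP /is_derive_line.
have cf (s : R) : `|s| <= `|t| -> {for s, continuous f}.
  move=> /dfs[h _]; apply: differentiable_continuous.
  by apply/derivable1_diffP.
have g0 : g x = f 0 by rewrite /f scale0r addr0.
have [t0|t0|->] := ltgtP t 0; last first.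
- exists 0; rewrite !normr0; split => //.
  by rewrite scale0r addr0 subrr mul0r.
- have inn (s : R) : 0 <= s <= t -> `|s| <= `|t|.
    by move=> /andP[s0 st]; rewrite ger0_norm// gtr0_norm.
  have [||s] := @MVT R f (fun s => 'D_v g (x + s *: v)) 0 t t0.
  + move=> s; rewrite in_itv/= => /andP[/ltW s0 /ltW st].
    by apply: dfs; apply: inn; rewrite s0.
  + apply: continuous_in_subspaceT => s; rewrite inE/= in_itv/= => /inn.
    exact: cf.
  rewrite in_itv/= => /andP[/ltW s0 /ltW st] E; exists s; split.
    by apply: inn; rewrite s0.
  by rewrite g0 -/(f t) E subr0 mulrC.
- have inn (s : R) : t <= s <= 0 -> `|s| <= `|t|.
    by move=> /andP[s0 st]; rewrite ler0_norm// ltr0_norm// lerN2.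
  have [||s] := @MVT R f (fun s => 'D_v g (x + s *: v)) t 0 t0.
  + move=> s; rewrite in_itv/= => /andP[/ltW s0 /ltW st].
    by apply: dfs; apply: inn; rewrite s0.
  + apply: continuous_in_subspaceT => s; rewrite inE/= in_itv/= => /inn.
    exact: cf.
  rewrite in_itv/= => /andP[/ltW s0 /ltW st] E; exists s; split.
    by apply: inn; rewrite s0.
  by rewrite g0 -/(f t) -opprB E sub0r mulrN opprK mulrC.
Qed.

Definition evec n (r : 'I_n) : 'rV[R]_n := delta_mx 0 r.

Lemma coord_norm m n (x : 'M[R]_(m, n)) i j : `|x i j| <= `|x|.
Proof.
rewrite {2}/Num.Def.normr/= mx_normrE.
exact: (le_bigmax _ (fun k : 'I_m * 'I_n => `|x k.1 k.2|) (i, j)).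
Qed.

Lemma norm_evec n (r : 'I_n) (t : R) : `|t *: evec r| <= `|t|.
Proof.
rewrite normrZ ler_piMr// /Num.Def.normr/= mx_normrE.
apply: bigmax_le => // -[i j] _; rewrite mxE /=; case: (_ && _) => /=.
  by rewrite normr1.
by rewrite normr0.
Qed.

Lemma row_evec n (v : 'rV[R]_n) : v = \sum_r v 0 r *: evec r.
Proof. exact: row_sum_delta. Qed.

Definition lin_of n (c : 'I_n -> R) (v : 'rV[R]_n) : R^o := \sum_r v 0 r * c r.

Lemma lin_of_linear n (c : 'I_n -> R) : linear (lin_of c).
Proof.
move=> a u v; rewrite /lin_of scaler_sumr -big_split/=; apply: eq_bigr => r _.
by rewrite !mxE mulrDl -mulrA.
Qed.

HB.instance Definition _ n (c : 'I_n -> R) :=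
  GRing.isLinear.Build R 'rV[R]_n R^o _ (lin_of c) (lin_of_linear c).

Lemma continuous_sumr (T : topologicalType) (J : Type) (s : seq J)
    (F : J -> T -> R) (x : T) :
  (forall i, {for x, continuous (F i)}) ->
  {for x, continuous (fun y => \sum_(i <- s) F i y)}.
Proof.
move=> h; elim: s => [|i s ih].
  rewrite (_ : (fun _ => _) = cst 0); first exact: cst_continuous.
  by apply/funext => y; rewrite big_nil.
rewrite (_ : (fun _ => _) = (F i \+ (fun y => \sum_(i <- s) F i y))).
  by apply: (@continuousD R R^o) => //; exact: h.
by apply/funext => y; rewrite big_cons.
Qed.

Lemma lin_of_continuous n (c : 'I_n -> R) : continuous (lin_of c).
Proof.
move=> x; apply: continuous_sumr => i; apply: (@continuousM R).
  exact: coord_continuous.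
exact: cst_continuous.
Qed.

Lemma differentiable_of_estimate n (g : 'rV[R]_n -> R^o) x (c : 'I_n -> R) :
  (forall e : R, 0 < e -> exists d : R, 0 < d /\ forall v : 'rV[R]_n, `|v| < d ->
    `|g (x + v) - g x - lin_of c v| <= e * `|v|) ->
  differentiable g x /\ 'd g x = lin_of c :> (_ -> _).
Proof.
move=> h.
have E : g \o shift x = cst (g x) + lin_of c +o_ 0 id.
  apply/eqaddoP => e e0; have [d [d0 hd]] := h e e0.
  apply/nbhs_ballP; exists d => //= v; rewrite -ball_normE/= sub0r normrN => vd.
  have := hd v vd; rewrite !fctE /= opprD addrA [x + v]addrC.
  by [].
have D : 'd g x = lin_of c :> (_ -> _).
  by apply: (@diff_unique R _ _ g (lin_of c)) => //; exact: lin_of_continuous.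
split => //; apply/diff_locallyP; rewrite D; split => //; exact: lin_of_continuous.
Qed.

Lemma differentiable_of_partials n (g : 'rV[R]_n -> R^o) (V : set 'rV[R]_n) x :
  open V -> V x ->
  (forall y, V y -> forall r, derivable g y (evec r)) ->
  (forall r, {for x, continuous (fun y => 'D_(evec r) g y : R)}) ->
  differentiable g x /\
  'd g x = lin_of (fun r => 'D_(evec r) g x) :> (_ -> _).
Proof.
move=> oV Vx hd hc; apply: differentiable_of_estimate => e e0.
(* Each of the [n] coordinates may contribute an error [e1] times the norm of the increment;
   dividing by [n.+1] covers [n = 0]. *)
pose e1 := e / n.+1%:R.
have e10 : 0 < e1 by rewrite divr_gt0.
have [d1 d10 h1] := open_ballP oV Vx.
have /nbhs_ballP[d2 /= d20 h2] :
    nbhs x [set y | forall r, `|'D_(evec r) g x - 'D_(evec r) g y| <= e1].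
  apply: (@filter_forall _ _ (fun (r : 'I_n) y =>
    `|'D_(evec r) g x - 'D_(evec r) g y| <= e1) (nbhs x)) => r.
  by have /cvgrPdist_le := hc r; exact.
exists (Num.min d1 d2); split; first by rewrite lt_min d10.
move=> v; rewrite lt_min => /andP[vd1 vd2].
(* [p k] has moved in its first [k] coordinates only, so that consecutive points differ along one
   axis and the mean value theorem applies to each step. *)
pose p (k : nat) : 'rV[R]_n := \row_i (x 0 i + (if (i < k)%N then v 0 i else 0)).
have p0 : p 0%N = x by apply/rowP => i; rewrite mxE addr0.
have pn : p n = x + v by apply/rowP => i; rewrite !mxE ltn_ord.
have pS (r : 'I_n) : p r.+1 = p r + v 0 r *: evec r.
  apply/rowP => i; rewrite !mxE eqxx/= ltnS leq_eqVlt eq_sym.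
  have [->|ir] := eqVneq i r; first by rewrite eqxx ltnn /= mulr1 addr0.
  by rewrite val_eqE eq_sym (negbTE ir) /= mulr0 addr0.
have pball (r : 'I_n) (s : R) : `|s| <= `|v 0 r| -> `|x - (p r + s *: evec r)| <= `|v|.
  move=> sv; rewrite [leLHS]/Num.Def.normr/= mx_normrE.
  apply: bigmax_le => //= -[i j] _; rewrite !mxE /=.
  rewrite (ord1 i) eqxx /=; have [->|jr] := eqVneq j r.
    rewrite ltnn addr0 mulr1 opprD addNKr normrN.
    exact: le_trans sv (coord_norm _ _ _).
  rewrite mulr0 addr0; case: ifP => _; last by rewrite addr0 subrr normr0.
  by rewrite opprD addNKr normrN coord_norm.
have inb d y : `|x - y| <= `|v| -> `|v| < d -> ball x d y.
  by rewrite -ball_normE /= => a b; exact: le_lt_trans a b.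
have key (r : 'I_n) : `|g (p r.+1) - g (p r) - v 0 r * 'D_(evec r) g x| <= e1 * `|v|.
  rewrite pS; have [|s [sv ->]] := @MVT_dir _ g (p r) (evec r) (v 0 r).
    by move=> s /pball hs; apply: hd; apply: h1; exact: inb vd1.
  rewrite -mulrBr normrM mulrC distrC; apply: ler_pM => //; last exact: coord_norm.
  by apply: (h2 _ (inb _ _ (pball _ _ sv) vd2)).
have -> : g (x + v) - g x = \sum_(r < n) (g (p r.+1) - g (p r)).
  rewrite -pn -p0 -(big_mkord xpredT (fun k => g (p k.+1) - g (p k))).
  by rewrite telescope_sumr.
rewrite /lin_of -sumrB; apply: le_trans (ler_norm_sum _ _ _) _.
apply: (@le_trans _ _ (\sum_(r < n) e1 * `|v|)); first exact: ler_sum.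
rewrite sumr_const card_ord -[leLHS]mulr_natr mulrAC; apply: ler_wpM2r => //.
rewrite /e1 -mulrA ler_piMr ?(ltW e0)// ler_pdivrMl// mulr1 ler_nat.
exact: leqnSn.
Qed.

Lemma open_continuous_within (T : topologicalType) (W : topologicalType)
    (V : set T) (f : T -> W) : open V ->
  {within V, continuous f} <-> forall x, V x -> {for x, continuous f}.
Proof.
move=> oV; rewrite continuous_open_subspace//.
by split=> h x; [move=> Vx; apply: h; rewrite inE|rewrite inE; exact: h].
Qed.

Lemma continuous_near_eq (T W : topologicalType) (f g : T -> W) (x : T) :
  {near x, f =1 g} -> {for x, continuous f} -> {for x, continuous g}.
Proof.
move=> fg cf; have e : f x = g x by exact: nbhs_singleton fg.
change (g @ x --> g x); rewrite -e; apply: cvg_trans cf.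
exact: near_eq_cvg.
Qed.

Lemma C1_of_partials n (g : 'rV[R]_n -> R^o) (V : set 'rV[R]_n) : open V ->
  (forall x, V x -> forall r, derivable g x (evec r)) ->
  (forall x, V x -> forall r, {for x, continuous (fun y => 'D_(evec r) g y : R)}) ->
  C1_on V g.
Proof.
move=> oV hd hc; split=> [x Vx|v].
  by have [] := differentiable_of_partials oV Vx hd (hc x Vx).
apply/(open_continuous_within _ oV) => x Vx.
have nE : {near x, (fun y => lin_of (fun r => 'D_(evec r) g y) v) =1
    (fun y => 'd g y v)}.
  have : nbhs x V by exact: open_nbhs_nbhs.
  apply: filterS => y Vy.
  by have [_ ->] := differentiable_of_partials oV Vy hd (hc y Vy).
have c1 : {for x, continuous (fun y => lin_of (fun r => 'D_(evec r) g y) v)}.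
  apply: continuous_sumr => r; apply: (@continuousM R).
    exact: cst_continuous.
  exact: hc.
exact: continuous_near_eq nE c1.
Qed.

End Differentiability.

(** * Definable functions are C^1 on a dense open set *)

Section GenericC1.
Context (R : realType) (M : structure R).

Definition has_partial n (g : 'rV[R]_n -> R) (r : 'I_n) (x : 'rV[R]_n) (s : R) :=
  has_deriv (fun t => g (x + t *: evec R r)) 0 s.

Lemma has_partialP n (g : 'rV[R]_n -> R^o) r x s :
  has_partial g r x s <-> is_derive x (evec R r) g s.
Proof.
rewrite /has_partial; have := @has_derivP R (fun t => g (x + t *: evec R r)) 0 s.
by rewrite -(is_derive_line g x (evec R r) 0 s) scale0r addr0.
Qed.

Lemma has_partialE n (g : 'rV[R]_n -> R^o) r x :
  (exists s, has_partial g r x s) <-> derivable g x (evec R r).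
Proof.
split=> [[s /has_partialP[]]//|/derivableP h].
by exists ('D_(evec R r) g x); apply/has_partialP.
Qed.

(** The value 0 where there is no partial derivative makes [pd g r] total, hence definable as soon
    as [g] is, and the generic continuity theorem applies to it. *)
Definition pd n (g : 'rV[R]_n -> R) (r : 'I_n) (x : 'rV[R]_n) : R :=
  if `[< exists s, has_partial g r x s >] then 'D_(evec R r) (g : _ -> R^o) x else 0.

Lemma pdE n (g : 'rV[R]_n -> R^o) r x :
  derivable g x (evec R r) -> pd g r x = 'D_(evec R r) g x.
Proof. by move=> /has_partialE h; rewrite /pd; case: asboolP. Qed.

Lemma dpred_has_partial n m (g : 'rV[R]_n -> R) r (h : 'rV[R]_m -> 'rV[R]_n)
    (s : 'rV[R]_m -> R) : dfun M g -> dmap M h -> dfun M s ->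
  dpred M (fun z => has_partial g r (h z) (s z)).
Proof. by move=> hg hh hs; rewrite /has_partial /has_deriv; dtac. Qed.

Lemma dfun_pd n (g : 'rV[R]_n -> R) r : dfun M g -> dfun M (pd g r).
Proof.
move=> hg; apply: (@dpred_ext _ _ _ (fun z : 'rV[R]_(n + 1) =>
  has_partial g r (lsubmx z) (rsubmx z 0 0) \/
  ((~ exists s, has_partial g r (lsubmx z) s) /\ 0 = rsubmx z 0 0))).
  move=> z; rewrite /pd; case: asboolP => h.
    split=> [[/has_partialP[]//|[]//]|<-]; left.
    by apply/has_partialP/derivableP/has_partialE.
  by split=> [[h'|[]]//|]; [case: h; eexists; exact: h'|right].
apply: dpred_or; first by apply: dpred_has_partial => //; dtac.
apply: dpred_and; last by dtac.
by apply: dpred_not; apply: dpred_ex; apply: dpred_has_partial => //; dtac.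
Qed.

Context (hM : o_minimal M).

(** The one-variable theorem on the line through a given point in the direction [r] provides a point
    with a partial derivative in each open set. *)
Lemma generic_partial n (g : 'rV[R]_n -> R) r : dfun M g ->
  generic [set x | exists s, has_partial g r x s].
Proof.
move=> hg; apply: (definable_generic hM).
  by apply: dpred_ex; apply: dpred_has_partial => //; dtac.
move=> O oO [x Ox]; have [e e0 xe] := open_ballP oO Ox.
have hx : dfun M (fun t : 'rV[R]_1 => g (x + t 0 0 *: evec R r)) by dtac.
have ee : - e < e by lra.
have [c [s [/andP[c1 c2] hs]]] :=
  @derivable_point R M hM (fun t => g (x + t *: evec R r)) _ _ hx ee.
exists (x + c *: evec R r); split.
  apply: xe; rewrite -ball_normE /= opprD addNKr normrN.
  by apply: le_lt_trans (norm_evec _ _) _; rewrite ltr_norml c1.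
exists s => d d0; have [d' [d'0 hd]] := hs d d0; exists d'; split => // h hh.
by have := hd h hh; rewrite scale0r addr0 add0r scalerDl addrA.
Qed.

(** Demanded on a whole ball, so that the set of these points is open, and spelled out with epsilons
    and deltas, so that it is definable. *)
Definition C1_at n (g : 'rV[R]_n -> R) (x : 'rV[R]_n) : Prop :=
  exists e : R, 0 < e /\ forall y : 'rV[R]_n, ball x e y ->
    (forall r : 'I_n, exists s : R, has_partial g r y s) /\
    (forall r : 'I_n, forall e : R, 0 < e -> exists d : R, 0 < d /\
      forall z : 'rV[R]_n, ball y d z -> `|pd g r y - pd g r z| < e).

Lemma dpred_C1_at n (g : 'rV[R]_n -> R) : dfun M g -> dpred M (C1_at g).
Proof.
move=> hg; rewrite /C1_at; have hp r := dfun_pd r hg.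
apply: (@dpred_ex _ _ _ (fun x e => 0 < e /\ forall y : 'rV[R]_n, ball x e y ->
    (forall r : 'I_n, exists s : R, has_partial g r y s) /\
    (forall r : 'I_n, forall e : R, 0 < e -> exists d : R, 0 < d /\
      forall z : 'rV[R]_n, ball y d z -> `|pd g r y - pd g r z| < e))).
apply: dpred_and; first by dtac.
apply: dpred_allv; apply: dpred_imp; first by dtac.
apply: dpred_and; apply: dpred_all_fin => r.
  by apply: dpred_ex; apply: dpred_has_partial => //; dtac.
by have := hp r => hpr; dtac.
Qed.

Lemma open_C1_at n (g : 'rV[R]_n -> R) : open [set x | C1_at g x].
Proof.
rewrite openE => x [e [e0 h]]; apply/nbhs_ballP; exists (e / 2) => /=.
  by rewrite divr_gt0.
move=> y xy; exists (e / 2); split; first by rewrite divr_gt0.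
by move=> z yz; apply: h; apply: ball_split xy yz.
Qed.

Lemma generic_C1_at n (g : 'rV[R]_n -> R) : dfun M g -> generic [set x | C1_at g x].
Proof.
move=> hg.
have h1 : generic [set x | forall r : 'I_n, exists s, has_partial g r x s].
  by apply: generic_all_fin => r; exact: generic_partial.
have h2 : generic [set x | forall r : 'I_n, {for x, continuous (pd g r)}].
  by apply: generic_all_fin => r; apply: (generic_continuous hM); exact: dfun_pd.
apply: generic_sub (generic_interior (generic_and h1 h2)) => x.
rewrite /interior => /nbhs_ballP[e /= e0 he]; exists e; split => // y /he [hy1 hy2].
split => // r d d0; have [k [k0 hk]] := (continuous_atP _ _).1 (hy2 r) d d0.
by exists k.
Qed.

Lemma C1_at_partials n (g : 'rV[R]_n -> R^o) (x : 'rV[R]_n) : C1_at g x ->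
  (forall r, derivable g x (evec R r)) /\
  (forall r, {for x, continuous (fun y => 'D_(evec R r) g y : R)}).
Proof.
move=> C1; have nC : nbhs x [set y | C1_at g y].
  by apply: open_nbhs_nbhs; split => //; exact: open_C1_at.
have hd y : C1_at g y -> forall r, derivable g y (evec R r).
  by move=> [e [e0 /(_ _ (ballxx _ e0))[h _]]] r; apply/has_partialE.
split; first exact: hd.
move=> r; apply: (@continuous_near_eq _ _ (pd g r)).
  by apply: filterS nC => y /hd h; exact: pdE.
apply/continuous_atP; case: C1 => e [e0 /(_ _ (ballxx _ e0))[_ h]].
exact: h.
Qed.

Lemma C1_at_C1_on n (g : 'rV[R]_n -> R^o) (V : set 'rV[R]_n) : open V ->
  (forall x, V x -> C1_at g x) -> C1_on V g.
Proof.
by move=> oV h; apply: C1_of_partials => // x /h /C1_at_partials[].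
Qed.

End GenericC1.

(** * Translations into a dense open set *)

Section Translation.
Context (R : realType) (M : structure R) (hM : o_minimal M).

Lemma ball_sub_mx m n (z z' : 'rV[R]_(m + n)) e : ball z e z' <->
  ball (lsubmx z) e (lsubmx z') /\ ball (rsubmx z) e (rsubmx z').
Proof.
rewrite !ballE; split=> [[e0 h]|[[e0 h1] [_ h2]]].
  by split; split => // i j; rewrite !mxE.
split => // i j; case: (split_ordP j) => k ->.
  by have := h1 i k; rewrite !mxE.
by have := h2 i k; rewrite !mxE.
Qed.

Lemma ball_row_mx m n (a a' : 'rV[R]_m) (b b' : 'rV[R]_n) e :
  ball (row_mx a b) e (row_mx a' b') <-> ball a e a' /\ ball b e b'.
Proof. by rewrite ball_sub_mx !row_mxKl !row_mxKr. Qed.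

Lemma ball_const1 (s t e : R) :
  ball (const_mx s : 'rV[R]_1) e (const_mx t) <-> `|s - t| < e.
Proof.
rewrite ballE; split=> [[_ /(_ 0 0)]|h]; first by rewrite !mxE.
by split=> [|i j]; [exact: le_lt_trans h|rewrite !mxE].
Qed.

Lemma compact_ball_le n (x : 'rV[R]_n) (r : R) : compact [set y | `|x - y| <= r].
Proof.
apply: bounded_closed_compact.
  exists (`|x| + r); split; first exact: num_real.
  move=> k hk y /= xy; apply/ltW/(le_lt_trans _ hk).
  rewrite -[y](subKr x); apply: le_trans (ler_normB _ _) _.
  by rewrite lerD2l.
rewrite -[X in closed X]/((fun y => `|x - y|) @^-1` [set t | t <= r]).
apply: closed_comp; last exact: closed_le.
move=> y _; apply: continuous_comp; last exact: norm_continuous.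
by apply: continuousB; [exact: cst_continuous|exact: id].
Qed.

(** Compactness of the closed ball: thresholds on [s] valid locally in [u] have a common positive
    lower bound. *)
Lemma near_const_ball n (x : 'rV[R]_n) (r : R) (P : R -> 'rV[R]_n -> Prop) :
  (forall u, `|x - u| <= r -> exists d : R, 0 < d /\
     forall u' s, ball u d u' -> 0 < s -> s < d -> P s u') ->
  exists d : R, 0 < d /\
    forall s, 0 < s -> s < d -> forall u, `|x - u| <= r -> P s u.
Proof.
move=> h; have /compact_near_coveringP cK := @compact_ball_le n x r.
have [u /= xu|d /= d0 hd] := cK R (0^'+) P (at_right_proper_filter _).
  have [d [d0 hd]] := h u xu.
  exists (ball u d, [set s | 0 < s < d]) => /=; last first.
    by move=> [u' s] /= [h1 /andP[h2 h3]]; exact: hd.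
  split; first exact: nbhsx_ballx.
  exists d => //= s; rewrite /ball_ /= sub0r normrN => sd s0.
  by rewrite s0 -(gtr0_norm s0).
exists d; split => // s s0 sd u xu; apply: hd => //=.
by rewrite sub0r normrN gtr0_norm.
Qed.

(* Small constant translations [v] moving a whole ball into the dense open [G]:
   induction on the dimension of [v], the germ at [0+] of each coordinate being
   chosen with o-minimality and made uniform in [u] by compactness. *)
Lemma translation_into m n (G : 'rV[R]_m -> 'rV[R]_n -> Prop) (O : set 'rV[R]_m)
    (rho : R) :
  dpred M (fun z : 'rV[R]_(m + n) => G (lsubmx z) (rsubmx z)) ->
  open O -> O !=set0 -> 0 < rho ->
  (forall u v, O u -> ball 0 rho v -> forall e : R, 0 < e ->
     exists u' v', [/\ ball u e u', ball v e v' & G u' v']) ->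
  (forall u v, G u v -> exists e : R, 0 < e /\
     forall u' v', ball u e u' -> ball v e v' -> G u' v') ->
  exists V, [/\ open V, V !=set0, V `<=` O &
    forall e : R, 0 < e -> exists v, ball 0 e v /\ forall u, V u -> G u v].
Proof.
elim: n G O rho => [|n ih] G O rho hG oO [x Ox] r0 dG oG.
  have v0 (v w : 'rV[R]_0) : v = w by apply/rowP; case.
  exists [set u | O u /\ G u 0]; split.
  - apply: openI => //; rewrite openE => u /oG[e [e0 h]].
    apply/nbhs_ballP; exists e => // u' uu'; apply: h => //; exact: ballxx.
  - have [e e0 xe] := open_ballP oO Ox.
    have [u' [v' [h1 _ h2]]] := dG x 0 Ox (ballxx _ r0) e e0.
    by exists u'; split; [exact: xe|rewrite (v0 0 v')].
  - by move=> u [].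
  - by move=> e e0; exists 0; split; [exact: ballxx|move=> u []].
change n.+1 with (1 + n)%N in G, hG, dG, oG |- *.
(* [T] absorbs the first coordinate of the translation, which may be any small positive number,
   locally uniformly in the other data. It inherits definability, openness and density from [G], so
   the induction hypothesis applies to it. *)
pose T (u : 'rV[R]_m) (v : 'rV[R]_n) : Prop := exists d : R, 0 < d /\
  forall (u' : 'rV[R]_m) (w : 'rV[R]_n) (s : R), ball u d u' -> ball v d w ->
    0 < s -> s < d -> G u' (row_mx (const_mx s) w).
have hG' p (h1 : 'rV[R]_p -> 'rV[R]_m) (h2 : 'rV[R]_p -> 'rV[R]_(1 + n)) :
    dmap M h1 -> dmap M h2 -> dpred M (fun z => G (h1 z) (h2 z)).
  move=> d1 d2; have := dpred_comp hG (dmap_row_mx d1 d2).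
  by apply: dpred_ext => z; rewrite row_mxKl row_mxKr.
have hT : dpred M (fun z : 'rV[R]_(m + n) => T (lsubmx z) (rsubmx z)).
  by rewrite /T; dtac; apply: hG'; dtac.
have oT u v : T u v -> exists e : R, 0 < e /\
     forall u' v', ball u e u' -> ball v e v' -> T u' v'.
  move=> [d [d0 hd]]; have d20 : 0 < d / 2 by rewrite divr_gt0.
  exists (d / 2); split => // u' v' uu' vv'; exists (d / 2); split => //.
  move=> u'' w s u'u'' v'w s0 sd; apply: hd => //.
  - exact: ball_split uu' u'u''.
  - exact: ball_split vv' v'w.
  - by lra.
have dT u v : O u -> ball 0 rho v -> forall e : R, 0 < e ->
     exists u' v', [/\ ball u e u', ball v e v' & T u' v'].
  move=> Ou vr e e0; pose z := row_mx u v.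
  pose N := ball z e `&` ((fun z => lsubmx z) @^-1` O `&` (fun z => rsubmx z) @^-1` (ball 0 rho)).
  have oN : open N.
    apply: openI; first exact: ball_open.
    apply: openI.
      exact: (open_comp (fun z _ => @continuous_lsubmx R m n z) oO).
    apply: (open_comp (fun z _ => @continuous_rsubmx R m n z)).
    exact: ball_open.
  have N0 : N !=set0.
    by exists z; split; [exact: ballxx|split; rewrite /= ?row_mxKl ?row_mxKr].
  pose S (k : rat * bool) (z : 'rV[R]_(m + n)) : Prop := 0 < ratr k.1 :> R /\
    forall s : R, 0 < s -> s < ratr k.1 ->
      if k.2 then G (lsubmx z) (row_mx (const_mx s) (rsubmx z))
      else ~ G (lsubmx z) (row_mx (const_mx s) (rsubmx z)).
  have hS k : dpred M (S k).
    by rewrite /S; case: k.2; dtac; apply: hG'; dtac.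
  have [|[q b] [V [oV [y Vy] VN VS]]] := definable_category hM hS oN N0.
    move=> y _.
    have : tame_at 0 (fun s => G (lsubmx y) (row_mx (const_mx s) (rsubmx y))).
      by apply: (definable_tame hM); apply: hG'; dtac.
    case=> -[d d0 hd]; have [q] := rat_in_itvoo d0;
      rewrite in_itv/= => /andP[q0 qd]; [exists (q, true)|exists (q, false)];
      by split => // s s0 sq; apply: hd; rewrite s0 add0r (lt_trans sq qd).
  have [d d0 yd] := open_ballP oV Vy.
  have [_ [Oy ry]] := VN y Vy.
  have [/= q0 hq] := VS y Vy; rewrite /= in q0.
  case: b VS hq => VS _.
    exists (lsubmx y), (rsubmx y).
    have [/ball_sub_mx[h1 h2] _] := VN y Vy.
    rewrite /z row_mxKl row_mxKr in h1 h2; split => //.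
    exists (Num.min d (ratr q)); split; first by rewrite lt_min d0.
    move=> u' w s h3 h4 s0; rewrite lt_min => /andP[sd sq].
    have md : Num.min d (ratr q) <= d by rewrite ge_min lexx.
    have /yd Vz : ball y d (row_mx u' w).
      rewrite ball_sub_mx row_mxKl row_mxKr.
      by split; [exact: le_ball h3|exact: le_ball h4].
    by have [_ /(_ s s0 sq)] := VS _ Vz; rewrite /= row_mxKl row_mxKr.
  (* Otherwise [G] is avoided over [V] by all first coordinates in ]0, q[. The density hypothesis,
     at a translation whose first coordinate [s0] is well inside this interval, gives a point of [G]
     there. *)
  exfalso; pose s0 := Num.min rho (ratr q) / 2.
  have m0 : 0 < Num.min rho (ratr q) by rewrite lt_min r0.
  have mr : Num.min rho (ratr q) <= rho by rewrite ge_min lexx.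
  have mq : Num.min rho (ratr q) <= ratr q by rewrite ge_min lexx orbT.
  have b0 : ball 0 rho (row_mx (const_mx s0) (rsubmx y) : 'rV[R]_(1 + n)).
    rewrite -[0](row_mx0 R 1 1 n); apply/ball_row_mx; split => //.
    rewrite (_ : 0 = const_mx 0); last by apply/rowP => i; rewrite !mxE.
    by apply/ball_const1; rewrite sub0r normrN gtr0_norm /s0; lra.
  have e20 : 0 < Num.min d s0 by rewrite lt_min d0 /s0; lra.
  have [u' [v' [h1 h2 Guv]]] := dG _ _ Oy b0 _ e20.
  have md : Num.min d s0 <= d by rewrite ge_min lexx.
  have ms : Num.min d s0 <= s0 by rewrite ge_min lexx orbT.
  move: h2; rewrite -[v'](hsubmxK v') => /ball_row_mx[h2 h3].
  have v'E : lsubmx v' = const_mx (lsubmx v' 0 0).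
    by apply/rowP => i; rewrite !mxE (ord1 i).
  have /yd Vz : ball y d (row_mx u' (rsubmx v')).
    rewrite ball_sub_mx row_mxKl row_mxKr.
    by split; [exact: le_ball h1|exact: le_ball h3].
  move: h2; rewrite v'E => /ball_const1/lt_le_trans/(_ ms).
  rewrite ltr_distl => /andP[h4 h5].
  have [_ /(_ (lsubmx v' 0 0))] := VS _ Vz; rewrite /= row_mxKl row_mxKr -v'E hsubmxK.
  by apply => //; rewrite /s0 in h4 h5; lra.
have [V [oV [y Vy] VO hV]] := ih T O rho hT oO (ex_intro _ _ Ox) r0 dT oT.
have [r rr yr] := open_ballP oV Vy; have r20 : 0 < r / 2 by rewrite divr_gt0.
(* Half the radius keeps the closed ball inside [V], as the compactness argument requires. *)
exists (ball y (r / 2)); split.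
- exact: ball_open.
- by exists y; exact: ballxx.
- by apply: subset_trans VO; apply: subset_trans yr; apply: le_ball; lra.
move=> e e0; have [v [ve hv]] := hV e e0.
have [u yu|d [d0 hd]] := @near_const_ball m y (r / 2)
    (fun s u => G u (row_mx (const_mx s) v)).
  have /hv [d [d0 hd]] : V u by apply: yr; rewrite -ball_normE /=; lra.
  by exists d; split => // u' s uu' s0 sd; apply: hd => //; exact: ballxx.
pose s := Num.min d e / 2.
have m0 : 0 < Num.min d e by rewrite lt_min d0.
have md : Num.min d e <= d by rewrite ge_min lexx.
have me : Num.min d e <= e by rewrite ge_min lexx orbT.
exists (row_mx (const_mx s) v); split.
  rewrite -[0](row_mx0 R 1 1 n); apply/ball_row_mx; split => //.
  rewrite (_ : 0 = const_mx 0); last by apply/rowP => i; rewrite !mxE.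
  by apply/ball_const1; rewrite sub0r normrN gtr0_norm /s; lra.
move=> u; rewrite -ball_normE /= => /ltW yu; apply: hd => //; rewrite /s; lra.
Qed.

End Translation.

(** * Uniform limits of exterior derivatives *)

Section Grid.
Context (R : realType).

Lemma uniform_continuity_ball d (J : finType) (p : J -> 'rV[R]_d -> R) (r : R) :
  (forall u, `|u| <= r -> forall j, {for u, continuous (p j)}) ->
  forall t : R, 0 < t -> exists s : R, 0 < s /\ forall u u', `|u| <= r ->
    ball u s u' -> forall j, `|p j u - p j u'| <= t.
Proof.
move=> hc t t0.
have [|d' [d0 hd]] := @near_const_ball R d 0 r
  (fun s u => forall u', ball u s u' -> forall j, `|p j u - p j u'| <= t).
  move=> u; rewrite sub0r normrN => ur.
  have /nbhs_ballP[e /= e0 he] :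
      nbhs u [set y | forall j, `|p j u - p j y| <= t / 2].
    apply: (@filter_forall _ _ (fun (j : J) y => `|p j u - p j y| <= t / 2) (nbhs u)).
    by move=> j; have /cvgrPdist_le := hc u ur j; apply; rewrite divr_gt0.
  exists (e / 2); split; first by rewrite divr_gt0.
  move=> u' s uu' s0 se u'' u'u'' j.
  have b1 : ball u e u' by apply: le_ball uu'; lra.
  have b2 : ball u e u''.
    by apply: ball_split uu' _; apply: le_ball u'u''; exact: ltW.
  have := he _ b1 j; have := he _ b2 j => h2 h1.
  rewrite -(subrKA (p j u)); apply: le_trans (ler_normD _ _) _.
  by rewrite distrC; lra.
exists (d' / 2); split; first by rewrite divr_gt0.
move=> u u' ur uu' j; apply: (hd (d' / 2)) => //; try lra.
by rewrite sub0r normrN.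
Qed.

(** [ordS] is cyclic, so the shift permutes the grid. This expresses the telescoping of increments
    in direction [r], with the wrap-around confined to the last layer. *)
Lemma sum_shift_ffun d N (r : 'I_d) (g : {ffun 'I_d -> 'I_N.+1} -> R) :
  \sum_(P : {ffun 'I_d -> 'I_N.+1}) g [ffun i => if i == r then ordS (P i) else P i]
  = \sum_(P : {ffun 'I_d -> 'I_N.+1}) g P.
Proof.
pose s (P : {ffun 'I_d -> 'I_N.+1}) := [ffun i => if i == r then ordS (P i) else P i].
rewrite [RHS](reindex_inj (h := s))//= => P Q /ffunP PQ.
apply/ffunP => i; have := PQ i; rewrite !ffunE; case: ifP => // _.
exact: ordS_inj.
Qed.

(** Counts the grid lines in direction [r], each of which wraps around once. *)
Lemma sum_last_ffun k N (r : 'I_k.+1) :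
  \sum_(P : {ffun 'I_k.+1 -> 'I_N.+1}) ((P r == ord_max)%:R : R) = N.+1%:R ^+ k.
Proof.
pose c (i : 'I_k.+1) (j : 'I_N.+1) : R := if i == r then (j == ord_max)%:R else 1.
transitivity (\sum_(P : {ffun 'I_k.+1 -> 'I_N.+1}) \prod_i c i (P i)).
  apply: eq_bigr => P _; rewrite (bigD1 r)//= {1}/c eqxx big1 ?mulr1//.
  by move=> i /negbTE ir; rewrite /c ir.
rewrite -bigA_distr_bigA /= (bigD1 r)//= {1}/c eqxx.
rewrite (bigD1 ord_max)//= eqxx big1 ?addr0 ?mul1r; last by move=> i /negbTE ->.
rewrite (eq_bigr (fun=> N.+1%:R)).
  by rewrite prodr_const cardC1 card_ord.
by move=> i /negbTE ir; rewrite /c ir sumr_const card_ord.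
Qed.

(* A discrete divergence theorem: over a grid the increments telescope, leaving
   at most [2 * ep] on each line. *)
Lemma grid_divergence k (h de ep : R) (b p : 'I_k.+1 -> 'rV[R]_k.+1 -> R^o) :
  0 < h ->
  (forall r z, `|z| <= 2 * h -> is_derive z (evec R r) (b r) (p r z)) ->
  (forall r z, `|z| <= 2 * h -> {for z, continuous (p r : _ -> R)}) ->
  (forall z, `|z| <= 2 * h -> de <= \sum_r p r z) ->
  (forall r z, `|z| <= 2 * h -> `|b r z| <= ep) ->
  de * h <= 2 * k.+1%:R * ep.
Proof.
move=> h0 hb hp hde hep.
(* [t] bounds the variation of the partial derivatives over one mesh. It can be taken so small that
   its total contribution is half of a hypothetical excess. *)
suff key (t : R) : 0 < t -> h * (de - k.+1%:R * t) <= k.+1%:R * (2 * ep).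
  rewrite leNgt; apply/negP => hlt.
  have h1 : 0 < (de * h - 2 * k.+1%:R * ep) / 2 by lra.
  have hk : 0 < h * k.+1%:R by rewrite mulr_gt0.
  have := key ((de * h - 2 * k.+1%:R * ep) / 2 / (h * k.+1%:R)) (divr_gt0 h1 hk).
  have E (K X : R) : K != 0 -> h * (de - K * (X / (h * K))) = h * de - X.
    by move=> K0; field; rewrite K0 gt_eqF.
  by rewrite E// => ?; lra.
move=> t0.
have [s [s0 hs]] : exists s : R, 0 < s /\ forall u u', `|u| <= 2 * h ->
    ball u s u' -> forall r, `|p r u - p r u'| <= t.
  by apply: uniform_continuity_ball => // u uh r; exact: hp.
have [N hN] : exists N, h / N.+1%:R < s.
  exists (Num.truncn (h / s)); rewrite ltr_pdivrMr// mulrC -ltr_pdivrMr//.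
  by rewrite truncnS_gt// divr_ge0// ltW.
(* The mesh [q] is below the modulus of uniform continuity [s]. Grid points have norm at most [h],
   and one further step stays within [2 * h], the radius in the hypotheses. *)
pose q := h / N.+1%:R; have q0 : 0 < q by rewrite divr_gt0.
have qN : q * N.+1%:R = h by rewrite divfK.
pose pt (P : {ffun 'I_k.+1 -> 'I_N.+1}) : 'rV[R]_k.+1 := \row_i (q * (P i)%:R).
have pth P : `|pt P| <= h.
  rewrite [leLHS]/Num.Def.normr/= mx_normrE; apply: bigmax_le; first exact: ltW.
  move=> [i j] _; rewrite mxE /= ger0_norm; last by rewrite mulr_ge0// ltW.
  by rewrite -qN ler_pM2l// ler_nat ltnW.
have qh : q <= h by rewrite -qN ler_peMr ?(ltW q0)// ler1n.
have pts P (r : 'I_k.+1) (v : R) : `|v| <= `|q| -> `|pt P + v *: evec R r| <= 2 * h.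
  move=> vq; apply: le_trans (ler_normD _ _) _.
  have := pth P; have := norm_evec r v; rewrite (gtr0_norm q0) in vq.
  by move=> *; lra.
have dif P r : q * (p r (pt P) - t) <= b r (pt P + q *: evec R r) - b r (pt P).
  have [v vq|v [vq ->]] := @MVT_dir R _ (b r) (pt P) (evec R r) q.
    by have [] := hb r _ (pts P r v vq).
  have [_ ->] := hb r _ (pts P r v vq).
  rewrite ler_pM2l//.
  have : `|p r (pt P) - p r (pt P + v *: evec R r)| <= t.
    apply: hs; first by have := pth P => ?; lra.
    rewrite -ball_normE /= opprD addNKr normrN.
    apply: le_lt_trans (norm_evec r v) _; apply: le_lt_trans vq _.
    by rewrite gtr0_norm.
  by rewrite ler_norml => /andP[_]; lra.
(* Unless [P r] is the last index, the next point in direction [r] is the cyclically shifted grid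
   point, and the two terms cancel. Only the last layer contributes, at most [2 * ep] per point. *)
have up r : \sum_P (b r (pt P + q *: evec R r) - b r (pt P)) <= N.+1%:R ^+ k * (2 * ep).
  rewrite sumrB -(sum_shift_ffun r (fun P => b r (pt P))) -sumrB.
  rewrite -(sum_last_ffun N r) mulr_suml; apply: ler_sum => P _.
  have [Pr|Pr] := eqVneq (P r) ord_max.
    rewrite mul1r; apply: le_trans (ler_norm _) _; apply: le_trans (ler_normB _ _) _.
    have h1 : `|b r (pt P + q *: evec R r)| <= ep by apply: hep; exact: pts.
    have h2 : `|b r (pt [ffun i => if i == r then ordS (P i) else P i])| <= ep.
      by apply: hep; apply: le_trans (pth _) _; lra.
    by lra.
  rewrite mul0r (_ : pt P + _ = pt [ffun i => if i == r then ordS (P i) else P i]).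
    by rewrite subrr.
  apply/rowP => i; rewrite !mxE ffunE eqxx /=.
  have [->|ir] := eqVneq i r; last by rewrite mulr0 addr0.
  rewrite mulr1 -[X in _ + X]mulr1 -mulrDr natr1; congr (_ * _%:R).
  rewrite /= modn_small// ltnS ltn_neqAle -ltnS ltn_ord andbT.
  by apply: contra Pr => /eqP Pr; apply/eqP/val_inj.
have low : N.+1%:R ^+ k.+1 * (q * (de - k.+1%:R * t)) <=
    \sum_r \sum_P (b r (pt P + q *: evec R r) - b r (pt P)).
  rewrite exchange_big /=.
  apply: (@le_trans _ _ (\sum_(P : {ffun 'I_k.+1 -> 'I_N.+1}) (q * (de - k.+1%:R * t)))).
    by rewrite sumr_const card_ffun !card_ord -natrX mulr_natl.
  apply: ler_sum => P _; apply: (@le_trans _ _ (\sum_r q * (p r (pt P) - t))).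
    rewrite -mulr_sumr ler_pM2l// sumrB sumr_const card_ord mulr_natl lerB//.
    by apply: hde; have := pth P => ?; lra.
  by apply: ler_sum => r _; exact: dif.
have Nk : 0 < (N.+1%:R : R) ^+ k by rewrite exprn_gt0.
rewrite -(ler_pM2l Nk).
apply: (@le_trans _ _ (\sum_(r < k.+1) N.+1%:R ^+ k * (2 * ep))); last first.
  by rewrite sumr_const card_ord -mulr_natr; lra.
apply: (@le_trans _ _ (\sum_r \sum_P (b r (pt P + q *: evec R r) - b r (pt P)))).
  apply: le_trans _ low; rewrite exprS -qN; lra.
by apply: ler_sum => r _; exact: up.
Qed.

Lemma continuous_of_dist (V W : normedModType R) (f : V -> W) (x : V) :
  (forall e, 0 < e -> nbhs x [set y | `|f x - f y| <= e]) -> {for x, continuous f}.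
Proof. by move=> h; apply/cvgrPdist_le. Qed.

Lemma continuous_affine m n (x0 : 'rV[R]_n) (A : 'M[R]_(m, n)) :
  continuous (fun z : 'rV[R]_m => x0 + z *m A).
Proof.
move=> z; apply: continuous_of_dist => e e0.
have : nbhs z [set y | forall i : 'I_1, forall j : 'I_n, `|(z *m A) i j - (y *m A) i j| <= e].
  apply: (@filter_forall _ _ (fun (i : 'I_1) y => forall j : 'I_n,
    `|(z *m A) i j - (y *m A) i j| <= e) (nbhs z)) => i.
  apply: (@filter_forall _ _ (fun (j : 'I_n) y =>
    `|(z *m A) i j - (y *m A) i j| <= e) (nbhs z)) => j.
  have : {for z, continuous (fun y : 'rV[R]_m => \sum_r y i r * A r j)}.
    apply: continuous_sumr => r; apply: (@continuousM R).
      exact: coord_continuous.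
    exact: cst_continuous.
  move=> /cvgrPdist_le /(_ e e0); apply: filterS => y.
  by rewrite !mxE.
apply: filterS => y hy /=; rewrite opprD addrACA subrr add0r.
rewrite [leLHS]/Num.Def.normr/= mx_normrE.
by apply: bigmax_le => [|[i j] _]; [exact: ltW|rewrite !mxE; have := hy i j; rewrite !mxE].
Qed.

(** Regularity in one direction: under the affine map sending [z] to [x0 + z *m A], derivatives
    along the rows of [A] become partial derivatives on R^(k+1), where the grid estimate lives. *)
Definition C1_dir m (g : 'rV[R]_m -> R^o) (v : 'rV[R]_m) (V : set 'rV[R]_m) : Prop :=
  (forall x, V x -> derivable g x v) /\
  (forall x, V x -> {for x, continuous (fun y => 'D_v g y : R)}).

(* Uniform limits of forms preserve a continuous exterior derivative: only the
   values of the approximations [a'] and of their divergences are controlled. *)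
Lemma divergence_limit_le k m (A : 'M[R]_(k.+1, m)) (x0 : 'rV[R]_m)
    (a : 'I_k.+1 -> 'rV[R]_m -> R^o) (c : 'rV[R]_m -> R) (V : set 'rV[R]_m) :
  open V -> V x0 -> {for x0, continuous c} ->
  (forall r, C1_dir (a r) (row r A) V) ->
  (forall e : R, 0 < e -> exists (a' : 'I_k.+1 -> 'rV[R]_m -> R^o) c',
    [/\ forall r, C1_dir (a' r) (row r A) V,
        forall x, V x -> \sum_r 'D_(row r A) (a' r) x = c' x,
        forall r x, V x -> `|a' r x - a r x| <= e &
        forall x, V x -> `|c' x - c x| <= e]) ->
  c x0 <= \sum_r 'D_(row r A) (a r) x0.
Proof.
move=> oV Vx0 hc ha happ; rewrite leNgt; apply/negP => hlt.
pose D x : R := \sum_r 'D_(row r A) (a r) x.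
have cD : {for x0, continuous D}.
  by apply: continuous_sumr => r; have [_] := ha r; exact.
pose et := (c x0 - D x0) / 4; have et0 : 0 < et by rewrite /et /D; lra.
have et40 : 4 * et = c x0 - D x0 by rewrite /et; lra.
have [d1 [d10 h1]] := (continuous_atP _ _).1 hc et et0.
have [d2 [d20 h2]] := (continuous_atP _ _).1 cD et et0.
have [h [h0 hV]] : exists h : R, 0 < h /\ forall z : 'rV[R]_k.+1, `|z| <= 2 * h ->
    V (x0 + z *m A) /\ et * 2 <= c (x0 + z *m A) - D (x0 + z *m A).
  have : nbhs x0 [set x | V x /\ et * 2 <= c x - D x].
    have n1 : nbhs x0 V by exact: open_nbhs_nbhs.
    have n2 := nbhsx_ballx x0 _ d10; have n3 := nbhsx_ballx x0 _ d20.
    apply: filterS (filterI n1 (filterI n2 n3)) => x [Vx [/h1 + /h2]].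
    by rewrite !ltr_distl => /andP[? ?] /andP[? ?]; split => //; lra.
  have := @continuous_affine _ _ x0 A 0; rewrite /continuous_at mul0mx addr0.
  move=> cA /cA /nbhs_ballP[d /= d0 hd].
  exists (d / 4); split; first by rewrite divr_gt0.
  by move=> z zd; apply: hd; rewrite -ball_normE /= sub0r normrN; lra.
have K0 : 0 < 4 * k.+1%:R :> R by rewrite mulr_gt0// ltr0n.
(* Near [x0] the gap between [c] and [D] is at least [2 * et], and an approximation of [c] to within
   [et] leaves the difference a divergence of at least [et]. The second bound makes the right-hand
   side of the grid estimate at most half of [et * h], a contradiction. *)
have e0 : 0 < Num.min et (et * h / (4 * k.+1%:R)).
  by rewrite lt_min et0 /=; apply: divr_gt0 => //; exact: mulr_gt0.
have [a' [c' [ha' hc' haa hcc]]] := happ _ e0.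
have e1 : Num.min et (et * h / (4 * k.+1%:R)) <= et by rewrite ge_min lexx.
have e2 : Num.min et (et * h / (4 * k.+1%:R)) * (4 * k.+1%:R) <= et * h.
  by rewrite -ler_pdivlMr// ge_min lexx orbT.
have der (g : 'rV[R]_m -> R^o) r z : derivable g (x0 + z *m A) (row r A) ->
    is_derive z (evec R r) (fun z => g (x0 + z *m A)) ('D_(row r A) g (x0 + z *m A)).
  have L1 := is_derive_line g (x0 + z *m A) (row r A) 0 ('D_(row r A) g (x0 + z *m A)).
  have L2 := is_derive_line (fun z => g (x0 + z *m A)) z (evec R r) 0
    ('D_(row r A) g (x0 + z *m A)).
  rewrite scale0r addr0 in L1; rewrite scale0r addr0 in L2.
  move=> /derivableP /L1 H; apply/L2; move: H.
  congr (is_derive _ _ _ _); apply/funext => t.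
  by rewrite mulmxDl -scalemxAl -rowE addrA.
have cc (f : 'rV[R]_m -> R) (z : 'rV[R]_k.+1) : {for x0 + z *m A, continuous f} ->
    {for z, continuous (fun z : 'rV[R]_k.+1 => f (x0 + z *m A))}.
  by move=> hf; apply: continuous_comp => //; exact: continuous_affine.
have : et * h <= 2 * k.+1%:R * Num.min et (et * h / (4 * k.+1%:R)).
  apply: (@grid_divergence k h et (Num.min et (et * h / (4 * k.+1%:R)))
  (fun r z => a' r (x0 + z *m A) - a r (x0 + z *m A))
  (fun r z => 'D_(row r A) (a' r) (x0 + z *m A) - 'D_(row r A) (a r) (x0 + z *m A)) h0).
- move=> r z /hV[Vz _]; apply: is_deriveB.
    by apply: der; have [+ _] := ha' r; exact.
  by apply: der; have [+ _] := ha r; exact.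
- move=> r z /hV[Vz _]; apply: (@continuousB R R^o).
    by apply: (cc (fun x => 'D_(row r A) (a' r) x)); have [_] := ha' r; exact.
  by apply: (cc (fun x => 'D_(row r A) (a r) x)); have [_] := ha r; exact.
- move=> z /hV[Vz hz]; rewrite sumrB hc'// -/(D _).
  by have := hcc _ Vz; rewrite ler_norml => /andP[? ?]; lra.
- by move=> r z /hV[Vz _]; exact: haa.
by have : 0 < et * h by [rewrite mulr_gt0]; lra.
Qed.

Lemma divergence_limit k m (A : 'M[R]_(k.+1, m)) (x0 : 'rV[R]_m)
    (a : 'I_k.+1 -> 'rV[R]_m -> R^o) (c : 'rV[R]_m -> R) (V : set 'rV[R]_m) :
  open V -> V x0 -> {for x0, continuous c} ->
  (forall r, C1_dir (a r) (row r A) V) ->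
  (forall e : R, 0 < e -> exists (a' : 'I_k.+1 -> 'rV[R]_m -> R^o) c',
    [/\ forall r, C1_dir (a' r) (row r A) V,
        forall x, V x -> \sum_r 'D_(row r A) (a' r) x = c' x,
        forall r x, V x -> `|a' r x - a r x| <= e &
        forall x, V x -> `|c' x - c x| <= e]) ->
  \sum_r 'D_(row r A) (a r) x0 = c x0.
Proof.
move=> oV Vx0 hc ha happ; apply/eqP; rewrite eq_le; apply/andP; split; last first.
  exact: divergence_limit_le oV Vx0 hc ha happ.
have dN (g : 'rV[R]_m -> R^o) v x : derivable g x v ->
    'D_v (fun y => - g y) x = - 'D_v g x by exact: deriveN.
have hN (g : 'rV[R]_m -> R^o) v : C1_dir g v V -> C1_dir (fun y => - g y) v V.
  move=> [h1 h2]; split=> [x /h1|x Vx]; first exact: derivableN.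
  apply: (@continuous_near_eq _ _ (fun y => - 'D_v g y : R)).
    have : nbhs x V by exact: open_nbhs_nbhs.
    by apply: filterS => y /h1/dN ->.
  by apply: (@continuousN R R^o); exact: h2.
have hNc : {for x0, continuous (fun x => - c x)} by apply: (@continuousN R R^o).
have := @divergence_limit_le k m A x0 (fun r y => - a r y) (fun y => - c y) V oV Vx0 hNc
  (fun r => hN _ _ (ha r)).
have -> : \sum_r 'D_(row r A) (fun y => - a r y) x0 = - \sum_r 'D_(row r A) (a r) x0.
  by rewrite -sumrN; apply: eq_bigr => r _; apply: dN; have [+ _] := ha r; exact.
rewrite lerN2; apply => e e0; have [a' [c' [h1 h2 h3 h4]]] := happ e e0.
exists (fun r y => - a' r y), (fun y => - c' y); split.
- by move=> r; exact: hN.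
- move=> x Vx; rewrite -h2// -sumrN; apply: eq_bigr => r _.
  by apply: dN; have [+ _] := h1 r; exact.
- by move=> r x Vx; rewrite -opprD normrN; exact: h3.
- by move=> x Vx; rewrite -opprD normrN; exact: h4.
Qed.

End Grid.

(** * Pullback of alternating forms *)

Section AlternatingForms.
Context (R : realType).

(** Multilinearity for plain functions of matrices: the expansion below is an induction on the
    number of rows that freezes the first one at a basis vector. *)
Definition multilin k n (f : 'M[R]_(k, n) -> R) : Prop :=
  forall (A B C : 'M[R]_(k, n)) (i : 'I_k) (b c : R),
    (forall j, A i j = b * B i j + c * C i j) ->
    (forall l, l != i -> forall j, B l j = A l j /\ C l j = A l j) ->
    f A = b * f B + c * f C.

Lemma alt_multilin k n (t : alt R n k) : multilin t.
Proof.
move=> A B C i b c hi hl.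
have li l : lift i l != i by rewrite eq_sym neq_lift.
apply: (alt_multilinear t (i := i)).
- by apply/rowP => j; rewrite !mxE hi.
- by apply/matrixP => l j; rewrite !mxE; have [] := hl _ (li l) j.
- by apply/matrixP => l j; rewrite !mxE; have [] := hl _ (li l) j.
Qed.

Definition upd k n (A : 'M[R]_(k, n)) (i : 'I_k) (v : 'rV[R]_n) : 'M[R]_(k, n) :=
  \matrix_(l, j) if l == i then v 0 j else A l j.

Lemma upd_row k n (A : 'M[R]_(k, n)) i : upd A i (row i A) = A.
Proof. by apply/matrixP => l j; rewrite !mxE; case: eqVneq => // ->. Qed.

Lemma multilin_upd k n (f : 'M[R]_(k, n) -> R) A i b c (u v : 'rV[R]_n) :
  multilin f -> f (upd A i (b *: u + c *: v)) = b * f (upd A i u) + c * f (upd A i v).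
Proof.
move=> hf; apply: (hf _ _ _ i) => [j|l li j]; rewrite !mxE ?eqxx//.
by rewrite (negbTE li).
Qed.

Lemma multilin_sum k n (f : 'M[R]_(k, n) -> R) A i (J : Type) (s : seq J)
    (b : J -> R) (u : J -> 'rV[R]_n) : multilin f ->
  f (upd A i (\sum_(l <- s) b l *: u l)) = \sum_(l <- s) b l * f (upd A i (u l)).
Proof.
move=> hf; elim: s => [|l s ih].
  rewrite !big_nil; have := multilin_upd A i 0 0 0 0 hf.
  by rewrite !scaler0 !mul0r !addr0.
rewrite !big_cons -ih -[X in _ = _ + X]mul1r -multilin_upd//.
by rewrite scale1r.
Qed.

Lemma sum_ffunS (T : finType) k (F : {ffun 'I_k.+1 -> T} -> R) :
  \sum_K F K = \sum_(c : T) \sum_(K : {ffun 'I_k -> T})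
    F [ffun i => oapp K c (unlift ord0 i)].
Proof.
rewrite pair_big /=.
pose h (p : T * {ffun 'I_k -> T}) : {ffun 'I_k.+1 -> T} :=
  [ffun i => oapp p.2 p.1 (unlift ord0 i)].
rewrite (reindex h) /=; first by apply: eq_bigr => -[].
exists (fun K => (K ord0, [ffun i => K (lift ord0 i)])).
  move=> [c K] _; rewrite /h /= ffunE unlift_none /=; congr (_, _).
  by apply/ffunP => i; rewrite !ffunE liftK.
move=> K _; apply/ffunP => i; rewrite /h ffunE.
by case: unliftP => [j|] -> //=; rewrite ffunE.
Qed.

Lemma multilin_expand k n (f : 'M[R]_(k, n) -> R) A : multilin f ->
  f A = \sum_(K : {ffun 'I_k -> 'I_n}) (\prod_i A i (K i)) * f (rowsub K 1%:M).
Proof.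
elim: k f A => [|k ih] f A hf.
  rewrite (eq_bigr (fun=> f A)); last first.
    by move=> K _; rewrite big_ord0 mul1r; congr f; apply/matrixP; case.
  by rewrite sumr_const card_ffun !card_ord expn0.
pose g c (B : 'M[R]_(k, n)) : R :=
  f (\matrix_(i, j) oapp (fun l => B l j) (c == j)%:R (unlift ord0 i)).
have hg c : multilin (g c).
  move=> B C D i b d hi hl; apply: (hf _ _ _ (lift ord0 i)) => [j|l].
    by rewrite !mxE liftK /=.
  case: (unliftP ord0 l) => [m -> mi|-> _] j; rewrite !mxE ?liftK ?unlift_none//=.
  by apply: hl; rewrite (inj_eq lift_inj) in mi.
rewrite sum_ffunS -[in LHS](upd_row A ord0) [row ord0 A]row_evec.
rewrite multilin_sum//; apply: eq_bigr => c _.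
transitivity (A ord0 c * g c (\matrix_(i, j) A (lift ord0 i) j)).
  rewrite mxE; congr (_ * f _); apply/matrixP => i j; rewrite !mxE.
  by case: unliftP => [l|] -> //=; rewrite ?eqxx /= ?mxE// eq_sym.
rewrite (ih (g c))// mulr_sumr; apply: eq_bigr => K _.
rewrite mulrA; congr (_ * _).
  rewrite big_ord_recl ffunE unlift_none /=; congr (_ * _).
  by apply: eq_bigr => i _; rewrite ffunE liftK mxE.
congr f; apply/matrixP => i j; rewrite !mxE ffunE.
by case: unliftP => [l|] _ /=; rewrite ?mxE.
Qed.

Lemma alt_expand k n (t : alt R n k) A :
  t A = \sum_(K : {ffun 'I_k -> 'I_n}) (\prod_i A i (K i)) * t (rowsub K 1%:M).
Proof. exact/multilin_expand/alt_multilin. Qed.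

Lemma alt_ext k n (t u : alt R n k) : t =1 u -> t = u.
Proof.
case: t u => [t t1 t2] [u u1 u2] /= /funext tu; subst u.
by congr Alt; exact: Prop_irrelevance.
Qed.

Definition swap_rows k n (i j : 'I_k) (A : 'M[R]_(k, n)) : 'M[R]_(k, n) :=
  \matrix_(l, m) A (tperm i j l) m.

Lemma alt_swap k n (t : alt R n k) (i j : 'I_k) A : i != j ->
  t (swap_rows i j A) = - t A.
Proof.
move=> ij; pose F (u v : 'rV[R]_n) := t (upd (upd A i u) j v).
have F0 u : F u u = 0.
  apply: (alt_alternating t ij) => m; by rewrite !mxE !eqxx (negbTE ij).
have updC u v : upd (upd A i u) j v = upd (upd A j v) i u.
  apply/matrixP => l m; rewrite !mxE.
  by have [->|//] := eqVneq l j; rewrite eq_sym (negbTE ij).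
have FDr u v w : F u (v + w) = F u v + F u w.
  have := multilin_upd (upd A i u) j 1 1 v w (alt_multilin t).
  by rewrite !scale1r !mul1r.
have FDl u v w : F (u + v) w = F u w + F v w.
  rewrite /F !updC; have := multilin_upd (upd A j w) i 1 1 u v (alt_multilin t).
  by rewrite !scale1r !mul1r.
have := F0 (row i A + row j A); rewrite FDl !FDr !F0 add0r addr0 => /eqP.
rewrite addr_eq0 => /eqP E.
have -> : t A = F (row i A) (row j A).
  congr (t _); apply/matrixP => l m; rewrite !mxE.
  have [->//|lj] := eqVneq l j.
  by have [->|] := eqVneq l i.
rewrite E opprK; congr (t _); apply/matrixP => l m; rewrite !mxE.
by have [->|li] := eqVneq l i; [rewrite tpermL (negbTE ij)|
  have [->|lj] := eqVneq l j; [rewrite tpermR|rewrite tpermD// eq_sym]].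
Qed.

Lemma alt_rowsub_swap k n (t : alt R n k) (i j : 'I_k) (K : 'I_k -> 'I_n) : i != j ->
  t (rowsub K 1%:M) = - t (rowsub (K \o tperm i j) 1%:M).
Proof.
move=> ij; rewrite -(alt_swap t _ ij); congr (t _).
by apply/matrixP => l m; rewrite !mxE /= tpermK.
Qed.

(* Swapping an inversion of [K] increases the weight [w K]. *)
Lemma alt_rowsub_sort k n (K : 'I_k -> 'I_n) :
  (forall t : alt R n k, t (rowsub K 1%:M) = 0) \/
  exists (I : 'I_k -> 'I_n) (c : R), increasing I /\
    forall t : alt R n k, t (rowsub K 1%:M) = c * t (rowsub I 1%:M).
Proof.
pose w (K : 'I_k -> 'I_n) : nat := (\sum_(i < k) i * K i)%N.
have wb (L : 'I_k -> 'I_n) : (w L <= k * (k * n))%N.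
  rewrite -[X in (_ <= X * _)%N]card_ord -sum_nat_const; apply: leq_sum => i _.
  by apply: leq_mul; exact: ltnW.
(* The weight is bounded by [k * (k * n)], so the induction is on what is missing to this bound. A
   failure of increase is either a repeated index, where alternation gives zero, or an inversion to
   be swapped. *)
move: {2}(_ - w K)%N (leqnn (k * (k * n) - w K)) => d.
elim: d K => [|d ih] K hd.
all: have [inc|] := pselect (increasing K); first by right; exists K, 1; split => // t; rewrite mul1r.
all: move=> /existsNP[a /existsNP[b /not_implyP[ab /negP]]]; rewrite -leqNgt leq_eqVlt.
all: have nab : a != b by rewrite neq_ltn ab.
all: move=> /predU1P[Kab|Kba]; first by left=> t; apply: (alt_alternating t nab) => j;
  rewrite !mxE (val_inj Kab : K b = K a).
all: have wlt : (w K < w (K \o tperm a b))%N.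
1,3: rewrite /w (bigD1 a)//= (bigD1 b) ?(eq_sym b)//= addnA;
  rewrite [X in (_ < X)%N](bigD1 a)//= [X in (_ < _ + X)%N](bigD1 b) ?(eq_sym b)//= addnA;
  rewrite tpermL tpermR; rewrite [X in (_ < _ + X)%N](eq_bigr (fun i : 'I_k => i * K i)%N);
  [rewrite ltn_add2r; nia|by move=> i /andP[ia ib]; rewrite tpermD// eq_sym].
  by have := wb (K \o tperm a b); lia.
have [|h|[I [c [incI h]]]] := ih (K \o tperm a b).
- by have := wb (K \o tperm a b); lia.
- by left=> t; rewrite (alt_rowsub_swap t _ nab) h oppr0.
right; exists I, (- c); split => // t.
by rewrite (alt_rowsub_swap t _ nab) h mulNr.
Qed.

Definition ins k n (a : 'I_k.+1) (w : 'rV[R]_n) (B : 'M[R]_(k, n)) : 'M[R]_(k.+1, n) :=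
  \matrix_(i, j) oapp (fun l => B l j) (w 0 j) (unlift a i).

(** The row at place [a] reaches the front after [a] swaps with its neighbour, each of which changes
    the sign. *)
Lemma alt_ins k n (t : alt R n k.+1) (a : 'I_k.+1) w (B : 'M[R]_(k, n)) :
  t (ins a w B) = (-1) ^+ a * t (ins ord0 w B).
Proof.
case: a => a; elim: a => [|a ih] ha.
  by rewrite mul1r (_ : Ordinal ha = ord0)//; apply: val_inj.
have ha' : (a < k.+1)%N by exact: ltnW.
have nab : Ordinal ha' != Ordinal ha by rewrite -val_eqE /= ltn_eqF.
rewrite exprS mulN1r mulNr -(ih ha') -(alt_swap t _ nab); congr (t _).
apply/matrixP => i j; rewrite !mxE.
have [->|ia] := eqVneq i (Ordinal ha).
  by rewrite tpermR !unlift_none.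
have [->|ia'] := eqVneq i (Ordinal ha').
  rewrite tpermL.
  pose l0 : 'I_k := Ordinal (ha : a < k)%N.
  have e1 : Ordinal ha' = lift (Ordinal ha) l0.
    by apply: val_inj; rewrite /= /bump ltnn.
  have e2 : Ordinal ha = lift (Ordinal ha') l0.
    by apply: val_inj; rewrite /= /bump leqnn.
  have -> : unlift (Ordinal ha) (Ordinal ha') = Some l0 by rewrite e1 liftK.
  by have -> : unlift (Ordinal ha') (Ordinal ha) = Some l0 by rewrite e2 liftK.
rewrite tpermD 1?eq_sym//; congr (oapp _ _ _).
case: (unliftP (Ordinal ha) i) => [l El|El]; last by rewrite El eqxx in ia.
case: (unliftP (Ordinal ha') i) => [m Em|Em]; last by rewrite Em eqxx in ia'.
congr (Some _); apply: ord_inj; move/(congr1 (@nat_of_ord _)): El => /=.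
move: ia ia'; rewrite Em -!val_eqE /= /bump.
move: (nat_of_ord l) (nat_of_ord m) => p q.
by case: (ltnP a p) => h1; case: (leqP a q) => h2; rewrite ?add1n ?add0n; lia.
Qed.

End AlternatingForms.

(** * Exterior derivative of a pullback along a twice differentiable map *)

Section PullbackDerivative.
Context (R : realType).

Lemma upd_ins k n (B : 'M[R]_(k.+1, n)) (a : 'I_k.+1) (w : 'rV[R]_n) :
  upd B a w = ins a w (row' a B).
Proof.
apply/matrixP => i j; rewrite !mxE; case: unliftP => [l|] ->.
  by rewrite /= mxE eq_sym (negbTE (neq_lift a l)).
by rewrite eqxx.
Qed.

Lemma antisymmetric_sum k (G : 'I_k -> 'I_k -> R) :
  (forall r s, G r s = - G s r) -> \sum_r \sum_s G r s = 0.
Proof.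
move=> h; have E : \sum_r \sum_s G r s = - \sum_r \sum_s G r s.
  rewrite {1}exchange_big /= -sumrN; apply: eq_bigr => r _.
  by rewrite -sumrN; apply: eq_bigr => s _; rewrite h.
by lra.
Qed.

(* The second derivatives of a map do not contribute to the exterior derivative
   of a pullback. *)
Lemma hessian_cancel k n (t : alt R n k) (C : 'M[R]_(k.+1, n))
    (H : 'I_k.+1 -> 'I_k.+1 -> 'rV[R]_n) : (forall r s, H r s = H s r) ->
  \sum_(r < k.+1) (-1) ^+ r * \sum_(a < k) t (upd (row' r C) a (H r (lift r a))) = 0.
Proof.
case: k t C H => [|k] t C H Hs.
  by rewrite big1// => r _; rewrite big_ord0 mulr0.
(* [G r s] is the term with the vector [H r s] moved to the front, [a] being the place of [s] once
   row [r] is removed. Exchanging [r] and [s] keeps this vector and the remaining rows but changes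
   the exponent by one, so [G] is antisymmetric. *)
pose G (r s : 'I_k.+2) : R := if unlift r s is Some a then
  (-1) ^+ (r + a) * t (ins ord0 (H r s) (row' a (row' r C))) else 0.
transitivity (\sum_r \sum_s G r s); last apply: antisymmetric_sum.
  apply: eq_bigr => r _; rewrite (bigD1_ord r)//= {1}/G unlift_none add0r mulr_sumr.
  apply: eq_bigr => a _; rewrite /G liftK upd_ins alt_ins mulrA -exprD.
  by [].
move=> r s; rewrite /G; case: (unliftP r s) => [a Ea|->]; last first.
  by rewrite unlift_none oppr0.
case: (unliftP s r) => [b Eb|E]; last by move: (neq_lift r a); rewrite -Ea E eqxx.
rewrite (Hs s r).
have sE : nat_of_ord s = bump r a by rewrite Ea.
have rE : nat_of_ord r = bump s b by rewrite Eb.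
have bE : nat_of_ord b = unbump a r.
  by move: sE rE; rewrite /bump /unbump; case: leqP; case: leqP; case: ltnP => *; lia.
have -> : row' b (row' s C) = row' a (row' r C).
  apply/matrixP => i j; rewrite !mxE; congr (C _ _); apply: ord_inj.
  by rewrite /= bE [RHS]bumpC -sE.
have [h|h] : (r + a = (s + b).+1 \/ s + b = (r + a).+1)%N.
- move: sE rE; rewrite /bump; case: leqP; case: leqP => *; lia.
- by rewrite h exprS mulN1r mulNr.
- by rewrite h exprS mulN1r mulNr opprK.
Qed.

Section Rules.
Context (V : normedModType R) (x v : V).

Lemma is_derive_bigsum (J : Type) (s : seq J) (F : J -> V -> R^o) (dF : J -> R) :
  (forall i, is_derive x v (F i) (dF i)) ->
  is_derive x v (fun y => \sum_(i <- s) F i y : R^o) (\sum_(i <- s) dF i).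
Proof.
move=> h; elim: s => [|i s ih].
  rewrite (_ : (fun _ => _) = cst 0) ?big_nil; first exact: is_derive_cst.
  by apply/funext => y; rewrite big_nil.
rewrite (_ : (fun _ => _) = (F i \+ (fun y => \sum_(i <- s) F i y))) ?big_cons.
  exact: is_deriveD.
by apply/funext => y; rewrite big_cons.
Qed.

Lemma is_derive_mul (f g : V -> R^o) (df dg : R) :
  is_derive x v f df -> is_derive x v g dg ->
  is_derive x v (fun y => f y * g y : R^o) (df * g x + f x * dg).
Proof.
move=> hf hg; have := is_deriveM hf hg.
by rewrite addrC [g x *: df]mulrC.
Qed.

Lemma is_derive_bigprod k (f : 'I_k -> V -> R^o) (df : 'I_k -> R) :
  (forall i, is_derive x v (f i) (df i)) ->
  is_derive x v (fun y => \prod_i f i y : R^o)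
    (\sum_a \prod_i (if i == a then df i else f i x)).
Proof.
elim: k f df => [|k ih] f df h.
  rewrite big_ord0 (_ : (fun _ => _) = cst 1); first exact: is_derive_cst.
  by apply/funext => y; rewrite big_ord0.
have := is_derive_mul (h ord0) (ih (fun i => f (lift ord0 i)) (fun i => df (lift ord0 i)) (fun i => h _)).
rewrite (_ : (fun y => f ord0 y * _) = (fun y => \prod_i f i y)); last first.
  by apply/funext => y; rewrite big_ord_recl.
rewrite (_ : _ + _ = \sum_a \prod_i (if i == a then df i else f i x))//.
rewrite big_ord_recl; congr (_ + _).
  by rewrite big_ord_recl eqxx.
rewrite mulr_sumr; apply: eq_bigr => a _; rewrite big_ord_recl /=.
by congr (_ * _).
Qed.

End Rules.

Lemma is_derive_diff (V W : normedModType R) (f : V -> W) (x v : V) :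
  differentiable f x -> is_derive x v f ('d f x v).
Proof. by move=> h; apply: DeriveDef; [exact: diff_derivable|exact: deriveE]. Qed.

(** The product rule applied to the expansion of [b] in its coefficients: one term differentiates
    the coefficients along [w], and the term of index [a] differentiates the [a]-th argument. *)
Lemma derive_alt_pull k m n (g : 'rV[R]_m -> 'rV[R]_n) (J : 'rV[R]_m -> 'M[R]_(m, n))
    (b : 'rV[R]_n -> alt R n k) (u v : 'rV[R]_m) (C : 'M[R]_(k, m)) (w : 'rV[R]_n)
    (DJ : 'M[R]_(m, n)) :
  differentiable g u -> 'd g u v = w ->
  (forall i j, is_derive u v (fun u' => J u' i j : R^o) (DJ i j)) ->
  (forall K, differentiable (fun y => b y (rowsub K 1%:M) : R^o) (g u)) ->
  is_derive u v (fun u' => b (g u') (C *m J u') : R^o)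
    ('D_w (fun y => b y (C *m J u) : R^o) (g u) +
     \sum_a b (g u) (upd (C *m J u) a (row a C *m DJ))).
Proof.
move=> dg dgw dJ db.
have dCJ (a : 'I_k) j : is_derive u v (fun u' => (C *m J u') a j : R^o) ((C *m DJ) a j).
  rewrite (_ : (fun _ => _) = (fun u' => \sum_i C a i * J u' i j)); last first.
    by apply/funext => u'; rewrite mxE.
  by rewrite mxE; apply: is_derive_bigsum.
pose c (K : {ffun 'I_k -> 'I_n}) (y : 'rV[R]_n) : R^o := b y (rowsub K 1%:M).
have dc K : is_derive u v (fun u' => c K (g u')) ('D_w (c K) (g u)).
  have := is_derive_diff v (differentiable_comp dg (db K)).
  by rewrite diff_comp// /comp /= dgw -deriveE.
have -> : (fun u' => b (g u') (C *m J u') : R^o) =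
    (fun u' => \sum_(K : {ffun 'I_k -> 'I_n}) (\prod_i (C *m J u') i (K i)) * c K (g u')).
  by apply/funext => u'; rewrite alt_expand.
pose dP (K : {ffun 'I_k -> 'I_n}) : R :=
  \sum_a \prod_i (if i == a then (C *m DJ) i (K i) else (C *m J u) i (K i)).
have dK (K : {ffun 'I_k -> 'I_n}) :
    is_derive u v (fun u' => (\prod_i (C *m J u') i (K i)) * c K (g u') : R^o)
      (dP K * c K (g u) + (\prod_i (C *m J u) i (K i)) * 'D_w (c K) (g u)).
  exact: is_derive_mul (is_derive_bigprod (fun i => dCJ i (K i))) (dc K).
have dS := is_derive_bigsum (index_enum _) dK.
move: dS; congr (is_derive _ _ _ _).
rewrite big_split /= addrC; congr (_ + _).
  have -> : (fun y => b y (C *m J u) : R^o) =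
      (fun y => \sum_(K : {ffun 'I_k -> 'I_n}) (\prod_i (C *m J u) i (K i)) * c K y).
    by apply/funext => y; rewrite alt_expand.
  have dQ (K : {ffun 'I_k -> 'I_n}) :
      is_derive (g u) w (fun y => (\prod_i (C *m J u) i (K i)) * c K y : R^o)
        ((\prod_i (C *m J u) i (K i)) * 'D_w (c K) (g u)).
    have dcK : is_derive (g u) w (c K) ('D_w (c K) (g u)).
      by apply/derivableP/diff_derivable; exact: db.
    have := is_derive_mul (is_derive_cst (\prod_i (C *m J u) i (K i) : R^o) (g u) w) dcK.
    by rewrite mul0r add0r.
  by have [_ ->] := is_derive_bigsum (index_enum _) dQ.
under eq_bigr do rewrite mulr_suml.
rewrite exchange_big /=; apply: eq_bigr => a _; rewrite alt_expand.
apply: eq_bigr => K _; congr (_ * _); apply: eq_bigr => i _.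
by rewrite [RHS]mxE; case: eqVneq => [->|//]; rewrite -row_mul [RHS]mxE.
Qed.

(** The argument terms of the product rule are values of a symmetric bilinear map, the second
    derivative, and cancel. [J] has to agree with the Jacobian of [g] at [u], so the Jacobian of a
    translate of [g] may be used for it. *)
Lemma ext_deriv_pull k m n (g : 'rV[R]_m -> 'rV[R]_n) (J : 'rV[R]_m -> 'M[R]_(m, n))
    (b : 'rV[R]_n -> alt R n k) (u : 'rV[R]_m) (DJ : 'rV[R]_m -> 'M[R]_(m, n)) :
  differentiable g u -> J u = jacobian g u ->
  (forall v i j, is_derive u v (fun u' => J u' i j : R^o) (DJ v i j)) ->
  (forall v w, w *m DJ v = v *m DJ w) ->
  (forall K, differentiable (fun y => b y (rowsub K 1%:M) : R^o) (g u)) ->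
  forall A, ext_deriv (fun u' => alt_pull (J u') (b (g u'))) u A =
    ext_deriv b (g u) (A *m J u).
Proof.
move=> dg Ju dJ sJ db A; rewrite /ext_deriv.
have row'M r : row' r (A *m J u) = row' r A *m J u.
  by rewrite !row'Esub mul_rowsub_mx.
rewrite -[RHS]addr0 -[X in _ + X](@hessian_cancel k n (b (g u)) (A *m J u)
  (fun r s => row s A *m DJ (row r A))); last by move=> r s; rewrite sJ.
rewrite -big_split /=; apply: eq_bigr => r _; rewrite -mulrDr; congr (_ * _).
have dgv : 'd g u (row r A) = row r (A *m J u).
  by rewrite row_mul Ju -deriveEjacobian// deriveE.
have [_ ->] := derive_alt_pull (row' r A) dg dgv (dJ (row r A)) db.
rewrite row'M; congr (_ + _); apply: eq_bigr => a _; congr (b _ (upd _ _ (_ *m _))).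
by apply/rowP => j; rewrite !mxE.
Qed.

(** The second difference with steps [h] in the two directions is symmetric in them. Two mean value
    theorems write it as [h * h] times either mixed derivative at a point within [3 * h] of [x], and
    continuity of both at [x] forces equality. *)
Lemma clairaut n (f : 'rV[R]_n -> R^o) (i l : 'I_n) (x : 'rV[R]_n) (V : set 'rV[R]_n) :
  open V -> V x ->
  (forall y, V y -> derivable f y (evec R i) /\ derivable f y (evec R l)) ->
  (forall y, V y -> derivable (fun z => 'D_(evec R i) f z) y (evec R l)) ->
  (forall y, V y -> derivable (fun z => 'D_(evec R l) f z) y (evec R i)) ->
  {for x, continuous (fun y => 'D_(evec R l) (fun z => 'D_(evec R i) f z) y : R)} ->
  {for x, continuous (fun y => 'D_(evec R i) (fun z => 'D_(evec R l) f z) y : R)} ->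
  'D_(evec R l) (fun z => 'D_(evec R i) f z) x =
  'D_(evec R i) (fun z => 'D_(evec R l) f z) x.
Proof.
move=> oV Vx df dil dli cil cli.
have [e e0 xe] := open_ballP oV Vx.
pose F a b := 'D_(evec R a) (fun z => 'D_(evec R b) f z).
have key (a b : 'I_n) (h : R) : (forall y, V y -> derivable f y (evec R a)) ->
    (forall y, V y -> derivable (fun z => 'D_(evec R a) f z) y (evec R b)) ->
    0 < h -> 2 * h < e -> exists y, ball x (3 * h) y /\
    f (x + h *: evec R a + h *: evec R b) - f (x + h *: evec R a)
      - (f (x + h *: evec R b) - f x) = h * (h * F b a y).
  move=> da dab h0 he.
  have inV (s t : R) : `|s| <= `|h| -> `|t| <= `|h| ->
      ball x (3 * h) (x + s *: evec R a + t *: evec R b) /\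
      V (x + s *: evec R a + t *: evec R b).
    move=> sh th; have : `|x - (x + s *: evec R a + t *: evec R b)| <= 2 * h.
      rewrite -addrA opprD addNKr normrN.
      apply: le_trans (ler_normD _ _) _.
      have := norm_evec a s; have := norm_evec b t; rewrite (gtr0_norm h0) in sh th.
      by move=> *; lra.
    by move=> hx; split; [|apply: xe]; rewrite -ball_normE /=; lra.
  pose g (y : 'rV[R]_n) : R^o := f (y + h *: evec R b) - f y.
  have dg (s : R) : `|s| <= `|h| -> is_derive (x + s *: evec R a) (evec R a) g
      ('D_(evec R a) f (x + s *: evec R a + h *: evec R b) - 'D_(evec R a) f (x + s *: evec R a)).
    move=> sh; apply: is_deriveB; last first.
      have z0 : `|0 : R| <= `|h| by rewrite normr0.
      by apply/derivableP/da; have [_] := inV s 0 sh z0; rewrite scale0r addr0.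
    have hd : derivable f (x + s *: evec R a + h *: evec R b) (evec R a).
      by apply: da; have [] := inV s h sh (lexx _).
    move/derivableP: hd => -[h1 h2]; apply: DeriveDef; move: h1 h2; rewrite /derivable /derive /=.
      by under eq_fun do rewrite addrA.
    by move=> _; under eq_fun do rewrite addrA.
  have [s' s'h|s [sh]] := @MVT_dir R _ g x (evec R a) h.
    by have [] := dg s' s'h.
  have [_ ->] := dg s sh.
  have [t' t'h|t [th ->]] := @MVT_dir R _ (fun z => 'D_(evec R a) f z) (x + s *: evec R a) (evec R b) h.
    by apply: dab; have [] := inV s t' sh t'h.
  move=> E; exists (x + s *: evec R a + t *: evec R b); split.
    by have [] := inV s t sh th.
  by rewrite -E /g.
apply/eqP; rewrite eq_sym -subr_eq0 -normr_le0 leNgt; apply/negP => hlt.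
pose d := `|F i l x - F l i x| / 4.
have d0 : 0 < d by rewrite divr_gt0.
have [r1 [r10 h1]] : exists r : R, 0 < r /\ forall y, ball x r y ->
    `|F l i x - F l i y| < d by exact: (continuous_atP _ _).1 cil d d0.
have [r2 [r20 h2]] : exists r : R, 0 < r /\ forall y, ball x r y ->
    `|F i l x - F i l y| < d by exact: (continuous_atP _ _).1 cli d d0.
pose h := Num.min e (Num.min r1 r2) / 4.
have m0 : 0 < Num.min e (Num.min r1 r2) by rewrite !lt_min e0 r10.
have me : Num.min e (Num.min r1 r2) <= e by rewrite ge_min lexx.
have m1 : Num.min e (Num.min r1 r2) <= r1 by rewrite !ge_min lexx orbT.
have m2 : Num.min e (Num.min r1 r2) <= r2 by rewrite !ge_min lexx !orbT.
have h0 : 0 < h by rewrite /h; lra.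
have he : 2 * h < e by rewrite /h; lra.
have hr1 : 3 * h <= r1 by rewrite /h; lra.
have hr2 : 3 * h <= r2 by rewrite /h; lra.
have [y1 [b1 E1]] := key i l h (fun y Vy => (df y Vy).1) dil h0 he.
have [y2 [b2 E2]] := key l i h (fun y Vy => (df y Vy).2) dli h0 he.
have : h * (h * F l i y1) = h * (h * F i l y2).
  rewrite -E1 -E2 (addrAC x (h *: evec R l)).
  by rewrite !opprB addrACA [RHS]addrACA; congr (_ + _); rewrite addrC.
move=> /(mulfI (lt0r_neq0 h0))/(mulfI (lt0r_neq0 h0)) E.
have := h2 y2 (le_ball hr2 b2); have := h1 y1 (le_ball hr1 b1).
rewrite -E {E E1 E2}; move: d0; rewrite /d.
move: (F l i x) (F i l x) (F l i y1) => p q r d0.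
rewrite !ltr_distl => /andP[? ?] /andP[? ?].
have : `|q - p| < 4 * (`|q - p| / 4) by rewrite ltr_distl; apply/andP; split; lra.
by lra.
Qed.

End PullbackDerivative.

(** * Calculus of C^1 functions on open sets *)

Section C1Calculus.
Context (R : realType).

Lemma differentiable_near_eq (V W : normedModType R) (f g : V -> W) (x : V) :
  {near x, f =1 g} -> differentiable f x ->
  differentiable g x /\ 'd g x = 'd f x :> (_ -> _).
Proof.
move=> fg df; have e : f x = g x by exact: nbhs_singleton fg.
have [dc _] := (diff_locallyP x f).1 df.
have E : g \o shift x = cst (g x) + 'd f x +o_ 0 id.
  have /eqaddoP h := diff_locally df; apply/eqaddoP => d d0.
  have n1 : \forall h \near 0, f (h + x) = g (h + x).
    have : \forall z \near x, f z = g z by exact: fg.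
    by rewrite (near_shift 0 x); apply: filterS => k /=; rewrite subr0.
  move: (h d d0) n1; apply: filter_app2; near=> k.
  by rewrite !fctE /= e => h1 <-.
have D : 'd g x = 'd f x :> (_ -> _) by exact: (diff_unique dc E).
split; last exact: D.
by apply/diff_locallyP; rewrite D; split; [exact: dc|exact: E].
Unshelve. all: by end_near. Qed.

Lemma C1_onP n (V : set 'rV[R]_n) (f : 'rV[R]_n -> R^o) : open V ->
  C1_on V f <-> forall v, C1_dir f v V.
Proof.
move=> oV; split=> [[h1 h2] v|h].
  split=> x Vx; first by apply: diff_derivable; exact: h1.
  have /(open_continuous_within _ oV) /(_ x Vx) := h2 v.
  apply: continuous_near_eq; have : nbhs x V by exact: open_nbhs_nbhs.
  by apply: filterS => y /h1 hy; rewrite deriveE.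
by apply: C1_of_partials => // x Vx r; have [] := h (evec R r); auto.
Qed.

Lemma C1_on_continuous n (V : set 'rV[R]_n) (f : 'rV[R]_n -> R^o) x :
  C1_on V f -> V x -> {for x, continuous (f : _ -> R)}.
Proof. by move=> [h _] /h /differentiable_continuous. Qed.

Lemma C1_on_ext n (V : set 'rV[R]_n) (f g : 'rV[R]_n -> R^o) : open V ->
  (forall x, V x -> f x = g x) -> C1_on V f -> C1_on V g.
Proof.
move=> oV fg [h1 h2].
have nV x : V x -> {near x, f =1 g}.
  by move=> Vx; have : nbhs x V by [exact: open_nbhs_nbhs]; apply: filterS.
split=> [x Vx|v]; first exact: (differentiable_near_eq (nV x Vx) (h1 x Vx)).1.
apply/(open_continuous_within _ oV) => x Vx.
have /(open_continuous_within _ oV) /(_ x Vx) := h2 v.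
apply: continuous_near_eq; have : nbhs x V by exact: open_nbhs_nbhs.
apply: filterS => y Vy; have [_ E] := differentiable_near_eq (nV y Vy) (h1 y Vy).
exact: (congr1 (fun h => h v) (esym E)).
Qed.

Lemma C1_on_sub n (V U : set 'rV[R]_n) (f : 'rV[R]_n -> R^o) : open V -> open U ->
  V `<=` U -> C1_on U f -> C1_on V f.
Proof.
move=> oV oU VU /(C1_onP _ oU) h; apply/(C1_onP _ oV) => v.
by have [h1 h2] := h v; split=> x /VU; [exact: h1|exact: h2].
Qed.

Lemma C1_on_cst n (V : set 'rV[R]_n) (a : R) : open V -> C1_on V (fun=> a : R^o).
Proof.
move=> oV; apply/(C1_onP _ oV) => v; split=> x Vx; first exact: derivable_cst.
have -> : (fun y : 'rV[R]_n => 'D_v (fun=> a : R^o) y : R) = cst 0.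
  by apply/funext => y; exact: derive_cst.
exact: cst_continuous.
Qed.

Lemma C1_on_add n (V : set 'rV[R]_n) (f g : 'rV[R]_n -> R^o) : open V ->
  C1_on V f -> C1_on V g -> C1_on V (fun x => f x + g x : R^o).
Proof.
move=> oV /(C1_onP _ oV) hf /(C1_onP _ oV) hg; apply/(C1_onP _ oV) => v.
have [f1 f2] := hf v; have [g1 g2] := hg v.
split=> x Vx; first by apply: derivableD; auto.
apply: (@continuous_near_eq _ _ (fun y => 'D_v f y + 'D_v g y : R)).
  have : nbhs x V by exact: open_nbhs_nbhs.
  by apply: filterS => y Vy; rewrite -deriveD; auto.
by apply: (@continuousD R R^o); auto.
Qed.

Lemma C1_on_mul n (V : set 'rV[R]_n) (f g : 'rV[R]_n -> R^o) : open V ->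
  C1_on V f -> C1_on V g -> C1_on V (fun x => f x * g x : R^o).
Proof.
move=> oV cf cg; have /(C1_onP _ oV) hf := cf; have /(C1_onP _ oV) hg := cg.
apply/(C1_onP _ oV) => v; have [f1 f2] := hf v; have [g1 g2] := hg v.
have D x : V x -> is_derive x v (fun x => f x * g x : R^o)
    ('D_v f x * g x + f x * 'D_v g x).
  by move=> Vx; apply: is_derive_mul; apply/derivableP; auto.
split=> x Vx; first by have [] := D x Vx.
apply: (@continuous_near_eq _ _ (fun y => 'D_v f y * g y + f y * 'D_v g y : R)).
  have : nbhs x V by exact: open_nbhs_nbhs.
  by apply: filterS => y /D [_ ->].
have c1 := C1_on_continuous cf Vx; have c2 := C1_on_continuous cg Vx.
by apply: (@continuousD R R^o); apply: (@continuousM R); auto.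
Qed.

Lemma C1_on_sum n (V : set 'rV[R]_n) (J : Type) (s : seq J) (F : J -> 'rV[R]_n -> R^o) :
  open V -> (forall i, C1_on V (F i)) -> C1_on V (fun x => \sum_(i <- s) F i x : R^o).
Proof.
move=> oV h; elim: s => [|i s ih].
  by apply: C1_on_ext (C1_on_cst 0 oV) => // x _; rewrite big_nil.
by apply: C1_on_ext (C1_on_add oV (h i) ih) => // x _; rewrite big_cons.
Qed.

Lemma C1_on_prod n (V : set 'rV[R]_n) (J : Type) (s : seq J) (F : J -> 'rV[R]_n -> R^o) :
  open V -> (forall i, C1_on V (F i)) -> C1_on V (fun x => \prod_(i <- s) F i x : R^o).
Proof.
move=> oV h; elim: s => [|i s ih].
  by apply: C1_on_ext (C1_on_cst 1 oV) => // x _; rewrite big_nil.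
by apply: C1_on_ext (C1_on_mul oV (h i) ih) => // x _; rewrite big_cons.
Qed.

Lemma C1_on_ln n (V : set 'rV[R]_n) (f : 'rV[R]_n -> R^o) : open V ->
  (forall x, V x -> 0 < f x :> R) -> C1_on V f -> C1_on V (fun x => ln (f x) : R^o).
Proof.
move=> oV f0 cf; have /(C1_onP _ oV) hf := cf; apply/(C1_onP _ oV) => v.
have dl x : V x -> differentiable (@ln R : R -> R^o) (f x).
  by move=> /f0 h; apply/derivable1_diffP; have [] := is_derive1_ln h.
have D x : V x -> is_derive x v (fun x => ln (f x) : R^o) ((f x)^-1 * 'D_v f x).
  move=> Vx; have df := cf.1 x Vx.
  have := is_derive_diff v (differentiable_comp df (dl x Vx)).
  rewrite diff_comp//; last exact: dl.
  rewrite /comp /= -(deriveE v df) -[X in 'd _ _ X]mulr1.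
  rewrite -[X in 'd _ _ X]/(('D_v f x : R) *: (1 : R)) linearZ /= -deriveE; last exact: dl.
  have [_ ->] := is_derive1_ln (f0 x Vx).
  by rewrite mulrC.
split=> x Vx; first by have [] := D x Vx.
apply: (@continuous_near_eq _ _ (fun y => (f y)^-1 * 'D_v f y : R)).
  have : nbhs x V by exact: open_nbhs_nbhs.
  by apply: filterS => y /D [_ ->].
apply: (@continuousM R); last by have [_] := hf v; auto.
apply: (@continuousV R); last exact: C1_on_continuous cf Vx.
by rewrite gt_eqF// f0.
Qed.

End C1Calculus.

(** * Definable and constructible functions *)

Section FunctionClasses.
Context (R : realType) (M : structure R).

Definition extend0 n (A : set 'rV[R]_n) (g : 'rV[R]_n -> R) (x : 'rV[R]_n) : R :=
  if `[< A x >] then g x else 0.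

Lemma extend0E n (A : set 'rV[R]_n) g x : A x -> extend0 A g x = g x.
Proof. by move=> Ax; rewrite /extend0; case: asboolP. Qed.

Lemma extend0N n (A : set 'rV[R]_n) g x : ~ A x -> extend0 A g x = 0.
Proof. by move=> Ax; rewrite /extend0; case: asboolP. Qed.

Lemma definable_map_dom n m (A : set 'rV[R]_n) (h : 'rV[R]_n -> 'rV[R]_m) :
  definable_map M A h -> dpred M A.
Proof.
move=> hh; apply: (@dpred_ext _ _ _ (fun x => exists y, graph_on A h (row_mx x y))).
  move=> x; split=> [[y []]|Ax]; rewrite /= ?row_mxKl ?row_mxKr//.
  by exists (h x); split; rewrite ?row_mxKl ?row_mxKr.
apply: dpred_exv; have hh' : dpred M (graph_on A h) by exact: hh.
by apply: (dpred_comp hh'); dtac.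
Qed.

Lemma definable_map_dmap n m (A : set 'rV[R]_n) (h : 'rV[R]_n -> 'rV[R]_m) :
  definable_map M A h ->
  dmap M (fun x => \row_j extend0 A (fun x => h x 0 j) x).
Proof.
move=> hh; have hA := definable_map_dom hh; apply: dmap_row => j.
have hh' : dpred M (graph_on A h) by exact: hh.
have hE : dpred M (fun z : 'rV[R]_(n + 1) => exists y : 'rV[R]_m,
    graph_on A h (row_mx (lsubmx z) y) /\ y 0 j = rsubmx z 0 0).
  apply: (@dpred_exv _ _ _ _ (fun z y => graph_on A h (row_mx (lsubmx z) y) /\
    y 0 j = rsubmx z 0 0)).
  by apply: dpred_and; [apply: (dpred_comp hh'); dtac|dtac].
apply: (@dpred_ext _ _ _ (fun z : 'rV[R]_(n + 1) =>
  (exists y : 'rV[R]_m, graph_on A h (row_mx (lsubmx z) y) /\ y 0 j = rsubmx z 0 0) \/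
  (~ A (lsubmx z) /\ 0 = rsubmx z 0 0))).
  move=> z; rewrite /extend0; case: asboolP => Az; split.
  - move=> [[y [[]]]|[]//]; rewrite row_mxKl row_mxKr => _ -> //.
  - move=> e; left; exists (h (lsubmx z)); split => //.
    by split; rewrite ?row_mxKl ?row_mxKr.
  - by move=> [[y [[]]]|[]//]; rewrite row_mxKl.
  - by move=> e; right.
apply: dpred_or => //; apply: dpred_and; last by dtac.
by apply: dpred_not; apply: (dpred_comp hA); dtac.
Qed.

(** [definable_fun] only constrains the values on [A]; extension by zero gives the total function to
    which the closure rules of [dfun] apply. *)
Lemma definable_funP n (A : set 'rV[R]_n) (g : 'rV[R]_n -> R) :
  definable_fun M A g <-> dpred M A /\ dfun M (extend0 A g).
Proof.
split=> [hg|[hA hg]].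
  split; first exact: definable_map_dom hg.
  have := definable_map_dmap hg 0; apply: dfun_ext => x.
  by rewrite mxE /extend0 mxE.
apply: (@dpred_ext _ _ _ (fun z : 'rV[R]_(n + 1) =>
  A (lsubmx z) /\ extend0 A g (lsubmx z) = rsubmx z 0 0)).
  move=> z; split=> [[Az E]|[Az E]]; split => //.
    by apply/rowP => i; rewrite !mxE (ord1 i) -[RHS](extend0E g Az) E mxE.
  by rewrite extend0E// E mxE.
apply: dpred_and; last by exact: hg.
by apply: (dpred_comp hA); dtac.
Qed.

(** Composition carries coefficients through chart representatives of maps; extension by zero allows
    gluing over overlapping charts; the last clause gives a definable open set, dense in [A], on
    which a coefficient is C^1. *)
Record tame_class (F : funclass R) : Prop := TameClass {
  tame_class_ext : forall n (A : set 'rV[R]_n) f g,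
    (forall x, A x -> f x = g x) -> F n A f -> F n A g;
  tame_class_definable : forall n (A : set 'rV[R]_n) f, definable_fun M A f -> F n A f;
  tame_class_add : forall n (A : set 'rV[R]_n) f g,
    F n A f -> F n A g -> F n A (fun x => f x + g x);
  tame_class_mul : forall n (A : set 'rV[R]_n) f g,
    F n A f -> F n A g -> F n A (fun x => f x * g x);
  tame_class_comp : forall m n (A : set 'rV[R]_n) (V : set 'rV[R]_m)
    (h : 'rV[R]_m -> 'rV[R]_n) f,
    F n A f -> definable_map M V h -> (forall x, V x -> A (h x)) ->
    F m V (fun x => f (h x));
  tame_class_extend0 : forall n (A V : set 'rV[R]_n) f,
    dpred M A -> dpred M V -> V `<=` A -> F n V f -> F n A (extend0 V f);
  tame_class_C1 : forall n (A : set 'rV[R]_n) f, open A -> dpred M A -> F n A f ->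
    exists V : set 'rV[R]_n, [/\ open V, V `<=` A, dpred M V,
      (forall O : set 'rV[R]_n, open O -> O !=set0 -> O `<=` A -> V `&` O !=set0) &
      C1_on V (f : _ -> R^o)]
}.

Lemma definable_fun_ext n (A : set 'rV[R]_n) f g :
  (forall x, A x -> f x = g x) -> definable_fun M A f -> definable_fun M A g.
Proof.
move=> fg /definable_funP[hA hf]; apply/definable_funP; split => //.
apply: dfun_ext hf => x; rewrite /extend0; case: asboolP => // Ax; exact: fg.
Qed.

Lemma definable_fun_op n (A : set 'rV[R]_n) (o : R -> R -> R) f g :
  (forall t u : 'rV[R]_n -> R, dfun M t -> dfun M u -> dfun M (fun x => o (t x) (u x))) ->
  definable_fun M A f -> definable_fun M A g ->
  definable_fun M A (fun x => o (f x) (g x)).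
Proof.
move=> ho /definable_funP[hA hf] /definable_funP[_ hg]; apply/definable_funP.
split => //; have := dfun_if hA (ho _ _ hf hg) (dfun_cst M n 0).
apply: dfun_ext => x; rewrite {3}/extend0; case: asboolP => // Ax.
by rewrite !extend0E.
Qed.

Lemma definable_fun_comp m n (A : set 'rV[R]_n) (V : set 'rV[R]_m)
    (h : 'rV[R]_m -> 'rV[R]_n) f :
  definable_fun M A f -> definable_map M V h -> (forall x, V x -> A (h x)) ->
  definable_fun M V (fun x => f (h x)).
Proof.
move=> /definable_funP[hA hf] hh VA; apply/definable_funP.
have hV := definable_map_dom hh; split => //.
have := dfun_if hV (dfun_comp hf (definable_map_dmap hh)) (dfun_cst M m 0).
apply: dfun_ext => x; rewrite {3}/extend0; case: asboolP => // Vx.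
rewrite (_ : \row_j _ = h x); first by rewrite extend0E//; exact: VA.
by apply/rowP => j; rewrite mxE extend0E.
Qed.

Lemma definable_fun_extend n (A V : set 'rV[R]_n) f (a : R) :
  dpred M A -> dpred M V -> definable_fun M V f ->
  definable_fun M A (fun x => if `[< V x >] then f x else a).
Proof.
move=> hA hV /definable_funP[_ hf]; apply/definable_funP; split => //.
have := dfun_if hA (dfun_if hV hf (dfun_cst M n a)) (dfun_cst M n 0).
apply: dfun_ext => x; rewrite [RHS]/extend0; case: asboolP => // Ax.
by case: asboolP => // Vx; rewrite extend0E.
Qed.

Lemma definable_fun_cst n (A : set 'rV[R]_n) (a : R) : dpred M A ->
  definable_fun M A (fun=> a).
Proof.
move=> hA; apply/definable_funP; split => //.
by apply: dfun_if => //; exact: dfun_cst.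
Qed.

Context (hM : o_minimal M).

Definition C1_set n (A : set 'rV[R]_n) (f : 'rV[R]_n -> R) : set 'rV[R]_n :=
  [set x | A x /\ C1_at (extend0 A f) x].

Lemma open_C1_set n (A : set 'rV[R]_n) f : open A -> open (C1_set A f).
Proof. by move=> oA; apply: openI => //; exact: open_C1_at. Qed.

Lemma C1_set_C1_on n (A : set 'rV[R]_n) f : open A -> C1_on (C1_set A f) (f : _ -> R^o).
Proof.
move=> oA; have oC := @open_C1_set n A f oA.
apply: (@C1_on_ext _ _ _ (extend0 A f : _ -> R^o)) => //.
  by move=> x [Ax _]; exact: extend0E.
by apply: C1_at_C1_on => // x [].
Qed.

Lemma dpred_C1_set n (A : set 'rV[R]_n) f : definable_fun M A f ->
  dpred M (C1_set A f).
Proof.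
by move=> /definable_funP[hA hf]; apply: dpred_and => //; exact: dpred_C1_at.
Qed.

Lemma generic_C1_set n (A : set 'rV[R]_n) f : definable_fun M A f ->
  generic [set x | A x -> C1_set A f x].
Proof.
move=> /definable_funP[hA hf]; apply: generic_sub (generic_C1_at hM hf) => x hx Ax.
by split.
Qed.

Lemma definable_tame_class : tame_class (@definable_fun R M).
Proof.
split.
- exact: definable_fun_ext.
- by [].
- by move=> n A f g; apply: definable_fun_op => t u; exact: dfun_add.
- by move=> n A f g; apply: definable_fun_op => t u; exact: dfun_mul.
- exact: definable_fun_comp.
- by move=> n A V f hA hV VA hf; exact: definable_fun_extend.
move=> n A f oA hA hf; exists (C1_set A f); split.
- exact: open_C1_set.
- by move=> x [].
- exact: dpred_C1_set.
- move=> O oO O0 OA; have [x [Ox hx]] := generic_nonempty (generic_C1_set hf) oO O0.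
  by exists x; split => //; apply: hx; exact: OA.
- exact: C1_set_C1_on.
Qed.

End FunctionClasses.

Section Constructible.
Context (R : realType).
Let M := R_an R.

(** With an arbitrary finite index type, a sum is indexed by the disjoint union and a product by the
    cartesian product of the two index sets. *)
Lemma constructible_fin n (A : set 'rV[R]_n) (F : 'rV[R]_n -> R) (T : finType)
    (L : T -> nat) (f : T -> 'rV[R]_n -> R) (g : forall i : T, 'I_(L i) -> 'rV[R]_n -> R) :
  (forall i, definable_fun M A (f i)) ->
  (forall i j, definable_fun M A (g i j)) ->
  (forall i j x, A x -> 0 < g i j x) ->
  (forall x, A x -> F x = \sum_i f i x * \prod_j ln (g i j x)) ->
  constructible A F.
Proof.
move=> hf hg g0 hF; exists #|T|, (fun i => L (enum_val i)),
  (fun i => f (enum_val i)), (fun i => @g (enum_val i)); split => //.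
  by move=> i j x; exact: g0.
move=> x Ax; rewrite hF// (reindex (@enum_val T T))//=.
exact: onW_bij (enum_val_bij T).
Qed.

Lemma constructible_add n (A : set 'rV[R]_n) F G :
  constructible A F -> constructible A G -> constructible A (fun x => F x + G x).
Proof.
move=> [N1 [L1 [f1 [g1 [a1 b1 c1 d1]]]]] [N2 [L2 [f2 [g2 [a2 b2 c2 d2]]]]].
pose L (i : 'I_N1 + 'I_N2) := match i with inl i => L1 i | inr i => L2 i end.
pose f (i : 'I_N1 + 'I_N2) := match i with inl i => f1 i | inr i => f2 i end.
pose g (i : 'I_N1 + 'I_N2) : 'I_(L i) -> 'rV[R]_n -> R :=
  match i with inl i => @g1 i | inr i => @g2 i end.
apply: (@constructible_fin _ _ _ _ L f g).
- by case.
- by case.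
- by case.
- by move=> x Ax; rewrite big_sumType /= d1// d2.
Qed.

Lemma constructible_mul n (A : set 'rV[R]_n) F G :
  constructible A F -> constructible A G -> constructible A (fun x => F x * G x).
Proof.
move=> [N1 [L1 [f1 [g1 [a1 b1 c1 d1]]]]] [N2 [L2 [f2 [g2 [a2 b2 c2 d2]]]]].
pose L (i : 'I_N1 * 'I_N2) := (L1 i.1 + L2 i.2)%N.
pose f (i : 'I_N1 * 'I_N2) x := f1 i.1 x * f2 i.2 x.
pose g (i : 'I_N1 * 'I_N2) (j : 'I_(L i)) : 'rV[R]_n -> R :=
  match fintype.split j with inl j => @g1 i.1 j | inr j => @g2 i.2 j end.
apply: (@constructible_fin _ _ _ _ L f g).
- move=> i; apply: definable_fun_op => //; exact: dfun_mul.
- by move=> i j; rewrite /g; case: fintype.split.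
- by move=> i j; rewrite /g; case: fintype.split => k x; [exact: c1|exact: c2].
move=> x Ax; rewrite d1// d2// mulr_suml.
rewrite (eq_bigr (fun i => \sum_(j < N2) (f1 i x * \prod_l ln (g1 i l x)) *
   (f2 j x * \prod_l ln (g2 j l x)))); last by move=> i _; rewrite mulr_sumr.
rewrite pair_big; apply: eq_bigr => -[i j] _ /=; rewrite mulrACA /f /=; congr (_ * _).
rewrite big_split_ord /=; congr (_ * _); apply: eq_bigr => l _.
  by rewrite /g (unsplitK (inl l)).
by rewrite /g (unsplitK (inr l)).
Qed.

Context (hM : o_minimal M).

Lemma constructible_tame_class : tame_class M (@constructible R).
Proof.
split.
- move=> n A f g fg [N [L [f1 [g1 [a1 b1 c1 d1]]]]].
  by exists N, L, f1, g1; split => // x Ax; rewrite -fg// d1.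
- move=> n A f hf; apply: (@constructible_fin _ _ _ unit (fun=> 0%N) (fun=> f)
    (fun _ _ _ => 1)) => //.
    by move=> _ [].
  by move=> x Ax; rewrite big_const /= card_unit /= big_ord0 mulr1 addr0.
- exact: constructible_add.
- exact: constructible_mul.
- move=> m n A V h f [N [L [f1 [g1 [a1 b1 c1 d1]]]]] hh VA.
  exists N, L, (fun i x => f1 i (h x)), (fun i j x => g1 i j (h x)); split.
  + by move=> i; exact: definable_fun_comp (a1 i) hh VA.
  + by move=> i j; exact: definable_fun_comp (b1 i j) hh VA.
  + by move=> i j x /VA; exact: c1.
  + by move=> x /VA; exact: d1.
- move=> n A V f hA hV VA [N [L [f1 [g1 [a1 b1 c1 d1]]]]].
  (* The outer factors are extended by zero, but the arguments of the logarithms by one, to stay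
     positive on [A]. *)
  exists N, L, (fun i => extend0 V (f1 i)),
    (fun i j x => if `[< V x >] then g1 i j x else 1); split.
  + by move=> i; exact: definable_fun_extend.
  + by move=> i j; exact: definable_fun_extend.
  + by move=> i j x Ax; case: asboolP => // Vx; exact: c1.
  + move=> x Ax; rewrite /extend0; case: asboolP => Vx; first exact: d1.
    by rewrite big1// => i _; rewrite mul0r.
move=> n A f oA hA [N [L [f1 [g1 [a1 b1 c1 d1]]]]].
pose V : set 'rV[R]_n := [set x | [/\ A x, forall i, C1_set A (f1 i) x &
   forall i j, C1_set A (g1 i j) x]].
have oV : open V.
  rewrite openE => x [Ax hx1 hx2].
  have n0 : nbhs x A by exact: open_nbhs_nbhs.
  have n1 : nbhs x [set y | forall i, C1_set A (f1 i) y].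
    apply: (@filter_forall _ _ (fun i => C1_set A (f1 i)) (nbhs x)) => i.
    by apply: open_nbhs_nbhs; split => //; exact: open_C1_set.
  have n2 : nbhs x [set y | forall i j, C1_set A (g1 i j) y].
    apply: (@filter_forall _ _ (fun i y => forall j, C1_set A (g1 i j) y) (nbhs x)) => i.
    apply: (@filter_forall _ _ (fun j => C1_set A (g1 i j)) (nbhs x)) => j.
    by apply: open_nbhs_nbhs; split => //; exact: open_C1_set.
  by apply: filterS (filterI n0 (filterI n1 n2)) => y [? [? ?]].
have C1f i : C1_on V (f1 i : _ -> R^o).
  apply: (C1_on_sub oV (open_C1_set (f := f1 i) oA)); last exact: C1_set_C1_on.
  by move=> x [].
have C1g i j : C1_on V (g1 i j : _ -> R^o).
  apply: (C1_on_sub oV (open_C1_set (f := g1 i j) oA)); last exact: C1_set_C1_on.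
  by move=> x [].
exists V; split => //.
- by move=> x [].
- apply: (@dpred_ext _ _ _ (fun x => A x /\ (forall i, C1_set A (f1 i) x) /\
    forall i j, C1_set A (g1 i j) x)).
    by move=> x; split=> [[? [? ?]]|[]].
  apply: dpred_and => //; apply: dpred_and; apply: dpred_all_fin => i.
    exact: dpred_C1_set.
  by apply: dpred_all_fin => j; exact: dpred_C1_set.
- move=> O oO O0 OA.
  have gf : generic [set x | forall i, A x -> C1_set A (f1 i) x].
    by apply: generic_all_fin => i; exact: (generic_C1_set hM (a1 i)).
  have gg : generic [set x | forall i j, A x -> C1_set A (g1 i j) x].
    apply: generic_all_fin => i; apply: generic_all_fin => j.
    exact: (generic_C1_set hM (b1 i j)).
  have [x [Ox [hx1 hx2]]] := generic_nonempty (generic_and gf gg) oO O0.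
  have Ax := OA x Ox.
  by exists x; split => //; split => // [i|i j]; [exact: hx1|exact: hx2].
apply: (@C1_on_ext _ _ _ (fun x => \sum_i f1 i x * \prod_j ln (g1 i j x))) => //.
  by move=> x [Ax _ _]; rewrite d1.
have cl i j : C1_on V (fun x => ln (g1 i j x) : R^o).
  by apply: (C1_on_ln oV _ (C1g i j)) => x [Ax _ _]; exact: c1.
have cP i : C1_on V (fun x => \prod_j ln (g1 i j x) : R^o).
  exact: (C1_on_prod (index_enum _) oV (cl i)).
exact: (C1_on_sum (index_enum _) oV (fun i => C1_on_mul oV (C1f i) (cP i))).
Qed.

End Constructible.

(** * Composition, coefficients of forms and C^2 maps *)

Section SmoothMaps.
Context (R : realType) (m n : nat) (h : 'rV[R]_m -> 'rV[R]_n).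

Definition comp_fun (j : 'I_n) (u : 'rV[R]_m) : R^o := h u 0 j.

Lemma differentiable_of_comp u :
  (forall j, differentiable (comp_fun j) u) -> differentiable h u.
Proof.
move=> hj; rewrite (_ : h = \sum_(j < n) (fun u => comp_fun j u *: evec R j)).
  by apply: differentiable_sum => j; exact: differentiableZl.
apply/funext => v; rewrite fct_sumE [LHS]row_evec; apply: eq_bigr => j _.
by [].
Qed.

Lemma differentiable_comp_fun u j :
  differentiable h u -> differentiable (comp_fun j) u.
Proof.
move=> dh; apply: (@differentiable_comp _ _ _ _ h (fun x : 'rV[R]_n => x 0 j : R^o)) => //.
exact: differentiable_coord.
Qed.

Lemma diff_comp_fun u v j : differentiable h u ->
  'd (comp_fun j) u v = ('d h u v) 0 j :> R.
Proof.
move=> dh; rewrite -deriveE; last exact: differentiable_comp_fun.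
rewrite -deriveE// derive_mx ?mxE//; exact: diff_derivable.
Qed.

Lemma jacobianE u i j : differentiable h u ->
  jacobian h u i j = 'D_(evec R i) (comp_fun j) u.
Proof.
move=> dh; rewrite deriveE ?diff_comp_fun//; last exact: differentiable_comp_fun.
by rewrite /jacobian -(mul_rV_lin1 ('d h u)) /evec -rowE [RHS]mxE.
Qed.

Lemma derive_linear (f : 'rV[R]_m -> R^o) (u v : 'rV[R]_m) : differentiable f u ->
  'D_v f u = \sum_l v 0 l * 'D_(evec R l) f u :> R.
Proof.
move=> df; rewrite deriveE// [in LHS](row_evec v) linear_sum; apply: eq_bigr => l _.
by rewrite linearZ /= -deriveE.
Qed.

Lemma C1_on_comp (c : 'rV[R]_n -> R^o) (V : set 'rV[R]_m) (O : set 'rV[R]_n) :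
  open V -> open O -> (forall u, V u -> O (h u)) ->
  (forall j, C1_on V (comp_fun j)) -> C1_on O c ->
  C1_on V (fun u => c (h u) : R^o).
Proof.
move=> oV oO VO hj [c1 c2].
have dh u : V u -> differentiable h u.
  by move=> Vu; apply: differentiable_of_comp => j; have [+ _] := hj j; apply.
have ch u : V u -> {for u, continuous h}.
  by move=> /dh /differentiable_continuous.
have D u v : V u -> 'd (fun u => c (h u) : R^o) u v =
    \sum_j 'd (comp_fun j) u v * 'd c (h u) (evec R j) :> R.
  move=> Vu; have := diff_comp (dh u Vu) (c1 _ (VO u Vu)) => /(congr1 (fun f => f v)) /= E.
  rewrite /comp in E; rewrite E [X in 'd c (h u) X](row_evec ('d h u v)) linear_sum.
  by apply: eq_bigr => j _; rewrite linearZ /= diff_comp_fun//; exact: dh.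
split=> [u Vu|v].
  by apply: (@differentiable_comp _ _ _ _ h c); [exact: dh|apply: c1; exact: VO].
apply/(open_continuous_within _ oV) => u Vu.
apply: (@continuous_near_eq _ _
    (fun u => \sum_j 'd (comp_fun j) u v * 'd c (h u) (evec R j) : R)).
  have : nbhs u V by exact: open_nbhs_nbhs.
  by apply: filterS => y Vy; rewrite D.
apply: continuous_sumr => j; apply: (@continuousM R).
  by have [_ /(_ v) /(open_continuous_within _ oV) /(_ u Vu)] := hj j.
apply: (@continuous_comp _ _ _ h (fun y => 'd c y (evec R j) : R)); first exact: ch.
by have /(open_continuous_within _ oO) /(_ _ (VO u Vu)) := c2 (evec R j).
Qed.

Lemma C1_on_translate (V : set 'rV[R]_m) (v : 'rV[R]_n) j : open V ->
  C1_on V (comp_fun j) -> C1_on V (fun u => (h u + v) 0 j : R^o).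
Proof.
move=> oV hj; apply: (C1_on_ext oV _ (C1_on_add oV hj (C1_on_cst (v 0 j) oV))) => u _.
by rewrite mxE.
Qed.

End SmoothMaps.

Section AltCalculus.
Context (R : realType).

Lemma continuous_prodr (T : topologicalType) (J : Type) (s : seq J)
    (F : J -> T -> R) (x : T) :
  (forall i, {for x, continuous (F i)}) ->
  {for x, continuous (fun y => \prod_(i <- s) F i y)}.
Proof.
move=> hF; elim: s => [|i s ih].
  rewrite (_ : (fun _ => _) = cst 1); first exact: cst_continuous.
  by apply/funext => y; rewrite big_nil.
rewrite (_ : (fun _ => _) = (F i \* (fun y => \prod_(i <- s) F i y))).
  by apply: (@continuousM R) => //; exact: hF.
by apply/funext => y; rewrite big_cons.
Qed.

(** The expansion makes [b y (B y)] a polynomial in the coefficients of [b y] and the entries of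
    [B y]. *)
Lemma continuous_alt (T : topologicalType) n k (b : T -> alt R n k)
    (B : T -> 'M[R]_(k, n)) (x : T) :
  (forall K, {for x, continuous (fun y => b y (rowsub K 1%:M))}) ->
  (forall i j, {for x, continuous (fun y => B y i j)}) ->
  {for x, continuous (fun y => b y (B y))}.
Proof.
move=> hb hB.
rewrite (_ : (fun y => b y (B y)) = (fun y => \sum_(K : {ffun 'I_k -> 'I_n})
  (\prod_i B y i (K i)) * b y (rowsub K 1%:M))).
  apply: continuous_sumr => K; apply: (@continuousM R) => //.
  by apply: continuous_prodr.
by apply/funext => y; rewrite alt_expand.
Qed.

Lemma C1_on_alt m n k (V : set 'rV[R]_m) (b : 'rV[R]_m -> alt R n k)
    (B : 'rV[R]_m -> 'M[R]_(k, n)) : open V ->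
  (forall K, C1_on V (fun y => b y (rowsub K 1%:M) : R^o)) ->
  (forall i j, C1_on V (fun y => B y i j : R^o)) ->
  C1_on V (fun y => b y (B y) : R^o).
Proof.
move=> oV hb hB.
apply: (@C1_on_ext _ _ _ (fun y => \sum_(K : {ffun 'I_k -> 'I_n})
  (\prod_i B y i (K i)) * b y (rowsub K 1%:M) : R^o)) => //.
  by move=> y _; rewrite alt_expand.
apply: C1_on_sum => // K; apply: (C1_on_mul oV _ (hb K)).
exact: (C1_on_prod (index_enum _) oV (fun i => hB i (K i))).
Qed.

(** Regularity of forms is imposed on increasing multi-indices. Any other coefficient is zero or a
    multiple of one of these, with a factor that does not depend on the form. *)
Lemma continuous_coefs (T : topologicalType) n k (b : T -> alt R n k) (x : T) :
  (forall I, increasing I -> {for x, continuous (fun y => b y (rowsub I 1%:M))}) ->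
  forall K, {for x, continuous (fun y => b y (rowsub K 1%:M))}.
Proof.
move=> hb K; have [E|[I [c [incI E]]]] := @alt_rowsub_sort R k n K.
  rewrite (_ : (fun _ => _) = cst 0); first exact: cst_continuous.
  by apply/funext => y; rewrite E.
rewrite (_ : (fun _ => _) = (cst c \* (fun y => b y (rowsub I 1%:M)))).
  by apply: (@continuousM R); [exact: cst_continuous|exact: hb].
by apply/funext => y; rewrite E.
Qed.

Lemma C1_on_coefs m n k (V : set 'rV[R]_m) (b : 'rV[R]_m -> alt R n k) : open V ->
  (forall I, increasing I -> C1_on V (fun y => b y (rowsub I 1%:M) : R^o)) ->
  forall K, C1_on V (fun y => b y (rowsub K 1%:M) : R^o).
Proof.
move=> oV hb K; have [E|[I [c [incI E]]]] := @alt_rowsub_sort R k n K.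
  by apply: (C1_on_ext oV _ (C1_on_cst 0 oV)) => y _; rewrite E.
by apply: (C1_on_ext oV _ (C1_on_mul oV (C1_on_cst c oV) (hb I incI))) => y _; rewrite E.
Qed.

Lemma continuous_mulmx_entry (T : topologicalType) k m n (C : T -> 'M[R]_(k, m))
    (J : T -> 'M[R]_(m, n)) x :
  (forall i j, {for x, continuous (fun y => C y i j)}) ->
  (forall i j, {for x, continuous (fun y => J y i j)}) ->
  forall i j, {for x, continuous (fun y => (C y *m J y) i j)}.
Proof.
move=> hC hJ i j.
rewrite (_ : (fun _ => _) = (fun y => \sum_l C y i l * J y l j)).
  by apply: continuous_sumr => l; apply: (@continuousM R).
by apply/funext => y; rewrite mxE.
Qed.

Lemma C1_on_mulmx_entry k m n p (V : set 'rV[R]_p) (C : 'M[R]_(k, m))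
    (J : 'rV[R]_p -> 'M[R]_(m, n)) : open V ->
  (forall i j, C1_on V (fun y => J y i j : R^o)) ->
  forall i j, C1_on V (fun y => (C *m J y) i j : R^o).
Proof.
move=> oV hJ i j.
apply: (C1_on_ext oV _ (C1_on_sum (index_enum _) oV
  (fun l => C1_on_mul oV (C1_on_cst (C i l) oV) (hJ l j)))) => y _.
by rewrite mxE.
Qed.

End AltCalculus.

Lemma symmetric_form_sum (R : realType) m (D : 'I_m -> 'I_m -> R) (v w : 'rV[R]_m) :
  (forall i l, D i l = D l i) ->
  \sum_i \sum_l w 0 i * (v 0 l * D l i) = \sum_i \sum_l v 0 i * (w 0 l * D l i).
Proof.
move=> hD; rewrite exchange_big; apply: eq_bigr => i _; apply: eq_bigr => l _.
by rewrite mulrCA hD.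
Qed.

Section SecondDerivatives.
Context (R : realType) (M : structure R) (m n : nat) (h : 'rV[R]_m -> 'rV[R]_n).

(** Phrased with the total functions [pd], whose definability lets the generic C^1 theorem be
    applied a second time. On an open set of such points they are the entries of the Jacobian. *)
Definition C2_at (u : 'rV[R]_m) : Prop := forall j,
  C1_at (comp_fun h j) u /\ forall i, C1_at (pd (comp_fun h j) i) u.

Lemma generic_C2_at : o_minimal M -> dmap M h -> generic [set u | C2_at u].
Proof.
move=> hM dh; apply: generic_all_fin => j; apply: generic_and.
  by apply: (generic_C1_at hM); exact: dh.
by apply: generic_all_fin => i; apply: (generic_C1_at hM); apply: dfun_pd; exact: dh.
Qed.

Context (V : set 'rV[R]_m).
Context (oV : open V) (hV : forall u, V u -> C2_at u).

Lemma C2_comp_C1 j : C1_on V (comp_fun h j).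
Proof. by apply: C1_at_C1_on => // u /hV /(_ j)[]. Qed.

Lemma C2_differentiable u : V u -> differentiable h u.
Proof.
by move=> Vu; apply: differentiable_of_comp => j; have [+ _] := C2_comp_C1 j; apply.
Qed.

Lemma C2_jacobian u i j : V u -> pd (comp_fun h j) i u = jacobian h u i j.
Proof.
move=> Vu; have dh := C2_differentiable Vu; rewrite jacobianE// pdE//.
by apply: diff_derivable; exact: differentiable_comp_fun.
Qed.

Lemma C2_jacobian_C1 i j : C1_on V (fun u => jacobian h u i j : R^o).
Proof.
apply: (@C1_on_ext _ _ _ (pd (comp_fun h j) i : _ -> R^o)) => //.
  by move=> u Vu; exact: C2_jacobian.
by apply: C1_at_C1_on => // u /hV /(_ j)[_ /(_ i)].
Qed.

(** Both sides are bilinear in [v] and [w], and on basis vectors the identity is Clairaut's theorem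
    for each coordinate of [h]. *)
Lemma C2_hessian_sym u (v w : 'rV[R]_m) : V u ->
  w *m (\matrix_(i, j) 'D_v (fun u => jacobian h u i j : R^o) u) =
  v *m (\matrix_(i, j) 'D_w (fun u => jacobian h u i j : R^o) u).
Proof.
move=> Vu; have dJ i j : differentiable (fun u => jacobian h u i j : R^o) u.
  by have [+ _] := C2_jacobian_C1 i j; apply.
apply/rowP => j; rewrite [LHS]mxE [RHS]mxE.
pose D l i := 'D_(evec R l) (fun u => jacobian h u i j : R^o) u.
have DE (a b : 'rV[R]_m) : \sum_i b 0 i *
    (\matrix_(i, j) 'D_a (fun u => jacobian h u i j : R^o) u) i j =
    \sum_i \sum_l b 0 i * (a 0 l * D l i).
  by apply: eq_bigr => i _; rewrite mxE derive_linear// mulr_sumr.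
have jE y i : V y -> {near y, (fun u => jacobian h u i j : R^o) =1
    (fun z => 'D_(evec R i) (comp_fun h j) z)}.
  move=> Vy; have : nbhs y V by exact: open_nbhs_nbhs.
  by apply: filterS => z Vz; rewrite jacobianE//; exact: C2_differentiable.
have DE2 y l i : V y -> 'D_(evec R l) (fun u => jacobian h u i j : R^o) y =
    'D_(evec R l) (fun z => 'D_(evec R i) (comp_fun h j) z) y.
  by move=> Vy; apply: near_eq_derive; exact: jE.
apply: etrans (DE v w) _; apply: etrans _ (esym (DE w v)).
apply: symmetric_form_sum => i l.
apply/esym; rewrite /D (DE2 u l i Vu) (DE2 u i l Vu); apply: (clairaut oV Vu).
- move=> y Vy; have dy : differentiable (comp_fun h j) y.
    by have [+ _] := C2_comp_C1 j; apply.
  by split; exact: diff_derivable.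
- move=> y Vy; apply: near_eq_derivable (jE y i Vy) _.
  by apply: diff_derivable; have [+ _] := C2_jacobian_C1 i j; apply.
- move=> y Vy; apply: near_eq_derivable (jE y l Vy) _.
  by apply: diff_derivable; have [+ _] := C2_jacobian_C1 l j; apply.
- have /(C1_onP _ oV) /(_ (evec R l)) [_ /(_ u Vu)] := C2_jacobian_C1 i j.
  apply: continuous_near_eq; have : nbhs u V by exact: open_nbhs_nbhs.
  by apply: filterS => y Vy; exact: DE2.
- have /(C1_onP _ oV) /(_ (evec R i)) [_ /(_ u Vu)] := C2_jacobian_C1 l j.
  apply: continuous_near_eq; have : nbhs u V by exact: open_nbhs_nbhs.
  by apply: filterS => y Vy; exact: DE2.
Qed.

End SecondDerivatives.

(** * Pullbacks in Euclidean space *)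

Section LocalPullback.
Context (R : realType) (M : structure R) (hM : o_minimal M).

(** Putting the signs into the functions writes the exterior derivative as a divergence along the
    rows of [A], the shape required by [divergence_limit]. *)
Lemma ext_deriv_signed k m (b : 'rV[R]_m -> alt R m k) (V : set 'rV[R]_m)
    (A : 'M[R]_(k.+1, m)) : open V ->
  (forall K, C1_on V (fun y => b y (rowsub K 1%:M) : R^o)) ->
  let a (r : 'I_k.+1) u : R^o := (-1) ^+ r * b u (row' r A) in
  (forall r, C1_dir (a r) (row r A) V) /\
  forall u, V u -> \sum_r 'D_(row r A) (a r) u = ext_deriv b u A :> R.
Proof.
move=> oV hb a; have cb r : C1_on V (fun u => b u (row' r A) : R^o).
  by apply: (C1_on_alt oV hb) => i j; exact: C1_on_cst.
split=> [r|u Vu].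
  have /(C1_onP _ oV) := C1_on_mul oV (C1_on_cst ((-1) ^+ r) oV) (cb r).
  exact.
rewrite /ext_deriv; apply: eq_bigr => r _.
have db : derivable (fun u => b u (row' r A) : R^o) u (row r A).
  by apply: diff_derivable; have [+ _] := cb r; apply.
have [_ ->] := is_derive_mul (is_derive_cst ((-1) ^+ r : R^o) u (row r A)) (derivableP db).
by rewrite mul0r add0r.
Qed.

Lemma continuous_addf (T : topologicalType) (U : normedModType R) (f g : T -> U) x :
  {for x, continuous f} -> {for x, continuous g} ->
  {for x, continuous (fun y => f y + g y)}.
Proof. by move=> cf cg; exact: continuousD. Qed.

(** Joint continuity in [u] and [v] at [v = 0], made uniform in [u] by compactness; the values at
    [v] and at 0 are both compared with the value at the centre, whence [e / 2]. *)
Lemma small_translation k m n (h : 'rV[R]_m -> 'rV[R]_n) (J : 'rV[R]_m -> 'M[R]_(m, n))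
    (b : 'rV[R]_n -> alt R n k) (C : 'M[R]_(k, m)) (x : 'rV[R]_m) (r e : R) :
  (forall u, `|x - u| <= r -> {for u, continuous h}) ->
  (forall u, `|x - u| <= r -> forall i j, {for u, continuous (fun u => J u i j)}) ->
  (forall u, `|x - u| <= r -> forall K,
     {for h u, continuous (fun y => b y (rowsub K 1%:M))}) ->
  0 < e -> exists d : R, 0 < d /\ forall v, ball 0 d v -> forall u, `|x - u| <= r ->
    `|b (h u + v) (C *m J u) - b (h u) (C *m J u)| <= e.
Proof.
move=> ch cJ cb e0.
have e20 : 0 < e / 2 by rewrite divr_gt0.
have [u xu|d [d0 hd]] := @near_const_ball R m x r
  (fun s u => forall v, ball 0 s v -> `|b (h u + v) (C *m J u) - b (h u) (C *m J u)| <= e).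
  pose Phi (z : 'rV[R]_(m + n)) : R := b (h (lsubmx z) + rsubmx z) (C *m J (lsubmx z)).
  pose z0 : 'rV[R]_(m + n) := row_mx u 0.
  have cl : {for z0, continuous (fun z : 'rV[R]_(m + n) => h (lsubmx z))}.
    apply: (@continuous_comp _ _ _ (@lsubmx R 1 m n) h); first exact: continuous_lsubmx.
    by rewrite row_mxKl; exact: ch.
  have cs : {for z0, continuous (fun z : 'rV[R]_(m + n) => h (lsubmx z) + rsubmx z)}.
    exact: continuous_addf cl (@continuous_rsubmx R m n z0).
  have cP : {for z0, continuous Phi}.
    apply: continuous_alt => [K|].
      apply: (@continuous_comp _ _ _ (fun z : 'rV[R]_(m + n) => h (lsubmx z) + rsubmx z)
        (fun y => b y (rowsub K 1%:M))) => //.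
      by rewrite row_mxKl row_mxKr addr0; exact: cb.
    apply: continuous_mulmx_entry => i j; first exact: cst_continuous.
    apply: (@continuous_comp _ _ _ (@lsubmx R 1 m n) (fun u => J u i j)).
      exact: continuous_lsubmx.
    by rewrite row_mxKl; exact: cJ.
  have [d [d0 hd]] := (continuous_atP _ _).1 cP _ e20.
  exists d; split => // u' s uu' s0 sd v sv.
  have b0 : ball (0 : 'rV[R]_n) d 0 by exact: ballxx.
  have bv : ball (0 : 'rV[R]_n) d v by apply: le_ball sv; exact: ltW.
  have := hd (row_mx u' v) ((ball_row_mx _ _ _ _ _).2 (conj uu' bv)).
  have := hd (row_mx u' 0) ((ball_row_mx _ _ _ _ _).2 (conj uu' b0)).
  rewrite /Phi !row_mxKl !row_mxKr !addr0.
  move: (b (h u) _) (b (h u' + v) _) (b (h u') _) => p q t.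
  rewrite !ltr_distl => /andP[? ?] /andP[? ?].
  by rewrite ler_distl; apply/andP; split; lra.
exists (d / 2); split; first by rewrite divr_gt0.
by move=> v dv u xu; apply: (hd (d / 2)) => //; lra.
Qed.

Lemma derive_comp_translate m n (h : 'rV[R]_m -> 'rV[R]_n) (v : 'rV[R]_n) u w j :
  'D_w (comp_fun h j) u = 'D_w (comp_fun (fun u => h u + v) j) u.
Proof.
have E t : h (t *: w + u) 0 j - h u 0 j = (h (t *: w + u) + v) 0 j - (h u + v) 0 j.
  by rewrite !mxE opprD addrACA subrr addr0.
by rewrite /derive /comp_fun /shift /=; under eq_fun do rewrite E.
Qed.

(** One point suffices in the conclusion: [V] can be any small open set, so the identity is obtained
    on a dense set and extends by continuity. *)
Lemma local_pullback k m n (h : 'rV[R]_m -> 'rV[R]_n) (V : set 'rV[R]_m)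
    (W O : set 'rV[R]_n) (a : 'rV[R]_m -> alt R m k) (th : 'rV[R]_m -> alt R m k.+1)
    (b : 'rV[R]_n -> alt R n k) (et : 'rV[R]_n -> alt R n k.+1) :
  dmap M h -> open V -> V !=set0 -> open W -> open O -> dpred M O ->
  (forall P : set 'rV[R]_n, open P -> P !=set0 -> P `<=` W -> O `&` P !=set0) ->
  (forall u, V u -> W (h u)) ->
  (forall u, V u -> a u = alt_pull (jacobian h u) (b (h u))) ->
  (forall u, V u -> th u = alt_pull (jacobian h u) (et (h u))) ->
  (forall y, W y -> forall K, {for y, continuous (fun y => b y (rowsub K 1%:M))}) ->
  (forall y, W y -> forall K, {for y, continuous (fun y => et y (rowsub K 1%:M))}) ->
  (forall K, C1_on O (fun y => b y (rowsub K 1%:M) : R^o)) ->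
  (forall y, O y -> forall B, ext_deriv b y B = et y B) ->
  (forall K, C1_on V (fun u => a u (rowsub K 1%:M) : R^o)) ->
  forall A, exists u, V u /\ ext_deriv a u A = th u A.
Proof.
move=> dh oV V0 oW oO dO Od hW hath hth cb cet C1b dbet C1a A.
have [V1 [oV1 [u0 V1u0] V1V hC2]] := (genericP _).1 (generic_C2_at hM dh) V oV V0.
have dfh u : V1 u -> differentiable h u by exact: (C2_differentiable oV1 hC2).
have ch u : V1 u -> {for u, continuous h}.
  by move=> /dfh /differentiable_continuous.
have C1J i j : C1_on V1 (fun u => jacobian h u i j : R^o).
  exact: (C2_jacobian_C1 oV1 hC2).
have cJ u i j : V1 u -> {for u, continuous (fun u => jacobian h u i j)}.
  by move=> V1u; exact: (C1_on_continuous (C1J i j) V1u).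
have [d d0 hdW] := open_ballP oW (hW _ (V1V _ V1u0)).
(* With [h u] within [rho] of [h u0] and [v] within [rho] of zero, [h u + v] stays in a ball
   contained in [W], where [O] is dense. *)
pose rho := d / 2; have rho0 : 0 < rho by rewrite divr_gt0.
have [r1 r10 hr1] : exists2 r, 0 < r & ball u0 r `<=` [set u | V1 u /\ ball (h u0) rho (h u)].
  have n1 : nbhs u0 V1 by exact: open_nbhs_nbhs.
  have n2 : nbhs u0 [set u | ball (h u0) rho (h u)].
    by apply: (ch u0 V1u0); exact: nbhsx_ballx.
  by apply/nbhs_ballP; exact: filterI n1 n2.
pose G u v := ball u0 r1 u /\ O (h u + v).
have hG : dpred M (fun z : 'rV[R]_(m + n) => G (lsubmx z) (rsubmx z)).
  by rewrite /G; dtac.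
have [||V2 [oV2 [u1 V2u1] V2b hV2]] := @translation_into R M hM m n G (ball u0 r1) rho hG
    (ball_open _ _) (ex_intro _ u0 (ballxx _ r10)) rho0.
- move=> u v ub vb e e0.
  have [V1u hu] := hr1 u ub.
  have Wuv : ball (h u0) d (h u + v).
    rewrite -ball_normE /=; rewrite -!ball_normE /= sub0r normrN in hu vb.
    by rewrite opprD addrA; apply: le_lt_trans (ler_normB _ _) _; rewrite /rho in hu vb; lra.
  pose P := ball (h u + v) e `&` ball (h u0) d.
  have [|||y [Oy [h1 h2]]] := Od P.
  + by apply: openI; exact: ball_open.
  + by exists (h u + v); split => //; exact: ballxx.
  + by move=> y [_ /hdW].
  exists u, (y - h u); split; first exact: ballxx.
    by move: h1; rewrite -!ball_normE /= opprB addrCA addrA.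
  by split => //; rewrite addrC subrK.
- move=> u v [ub Ouv]; have [V1u _] := hr1 u ub.
  have [e e0 he] := open_ballP oO Ouv; have e20 : 0 < e / 2 by rewrite divr_gt0.
  have n1 : nbhs u (ball u0 r1).
    by apply: open_nbhs_nbhs; split => //; exact: ball_open.
  have n2 : nbhs u [set u' | ball (h u) (e / 2) (h u')].
    by apply: (ch u V1u); exact: nbhsx_ballx.
  have /nbhs_ballP[d' /= d'0 hd'] :
    nbhs u (ball u0 r1 `&` [set u' | ball (h u) (e / 2) (h u')]) by exact: filterI.
  exists (Num.min d' (e / 2)); split; first by rewrite lt_min d'0.
  move=> u' v' uu' vv'.
  have l1 : Num.min d' (e / 2) <= d' by rewrite ge_min lexx.
  have l2 : Num.min d' (e / 2) <= e / 2 by rewrite ge_min lexx orbT.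
  have [h1 h2] := hd' u' (le_ball l1 uu'); split => //; apply: he.
  have h3 := le_ball l2 vv'.
  rewrite -ball_normE /=; rewrite -!ball_normE /= in h2 h3.
  by rewrite opprD addrACA; apply: le_lt_trans (ler_normD _ _) _; lra.
have V2V1 u : V2 u -> V1 u by move=> /V2b /hr1[].
have V2V u : V2 u -> V u by move=> /V2V1 /V1V.
have [r2 r20 hr2] := open_ballP oV2 V2u1.
(* The closed ball of half the radius lies in [V2], so the uniform estimates hold on it, hence on
   [V3]. *)
pose V3 := ball u1 (r2 / 2); have oV3 : open V3 by exact: ball_open.
have V3u1 : V3 u1 by apply: ballxx; rewrite divr_gt0.
have V3cl u : V3 u -> `|u1 - u| <= r2 / 2.
  by rewrite /V3 -ball_normE /= => /ltW.
have clV2 u : `|u1 - u| <= r2 / 2 -> V2 u.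
  by move=> h1; apply: hr2; rewrite -ball_normE /=; lra.
have V3V2 u : V3 u -> V2 u by move=> /V3cl /clV2.
have sV3V1 : V3 `<=` V1 by move=> u /V3V2 /V2V1.
exists u1; split; first exact: V2V.
have C1a3 K : C1_on V3 (fun u => a u (rowsub K 1%:M) : R^o).
  by apply: (C1_on_sub oV3 oV _ (C1a K)) => u /V3V2 /V2V.
have [Ca Da] := ext_deriv_signed A oV3 C1a3.
rewrite -Da//; apply: (divergence_limit (c := fun u => th u A) oV3 V3u1) => //.
  apply: (@continuous_near_eq _ _ (fun u => et (h u) (A *m jacobian h u))).
    have : nbhs u1 V2 by exact: open_nbhs_nbhs.
    by apply: filterS => u /V2V Vu; rewrite hth.
  have V1u1 := V2V1 _ V2u1.
  apply: continuous_alt => [K|].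
    apply: (@continuous_comp _ _ _ h (fun y => et y (rowsub K 1%:M))); first exact: ch.
    by apply: cet; apply: hW; exact: V2V.
  apply: continuous_mulmx_entry => i j; first exact: cst_continuous.
  exact: cJ.
move=> e e0.
have cbK u : `|u1 - u| <= r2 / 2 -> forall K,
    {for h u, continuous (fun y => b y (rowsub K 1%:M))}.
  by move=> /clV2 /V2V /hW; exact: cb.
have cetK u : `|u1 - u| <= r2 / 2 -> forall K,
    {for h u, continuous (fun y => et y (rowsub K 1%:M))}.
  by move=> /clV2 /V2V /hW; exact: cet.
have chK u : `|u1 - u| <= r2 / 2 -> {for u, continuous h} by move=> /clV2 /V2V1; exact: ch.
have cJK u : `|u1 - u| <= r2 / 2 -> forall i j, {for u, continuous (fun u => jacobian h u i j)}.
  by move=> /clV2 /V2V1 V1u i j; exact: cJ.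
have hs r := small_translation (row' r A) chK cJK cbK e0.
have [d1 [d10 hd1]] : exists d : R, 0 < d /\ forall v, ball 0 d v ->
    forall (r : 'I_k.+1) u, `|u1 - u| <= r2 / 2 ->
    `|b (h u + v) (row' r A *m jacobian h u) - b (h u) (row' r A *m jacobian h u)| <= e.
  have : nbhs (0 : 'rV[R]_n) [set v | forall (r : 'I_k.+1) u, `|u1 - u| <= r2 / 2 ->
    `|b (h u + v) (row' r A *m jacobian h u) - b (h u) (row' r A *m jacobian h u)| <= e].
    apply: (@filter_forall _ _ (fun (r : 'I_k.+1) v => forall u, `|u1 - u| <= r2 / 2 ->
      `|b (h u + v) (row' r A *m jacobian h u) - b (h u) (row' r A *m jacobian h u)| <= e)
      (nbhs (0 : 'rV[R]_n))) => r.
    by have [d' [d'0 hd']] := hs r; apply/nbhs_ballP; exists d'.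
  by move=> /nbhs_ballP[d' d'0 hd']; exists d'; split.
have [d2 [d20 hd2]] := small_translation A chK cJK cetK e0.
have m0 : 0 < Num.min d1 d2 by rewrite lt_min d10.
have [v [vb hv]] := hV2 _ m0.
have l1 : Num.min d1 d2 <= d1 by rewrite ge_min lexx.
have l2 : Num.min d1 d2 <= d2 by rewrite ge_min lexx orbT.
have vd1 := le_ball l1 vb; have vd2 := le_ball l2 vb.
pose g u := h u + v.
have gO u : V3 u -> O (g u) by move=> /V3V2 /hv[].
have C1h j : C1_on V3 (comp_fun h j).
  by apply: (C1_on_sub oV3 oV1 sV3V1); exact: (C2_comp_C1 oV1 hC2).
have C1g j : C1_on V3 (comp_fun g j) by exact: C1_on_translate.
have C1J3 i j : C1_on V3 (fun u => jacobian h u i j : R^o).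
  exact: (C1_on_sub oV3 oV1 sV3V1 (C1J i j)).
(* This is the pullback of [b] along [g], because [g] and [h] have the same Jacobian. As [g] maps
   [V3] into [O], the classical computation applies to it, and it differs from [a] only in the point
   where [b] is evaluated. *)
pose a' u := alt_pull (jacobian h u) (b (g u)).
have C1a' K : C1_on V3 (fun u => a' u (rowsub K 1%:M) : R^o).
  apply: (C1_on_alt oV3 (b := fun u => b (g u)) (B := fun u => rowsub K 1%:M *m jacobian h u)).
    by move=> L; exact: (C1_on_comp oV3 oO gO C1g (C1b L)).
  exact: C1_on_mulmx_entry.
have [Ca' Da'] := ext_deriv_signed A oV3 C1a'.
exists (fun (r : 'I_k.+1) u => (-1) ^+ r * a' u (row' r A)),
  (fun u => et (g u) (A *m jacobian h u)); split => //.
- move=> u V3u; rewrite Da'//.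
  have V1u := sV3V1 u V3u.
  have dg : differentiable g u.
    by apply: differentiable_of_comp => j; have [+ _] := C1g j; apply.
  have Jg : jacobian h u = jacobian g u.
    apply/matrixP => i j; apply: (etrans (jacobianE i j (dfh u V1u))).
    apply: etrans _ (esym (jacobianE i j dg)).
    exact: derive_comp_translate.
  rewrite -dbet; last exact: gO.
  apply: (@ext_deriv_pull R k m n g (fun u => jacobian h u) b u
    (fun v => \matrix_(i, j) 'D_v (fun u => jacobian h u i j : R^o) u)).
  + exact: dg.
  + exact: Jg.
  + move=> w i j; rewrite [X in is_derive _ _ _ X]mxE; apply/derivableP/diff_derivable.
    by have [+ _] := C1J3 i j; apply.
  + by move=> w1 w2; exact: (C2_hessian_sym oV1 hC2).
  + by move=> K; have [+ _] := C1b K; apply; exact: gO.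
- move=> r u V3u; rewrite -mulrBr normrM normrX normrN1 expr1n mul1r.
  by rewrite hath; [exact: hd1 (V3cl u V3u)|exact/V2V/V3V2].
- by move=> u V3u; rewrite hth; [exact: hd2 (V3cl u V3u)|exact/V2V/V3V2].
Qed.

End LocalPullback.

(** * Forms on manifolds *)

Section Jacobians.
Context (R : realType).

Lemma mulmx_jacobian m n (h : 'rV[R]_m -> 'rV[R]_n) u v :
  v *m jacobian h u = 'd h u v.
Proof. exact: mul_rV_lin1. Qed.

Lemma eq_jacobian m n (h : 'rV[R]_m -> 'rV[R]_n) u (J : 'M[R]_(m, n)) :
  (forall v, 'd h u v = v *m J) -> jacobian h u = J.
Proof.
move=> hJ; apply/row_matrixP => i; rewrite [RHS]rowE -hJ [LHS]rowE.
exact: mulmx_jacobian.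
Qed.

Lemma jacobian_near_eq m n (f g : 'rV[R]_m -> 'rV[R]_n) u :
  {near u, f =1 g} -> differentiable f u ->
  differentiable g u /\ jacobian f u = jacobian g u.
Proof.
move=> fg df; have [dg E] := differentiable_near_eq fg df; split; first exact: dg.
apply: eq_jacobian => v; apply: etrans _ (esym (mulmx_jacobian g u v)).
exact: (congr1 (fun F => F v) (esym E)).
Qed.

Lemma jacobian_comp m n p (f : 'rV[R]_m -> 'rV[R]_n) (g : 'rV[R]_n -> 'rV[R]_p) u :
  differentiable f u -> differentiable g (f u) ->
  jacobian (g \o f) u = jacobian f u *m jacobian g (f u).
Proof.
move=> df dg; apply: eq_jacobian => v; rewrite mulmxA (mulmx_jacobian f u v).
rewrite (mulmx_jacobian g (f u)).
exact: (congr1 (fun F => F v) (diff_comp df dg)).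
Qed.

Lemma jacobian_near_id m (f : 'rV[R]_m -> 'rV[R]_m) u :
  {near u, f =1 id} -> jacobian f u = 1%:M.
Proof.
move=> fi; have fi' : {near u, id =1 f} by apply: filterS fi => v ->.
have [di ei] := @is_diff_id R 'rV[R]_m u.
have [_ <-] := jacobian_near_eq fi' di.
by apply: eq_jacobian => v; rewrite mulmx1 ei.
Qed.

Lemma alt_pull_comp m n p k (J : 'M[R]_(m, n)) (K : 'M[R]_(n, p)) (t : alt R p k) :
  alt_pull J (alt_pull K t) = alt_pull (J *m K) t.
Proof. by apply: alt_ext => A /=; rewrite mulmxA. Qed.

Lemma alt_pull1 n k (t : alt R n k) : alt_pull 1%:M t = t.
Proof. by apply: alt_ext => A /=; rewrite mulmx1. Qed.

Lemma alt_eq_coefs n k (t u : alt R n k) :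
  (forall K : 'I_k -> 'I_n, t (rowsub K 1%:M) = u (rowsub K 1%:M)) -> t = u.
Proof.
move=> tu; apply: alt_ext => A; rewrite (alt_expand t) (alt_expand u).
by apply: eq_bigr => K _; rewrite tu.
Qed.

Lemma continuous_coord (T : topologicalType) m n (f : T -> 'M[R]_(m, n)) x i j :
  {for x, continuous f} -> {for x, continuous (fun y => f y i j)}.
Proof.
move=> cf; apply: (@continuous_comp _ _ _ f (fun M : 'M[R]_(m, n) => M i j)) => //.
exact: coord_continuous.
Qed.

Lemma C1_on_jacobian m n (h : 'rV[R]_m -> 'rV[R]_n) (V : set 'rV[R]_m) u i j :
  open V -> C1_on V h -> V u -> {for u, continuous (fun u => jacobian h u i j)}.
Proof.
move=> oV [h1 h2] Vu.
have E y : jacobian h y i j = ('d h y (evec R i)) 0 j.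
  by rewrite -(mulmx_jacobian h y) /evec -rowE [RHS]mxE.
rewrite (_ : (fun _ => _) = (fun y => ('d h y (evec R i)) 0 j)); last exact/funext.
by apply: continuous_coord; have /(open_continuous_within _ oV) := h2 (evec R i); apply.
Qed.

Lemma open_preimage_within (T W : topologicalType) (V : set T) (f : T -> W) (O : set W) :
  open V -> {within V, continuous f} -> open O -> open (V `&` f @^-1` O).
Proof.
move=> oV /(open_continuous_within _ oV) cf oO; rewrite openE => x [Vx Ofx].
have n1 : nbhs x V by exact: open_nbhs_nbhs.
by apply: (filterI n1); apply: (cf x Vx); exact: open_nbhs_nbhs.
Qed.

Lemma eq_near_dense (T : topologicalType) (g h : T -> R) x :
  {for x, continuous g} -> {for x, continuous h} ->
  (forall Q, open Q -> Q x -> exists y, Q y /\ g y = h y) -> g x = h x.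
Proof.
move=> cg ch d; apply/eqP; case: (eqVneq (g x) (h x)) => // ne.
have e0 : 0 < `|g x - h x| / 2 by rewrite divr_gt0// normr_gt0 subr_eq0.
have n1 : nbhs x [set y | ball (g x) (`|g x - h x| / 2) (g y)].
  by apply: cg; exact: nbhsx_ballx.
have n2 : nbhs x [set y | ball (h x) (`|g x - h x| / 2) (h y)].
  by apply: ch; exact: nbhsx_ballx.
have [|y [Qy E]] := d _ (@open_interior _ ([set y | ball (g x) (`|g x - h x| / 2) (g y)] `&`
  [set y | ball (h x) (`|g x - h x| / 2) (h y)])); first exact: filterI.
have [/=] := interior_subset Qy; rewrite -!ball_normE /= E => h1 h2.
have : `|g x - h x| <= `|g x - h y| + `|h x - h y|.
  by rewrite [`|h x - _|]distrC -{1}[g x](subrK (h y)) -addrA; exact: ler_normD.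
by move: h1 h2; move: (`|g x - h x|) (`|g x - _|) (`|h x - _|) => a b c *; lra.
Qed.

End Jacobians.

Section Charts.
Context (R : realType) (M : structure R).

Lemma open_chart_map (T : topologicalType) n (c : chart M T n) O : open O ->
  open (chart_dom c `&` chart_map c @^-1` O).
Proof.
by move=> oO; apply: open_preimage_within => //;
  [exact: chart_dom_open|exact: chart_map_continuous].
Qed.

Lemma open_chart_inv (T : topologicalType) n (c : chart M T n) U : open U ->
  open (chart_img c `&` chart_inv c @^-1` U).
Proof.
by move=> oU; apply: open_preimage_within => //;
  [exact: chart_img_open|exact: chart_inv_continuous].
Qed.

Section Map.
Context (Y X : manifold M) (f : Y -> X).

Definition chart_overlap (j : 'I_(msize Y)) (i : 'I_(msize X)) : set 'rV[R]_(mdim Y) :=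
  chart_img (mchart j) `&` (f \o chart_inv (mchart j)) @^-1` chart_dom (mchart i).

Definition chart_rep (j : 'I_(msize Y)) (i : 'I_(msize X)) :
    'rV[R]_(mdim Y) -> 'rV[R]_(mdim X) :=
  chart_map (mchart i) \o f \o chart_inv (mchart j).

Context (hf : definable_C1_map f).

Lemma open_chart_overlap j i : open (chart_overlap j i).
Proof.
have [cf _] := hf; apply: (@open_chart_inv _ _ (mchart j) (f @^-1` chart_dom (mchart i))).
by apply: open_comp; [move=> x _; exact: cf|exact: chart_dom_open].
Qed.

Lemma chart_rep_differentiable j i u : chart_overlap j i u ->
  differentiable (chart_rep j i) u.
Proof. by have [_ /(_ j i)[_ [+ _]]] := hf; apply. Qed.

Lemma transition_differentiable (Z : manifold M) (i j : 'I_(msize Z)) u :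
  chart_img (mchart i) u -> chart_dom (mchart j) (chart_inv (mchart i) u) ->
  differentiable (chart_map (mchart j) \o chart_inv (mchart i)) u.
Proof. by move=> iu ju; have [_ [+ _]] := mchart_transition i j; apply. Qed.

Lemma tchart_dom (Z : manifold M) (z : Z) : chart_dom (tchart z) z.
Proof. by rewrite /tchart; case: cid. Qed.

(** [pullback] is defined with the charts chosen at [y] and [f y], not with [j] and [i]. Both sides
    involve Jacobians of composites that are equal near [u], and the chain rule identifies them. *)
Lemma in_chart_pullback k (w : kform X k) j i u : chart_overlap j i u ->
  in_chart (pullback f w) j u =
  alt_pull (jacobian (chart_rep j i) u) (in_chart w i (chart_rep j i u)).
Proof.
move=> [ju iu]; rewrite /in_chart /pullback.
have E : chart_inv (mchart i) (chart_rep j i u) = f (chart_inv (mchart j) u).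
  by rewrite /chart_rep /= chart_mapK.
rewrite E !alt_pull_comp; congr alt_pull.
set y := chart_inv (mchart j) u in iu E *.
pose jy := sval (cid (mchart_cover y)); pose ix := sval (cid (mchart_cover (f y))).
have dy : chart_dom (mchart jy) y := tchart_dom y.
have dx : chart_dom (mchart ix) (f y) := tchart_dom (f y).
rewrite /tangent_mx -/y -[tchart y]/(mchart jy) -[tchart (f y)]/(mchart ix).
have yu : chart_inv (mchart jy) (chart_map (mchart jy) y) = y by rewrite chart_mapK.
have oyj : chart_overlap jy ix (chart_map (mchart jy) y).
  by split; [exact: chart_map_img|rewrite /= yu].
have di := chart_rep_differentiable (conj ju iu : chart_overlap j i u).
have dt : differentiable (chart_map (mchart ix) \o chart_inv (mchart i)) (chart_rep j i u).
  by apply: transition_differentiable; [exact: chart_map_img|rewrite E].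
have ds : differentiable (chart_map (mchart jy) \o chart_inv (mchart j)) u.
  exact: transition_differentiable.
rewrite -(jacobian_comp di dt).
apply: etrans (esym (jacobian_comp ds (chart_rep_differentiable oyj))) _.
have dq : differentiable (chart_rep jy ix \o
    (chart_map (mchart jy) \o chart_inv (mchart j))) u.
  exact: differentiable_comp ds (chart_rep_differentiable oyj).
suff n0 : {near u, chart_rep jy ix \o (chart_map (mchart jy) \o chart_inv (mchart j)) =1
    (chart_map (mchart ix) \o chart_inv (mchart i)) \o chart_rep j i}.
  exact: (jacobian_near_eq n0 dq).2.
have n1 : nbhs u (chart_overlap j i) by apply: open_nbhs_nbhs; split => //; exact: open_chart_overlap.
have n2 : nbhs u (chart_img (mchart j) `&` chart_inv (mchart j) @^-1` chart_dom (mchart jy)).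
  by apply: open_nbhs_nbhs; split => //; apply: open_chart_inv; exact: chart_dom_open.
apply: filterS (filterI n1 n2) => v [[jv iv] [_ dv]].
by rewrite /chart_rep /= !chart_mapK.
Qed.

Lemma chart_rep_definable j i : definable_map M (chart_overlap j i) (chart_rep j i).
Proof. by have [_ /(_ j i)[]] := hf. Qed.

Lemma chart_rep_C1 j i : C1_on (chart_overlap j i) (chart_rep j i).
Proof. by have [_ /(_ j i)[]] := hf. Qed.

Lemma chart_overlap_img j i u : chart_overlap j i u -> chart_img (mchart i) (chart_rep j i u).
Proof. by move=> [_ iu]; exact: chart_map_img. Qed.

Lemma chart_overlap_cover j u : chart_img (mchart j) u -> exists i, chart_overlap j i u.
Proof. by move=> ju; have [i iu] := mchart_cover (f (chart_inv (mchart j) u)); exists i. Qed.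

End Map.

(** The transition from a chart to itself is the identity near the point. Hence a form is determined
    by its expressions in charts. *)
Lemma in_chart_tchart (X : manifold M) k (w : kform X k) (x : X) :
  in_chart w (sval (cid (mchart_cover x))) (chart_map (tchart x) x) = w x.
Proof.
set i := sval _; have dx : chart_dom (mchart i) x := tchart_dom x.
rewrite /in_chart -[tchart x]/(mchart i) (chart_mapK dx) -[tchart x]/(mchart i).
rewrite jacobian_near_id ?alt_pull1//.
have : nbhs (chart_map (mchart i) x) (chart_img (mchart i)).
  by apply: open_nbhs_nbhs; split; [exact: chart_img_open|exact: chart_map_img].
by apply: filterS => u iu /=; rewrite chart_invK.
Qed.

End Charts.

(** * Gluing and common domains of regularity in a tame class *)

Section TameClasses.
Context (R : realType) (M : structure R) (F : funclass R) (hF : tame_class M F).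

Lemma definable_map_id n (V : set 'rV[R]_n) : dpred M V -> definable_map M V id.
Proof.
move=> hV; apply: (@dpred_ext _ _ _ (fun z : 'rV[R]_(n + n) => V (lsubmx z) /\
    forall i : 'I_n, rsubmx z 0 i = lsubmx z 0 i)).
  by move=> z; split=> -[Vz E]; split => //; [apply/rowP|move=> i; rewrite E].
by dtac.
Qed.

Lemma tame_class_cst n (A : set 'rV[R]_n) (a : R) : dpred M A -> F A (fun=> a).
Proof. by move=> hA; apply: (tame_class_definable hF); exact: definable_fun_cst. Qed.

Lemma tame_class_sub n (A V : set 'rV[R]_n) f : F A f -> dpred M V -> V `<=` A -> F V f.
Proof.
by move=> Ff hV VA; apply: (tame_class_comp hF Ff (definable_map_id hV)) => x /VA.
Qed.

Lemma tame_class_sum n (A : set 'rV[R]_n) (J : Type) (s : seq J)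
    (f : J -> 'rV[R]_n -> R) : dpred M A ->
  (forall i, F A (f i)) -> F A (fun x => \sum_(i <- s) f i x).
Proof.
move=> hA hf; elim: s => [|i s ih].
  by apply: (tame_class_ext hF) (tame_class_cst 0 hA) => x _; rewrite big_nil.
by apply: (tame_class_ext hF) (tame_class_add hF (hf i) ih) => x _; rewrite big_cons.
Qed.

Lemma tame_class_prod n (A : set 'rV[R]_n) (J : Type) (s : seq J)
    (f : J -> 'rV[R]_n -> R) : dpred M A ->
  (forall i, F A (f i)) -> F A (fun x => \prod_(i <- s) f i x).
Proof.
move=> hA hf; elim: s => [|i s ih].
  by apply: (tame_class_ext hF) (tame_class_cst 1 hA) => x _; rewrite big_nil.
by apply: (tame_class_ext hF) (tame_class_mul hF (hf i) ih) => x _; rewrite big_cons.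
Qed.

(* The sets [V i] are made disjoint by removing the previous ones. *)
Lemma tame_class_glue n (A : set 'rV[R]_n) N (V : 'I_N -> set 'rV[R]_n) f :
  dpred M A -> (forall i, dpred M (V i)) -> (forall i, V i `<=` A) ->
  (forall x, A x -> exists i, V i x) -> (forall i, F (V i) f) -> F A f.
Proof.
move=> hA hV VA cV hf.
pose V' (i : 'I_N) x := V i x /\ forall l : 'I_N, (l < i)%N -> ~ V l x.
have hV' i : dpred M (V' i).
  rewrite /V'; apply: dpred_and; first exact: hV.
  apply: dpred_all_fin => l; apply: dpred_imp; first exact: dpred_const.
  by apply: dpred_not; exact: hV.
have := tame_class_sum (index_enum 'I_N) hA (fun i => tame_class_extend0 hF hA (hV' i)
  (fun x h => VA i x h.1) (tame_class_sub (hf i) (hV' i) (fun x h => h.1))).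
apply: (tame_class_ext hF) => x Ax; have [i0 i0x] := cV x Ax.
have [i Vix imin] := @arg_minnP 'I_N i0 (fun i => `[< V i x >]) (fun i => val i)
  (asboolT i0x).
have V'i : V' i x.
  split; first exact/asboolP.
  by move=> l li /asboolT /imin; rewrite leqNgt li.
rewrite (bigD1 i)//= (extend0E _ V'i) big1 ?addr0// => l li; apply: extend0N => -[Vl hl].
case: (ltngtP l i) li => [li _|il _|/val_inj -> /eqP//].
  by case: V'i => _ /(_ l li).
by case: V'i => Vi _; exact: (hl i il).
Qed.

Lemma generic_relative n (A V : set 'rV[R]_n) : V `<=` A -> open V ->
  (forall O : set 'rV[R]_n, open O -> O !=set0 -> O `<=` A -> V `&` O !=set0) ->
  open A -> generic [set x | A x -> V x].
Proof.
move=> VA oV hV oA; apply/genericP => Q oQ Q0.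
have [[x [Qx Ax]]|QA] := pselect ((Q `&` A) !=set0); last first.
  by exists Q; split => // x Qx Ax; case: QA; exists x.
exists (V `&` (Q `&` A)); split.
- by apply: openI => //; exact: openI.
- by apply: hV; [exact: openI|exists x|move=> y []].
- by move=> y [_ []].
- by move=> y [Vy _] Ay.
Qed.

(** The sets given for each [t] are intersected; density in [A] survives because it is expressed as
    genericity of an implication. *)
Lemma tame_class_C1_fin n (A : set 'rV[R]_n) (T : finType) (f : T -> 'rV[R]_n -> R) :
  open A -> dpred M A -> (forall t, F A (f t)) ->
  exists V : set 'rV[R]_n, [/\ open V, V `<=` A, dpred M V,
    (forall O : set 'rV[R]_n, open O -> O !=set0 -> O `<=` A -> V `&` O !=set0) &
    forall t, C1_on V (f t : _ -> R^o)].
Proof.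
move=> oA hA hf; have /choice[V hV] t := tame_class_C1 hF oA hA (hf t).
pose W : set 'rV[R]_n := [set x | A x /\ forall t, V t x].
have oW : open W.
  rewrite openE => x [Ax Vx].
  have n1 : nbhs x A by exact: open_nbhs_nbhs.
  have n2 : nbhs x [set y | forall t, V t y].
    apply: (@filter_forall _ _ V (nbhs x)) => t; have [oV _ _ _ _] := hV t.
    exact: open_nbhs_nbhs.
  exact: filterI n1 n2.
exists W; split => //.
- by move=> x [].
- apply: dpred_and => //; apply: dpred_all_fin => t.
  by have [_ _ dV _ _] := hV t.
- move=> O oO O0 OA.
  have g : generic [set x | forall t, A x -> V t x].
    apply: generic_all_fin => t; have [oV VA _ dV _] := hV t.
    exact: generic_relative.
  have [x [Ox hx]] := generic_nonempty g oO O0.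
  by exists x; split => //; split=> [|t]; [exact: OA|apply: hx; exact: OA].
move=> t; have [oV _ _ _ C1V] := hV t.
by apply: (C1_on_sub oW oV _ C1V) => x [_].
Qed.

End TameClasses.

(** * Coefficients of pulled back forms *)

Section Forms.
Context (R : realType) (M : structure R) (hM : o_minimal M).

Lemma near_extend0 n (V : set 'rV[R]_n) (g : 'rV[R]_n -> R) u : open V -> V u ->
  {near u, g =1 extend0 V g}.
Proof.
move=> oV Vu; have : nbhs u V by exact: open_nbhs_nbhs.
by apply: filterS => x Vx; rewrite extend0E.
Qed.

(** The extension of [h] by zero agrees with [h] near each point of the open set [V], so the total
    definable functions [pd] of its coordinates have the right values there. *)
Lemma definable_jacobian m n (V : set 'rV[R]_m) (h : 'rV[R]_m -> 'rV[R]_n) a b :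
  open V -> definable_map M V h -> (forall u, V u -> differentiable h u) ->
  definable_fun M V (fun u => jacobian h u a b).
Proof.
move=> oV hh dh; have hV := definable_map_dom hh.
pose g := extend0 V (comp_fun h b).
have hg : dfun M g.
  by have := definable_map_dmap hh b; apply: dfun_ext => x; rewrite mxE.
apply: (@definable_fun_ext _ _ _ _ (pd g a)); last first.
  apply/definable_funP; split => //.
  by apply: dfun_if => //; [exact: dfun_pd|exact: dfun_cst].
move=> u Vu; have ng := near_extend0 (comp_fun h b) oV Vu.
have [dg Eg] := differentiable_near_eq ng (differentiable_comp_fun b (dh u Vu)).
rewrite (@pdE _ _ (g : _ -> R^o)); last exact: diff_derivable.
apply: etrans _ (esym (jacobianE a b (dh u Vu))).
rewrite deriveE; last exact: dg.
rewrite deriveE; last exact: (differentiable_comp_fun b (dh u Vu)).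
exact: (congr1 (fun F => F _) Eg).
Qed.

Context (F : funclass R) (hF : tame_class M F).

Section OneManifold.
Context (X : manifold M) (k : nat) (w : kform X k) (Ew : E0 F w).
Implicit Types i : 'I_(msize X).

Lemma E0_continuous i u K : chart_img (mchart i) u ->
  {for u, continuous (fun u => in_chart w i u (rowsub K 1%:M))}.
Proof.
move=> iu; move: K; apply: continuous_coefs => I incI.
have [/(open_continuous_within _ (chart_img_open (c := mchart i))) c _] := Ew i incI.
exact: c.
Qed.

Lemma E0_class i K :
  F (chart_img (mchart i)) (fun u => in_chart w i u (rowsub K 1%:M)).
Proof.
have hi := chart_img_definable (mchart i).
have [E|[I [c [incI E]]]] := @alt_rowsub_sort R k _ K.
  by apply: (tame_class_ext hF) (tame_class_cst hF 0 hi) => u _; rewrite E.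
have [_ FI] := Ew i incI.
by apply: (tame_class_ext hF) (tame_class_mul hF (tame_class_cst hF c hi) FI) => u _; rewrite E.
Qed.

End OneManifold.

Context (Y X : manifold M) (f : Y -> X) (hf : definable_C1_map f).

(** Continuity is checked on one overlap with a chart of [X] at a time. Membership in [F] is not a
    local property; it is glued from the finitely many definable overlaps that cover the image of
    the chart [j]. *)
Lemma E0_pullback k (w : kform X k) : E0 F w -> E0 F (pullback f w).
Proof.
move=> Ew j I _; have oj := chart_img_open (c := mchart j).
have oV i := open_chart_overlap hf (j := j) (i := i).
have cE i u : chart_overlap f j i u -> coef (pullback f w) j I u =
    in_chart w i (chart_rep f j i u) (rowsub I 1%:M *m jacobian (chart_rep f j i) u).
  by move=> Vu; rewrite /coef (in_chart_pullback hf _ Vu).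
split.
  apply/(open_continuous_within _ oj) => u ju.
  have [i Vu] := chart_overlap_cover f ju.
  apply: (@continuous_near_eq _ _ (fun u => in_chart w i (chart_rep f j i u)
      (rowsub I 1%:M *m jacobian (chart_rep f j i) u))).
    have : nbhs u (chart_overlap f j i) by exact: open_nbhs_nbhs.
    by apply: filterS => v Vv; exact: esym (cE i v Vv).
  apply: continuous_alt => [K|].
    apply: (@continuous_comp _ _ _ (chart_rep f j i)
      (fun y => in_chart w i y (rowsub K 1%:M))).
      exact: differentiable_continuous (chart_rep_differentiable hf Vu).
    by apply: E0_continuous => //; exact: chart_overlap_img.
  apply: continuous_mulmx_entry => a b; first exact: cst_continuous.
  exact: C1_on_jacobian (oV i) (chart_rep_C1 hf j i) Vu.
have dV i : dpred M (chart_overlap f j i) := definable_map_dom (chart_rep_definable hf j i).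
apply: (tame_class_glue hF (chart_img_definable (mchart j)) dV).
- by move=> i u [].
- by move=> u; exact: chart_overlap_cover.
move=> i; apply: (tame_class_ext hF) => [u /cE E|]; first by rewrite E alt_expand.
apply: (tame_class_sum hF _ (dV i)) => K; apply: (tame_class_mul hF).
  apply: (tame_class_prod hF _ (dV i)) => a.
  apply: (tame_class_ext hF (f := fun u => \sum_b (rowsub I 1%:M : 'M[R]_(_, _)) a b *
     jacobian (chart_rep f j i) u b (K a))); first by move=> u _; rewrite [RHS]mxE.
  apply: (tame_class_sum hF _ (dV i)) => b; apply: (tame_class_mul hF); first exact: (tame_class_cst hF).
  apply: (tame_class_definable hF); apply: definable_jacobian => //.
    exact: chart_rep_definable.
  by move=> u; exact: chart_rep_differentiable.
apply: (tame_class_comp hF (E0_class Ew i K) (chart_rep_definable hf j i)) => u.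
exact: chart_overlap_img.
Qed.
End Forms.

(** * The operator D on manifolds *)

Section Differential.
Context (R : realType) (M : structure R) (hM : o_minimal M).

Lemma chart_inv_dense (X : manifold M) (U : set X) (i : 'I_(msize X)) : dense U ->
  forall P : set 'rV[R]_(mdim X), open P -> P !=set0 -> P `<=` chart_img (mchart i) ->
  (chart_img (mchart i) `&` chart_inv (mchart i) @^-1` U) `&` P !=set0.
Proof.
move=> dU P oP [u Pu] Pi; have iu := Pi u Pu.
have [||y [[iy Py] Uy]] := dU (chart_dom (mchart i) `&` chart_map (mchart i) @^-1` P).
- exists (chart_inv (mchart i) u); split; first exact: chart_inv_dom.
  by rewrite /= chart_invK.
- exact: open_chart_map.
exists (chart_map (mchart i) y); split => //; split; first exact: chart_map_img.
by rewrite /= chart_mapK.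
Qed.

Lemma chart_inv_interior (X : manifold M) (P : set X) (i : 'I_(msize X)) u :
  chart_img (mchart i) u ->
  P° (chart_inv (mchart i) u) <-> exists e : R, 0 < e /\
    forall v : 'rV[R]_(mdim X), ball u e v ->
      chart_img (mchart i) v /\ P (chart_inv (mchart i) v).
Proof.
move=> iu; split=> [Pu|[e [e0 he]]].
  have [|e e0 he] := open_ballP (open_chart_inv (c := mchart i) (@open_interior _ P)) (x := u).
    by split.
  exists e; split => // v /he[iv Pv]; split => //.
  exact: interior_subset.
apply: (@filterS _ (nbhs (chart_inv (mchart i) u)) _
  (chart_dom (mchart i) `&` chart_map (mchart i) @^-1` ball u e)) => [x [ix /he[_]]|].
  by rewrite chart_mapK.
apply: open_nbhs_nbhs; split; first by apply: open_chart_map; exact: ball_open.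
by split; [exact: chart_inv_dom|rewrite /= chart_invK//; exact: ballxx].
Qed.

Lemma chart_generic (X : manifold M) (i : 'I_(msize X)) (O : set 'rV[R]_(mdim X)) :
  open O ->
  (forall P : set 'rV[R]_(mdim X), open P -> P !=set0 -> P `<=` chart_img (mchart i) ->
     O `&` P !=set0) ->
  generic [set x | chart_dom (mchart i) x -> O (chart_map (mchart i) x)].
Proof.
move=> oO dO; apply/genericP => Q oQ Q0.
have [[x [Qx ix]]|Qi] := pselect ((Q `&` chart_dom (mchart i)) !=set0); last first.
  by exists Q; split => // x Qx ix; case: Qi; exists x.
exists (Q `&` (chart_dom (mchart i) `&` chart_map (mchart i) @^-1` O)); split.
- by apply: openI => //; exact: open_chart_map.
- have [||| u [Ou [iu Qu]]] := dO (chart_img (mchart i) `&` chart_inv (mchart i) @^-1` Q).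
  + exact: open_chart_inv.
  + exists (chart_map (mchart i) x); split; first exact: chart_map_img.
    by rewrite /= chart_mapK.
  + by move=> u [].
  exists (chart_inv (mchart i) u); split; first exact: Qu.
  by split; [exact: chart_inv_dom|rewrite /= chart_invK].
- by move=> y [].
- by move=> y [_ [_ Oy]] _.
Qed.

(** The condition is vacuous outside each chart domain, so even for open [O j] the set may fail to
    be open at the boundary of a domain; hence the interior. Read in the chart [i], the interior is
    a first-order condition on the definable transition maps. *)
Lemma definable_chart_interior (X : manifold M)
    (O : 'I_(msize X) -> set 'rV[R]_(mdim X)) : (forall j, dpred M (O j)) ->
  definable_subset M
    ([set x | forall j, chart_dom (mchart j) x -> O j (chart_map (mchart j) x)]° : set X).
Proof.
move=> hO i; set P := [set x | _]; have hi : dpred M (chart_img (mchart i)).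
  exact: chart_img_definable.
have hV j := definable_map_dom (mchart_transition i j).1.
have hT j := definable_map_dmap (mchart_transition i j).1.
apply: (@dpred_ext _ _ _ (fun u => chart_img (mchart i) u /\ exists e : R, 0 < e /\
    forall v : 'rV[R]_(mdim X), ball u e v -> chart_img (mchart i) v /\
    forall j : 'I_(msize X),
      (chart_img (mchart i) `&` chart_inv (mchart i) @^-1` chart_dom (mchart j)) v ->
      O j (\row_l extend0 (chart_img (mchart i) `&`
        chart_inv (mchart i) @^-1` chart_dom (mchart j))
       (fun v => (chart_map (mchart j) \o chart_inv (mchart i)) v 0 l) v))); last first.
  apply: dpred_and => //.
  apply: (@dpred_ex _ _ _ (fun u e => 0 < e /\
    forall v : 'rV[R]_(mdim X), ball u e v -> chart_img (mchart i) v /\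
    forall j : 'I_(msize X),
      (chart_img (mchart i) `&` chart_inv (mchart i) @^-1` chart_dom (mchart j)) v ->
      O j (\row_l extend0 (chart_img (mchart i) `&`
        chart_inv (mchart i) @^-1` chart_dom (mchart j))
       (fun v => (chart_map (mchart j) \o chart_inv (mchart i)) v 0 l) v))).
  apply: dpred_and; first by dtac.
  apply: (@dpred_allv _ _ _ _ (fun z v => ball (lsubmx z) (rsubmx z 0 0) v -> chart_img (mchart i) v /\
    forall j : 'I_(msize X),
      (chart_img (mchart i) `&` chart_inv (mchart i) @^-1` chart_dom (mchart j)) v ->
      O j (\row_l extend0 (chart_img (mchart i) `&`
        chart_inv (mchart i) @^-1` chart_dom (mchart j))
       (fun v => (chart_map (mchart j) \o chart_inv (mchart i)) v 0 l) v))).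
  apply: dpred_imp; first by dtac.
  apply: dpred_and; first by apply: (dpred_comp hi); dtac.
  apply: dpred_all_fin => j; apply: dpred_imp; first by apply: (dpred_comp (hV j)); dtac.
  by apply: (dpred_comp (hO j)); apply: (dmap_comp (hT j)); dtac.
have E v j : (chart_img (mchart i) `&` chart_inv (mchart i) @^-1` chart_dom (mchart j)) v ->
    \row_l extend0 (chart_img (mchart i) `&`
        chart_inv (mchart i) @^-1` chart_dom (mchart j))
       (fun v => (chart_map (mchart j) \o chart_inv (mchart i)) v 0 l) v =
    chart_map (mchart j) (chart_inv (mchart i) v).
  by move=> Vv; apply/rowP => l; rewrite mxE extend0E.
move=> u; split=> [[iu]|[iu]].
  move=> [e [e0 he]]; split => //; apply/chart_inv_interior => //; exists e; split => //.
  move=> v /he[iv hv]; split => // j jv; have Vv := conj iv jv.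
  by have := hv j Vv; rewrite E.
move=> /(chart_inv_interior _ iu)[e [e0 he]]; split => //; exists e; split => //.
move=> v /he[iv hv]; split => // j Vv; rewrite E//; apply: hv; exact: Vv.2.
Qed.

Context (F : funclass R) (hF : tame_class M F).

(** Both candidates equal the same exterior derivative on the intersection of two dense open sets,
    which is dense; their coefficients are continuous. *)
Lemma is_D_unique (X : manifold M) k (w : kform X k) (eta eta' : kform X k.+1) :
  is_D M F w eta -> is_D M F w eta' -> eta = eta'.
Proof.
move=> [E1 [U1 [oU1 dU1 _ h1]]] [E2 [U2 [oU2 dU2 _ h2]]]; apply/funext => x.
pose i := sval (cid (mchart_cover x)); pose u := chart_map (mchart i) x.
have ix : chart_dom (mchart i) x := tchart_dom x.
have iu : chart_img (mchart i) u by exact: chart_map_img.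
rewrite -(in_chart_tchart eta x) -(in_chart_tchart eta' x) -[tchart x]/(mchart i).
apply: alt_eq_coefs => K.
apply: (eq_near_dense (E0_continuous E1 (K := K) iu) (E0_continuous E2 (K := K) iu)).
move=> Q oQ Qu.
have dU : dense (U1 `&` U2).
  move=> O O0 oO; have [y [Oy U1y]] := dU1 O O0 oO.
  have [|z [[Oz U1z] U2z]] := dU2 (O `&` U1) _ (openI oO oU1); first by exists y.
  by exists z.
have [||| v [[iv [U1v U2v]] [_ Qv]]] := @chart_inv_dense X _ i dU (chart_img (mchart i) `&` Q).
- by apply: openI => //; exact: chart_img_open.
- by exists u.
- by move=> v [].
exists v; split => //.
have [_ <-] := h1 i; last by split.
by have [_ <-] := h2 i; last by split.
Qed.

Context (Y X : manifold M) (f : Y -> X) (hf : definable_C1_map f).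

(** The preimage of [U] cannot serve as the open set for the pullback: it may even be empty. The
    interior of the set where the coefficients of [pullback f w] are C^1 in every chart is used
    instead, provided by the tame class. *)
Lemma is_D_pullback k (w : kform X k) (eta : kform X k.+1) :
  E0 F w -> is_D M F w eta -> is_D M F (pullback f w) (pullback f eta).
Proof.
move=> Ew [Eeta [U [oU dU hU hD]]].
have Epw := E0_pullback hF hf Ew; have Epe := E0_pullback hF hf Eeta.
split => //.
have hO (j : 'I_(msize Y)) : exists O : set 'rV[R]_(mdim Y),
  [/\ open O, O `<=` chart_img (mchart j), dpred M O,
    (forall P : set 'rV[R]_(mdim Y), open P -> P !=set0 -> P `<=` chart_img (mchart j) ->
      O `&` P !=set0) &
    forall K : {ffun 'I_k -> 'I_(mdim Y)},
      C1_on O (fun u => in_chart (pullback f w) j u (rowsub K 1%:M) : R^o)].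
  apply: (tame_class_C1_fin hF) => [||K]; first exact: chart_img_open.
    exact: chart_img_definable.
  exact: (E0_class hF Epw).
move: hO => /choice[Oj hO].
pose P := [set y : Y | forall j, chart_dom (mchart j) y -> Oj j (chart_map (mchart j) y)].
have PO j u : chart_img (mchart j) u -> P° (chart_inv (mchart j) u) -> Oj j u.
  move=> ju /interior_subset/(_ j); rewrite chart_invK//; apply.
  exact: chart_inv_dom.
exists P°; split.
- exact: open_interior.
- apply: generic_all_fin => j; have [oO _ _ dO _] := hO j.
  exact: chart_generic.
- by apply: definable_chart_interior => j; have [] := hO j.
move=> j V; have oV : open V by apply: open_chart_inv; exact: open_interior.
have [oO _ _ _ C1O] := hO j.
have C1V K : C1_on V (fun u => in_chart (pullback f w) j u (rowsub K 1%:M) : R^o).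
  have -> : K = (finfun K : _ -> _) by apply/funext => a; rewrite ffunE.
  by apply: (C1_on_sub oV oO _ (C1O (finfun K))) => u [ju Pu]; exact: PO.
split=> [I _|u Vu A]; first exact: C1V.
have [Ca Da] := ext_deriv_signed A oV C1V.
have Vj v : V v -> chart_img (mchart j) v by case.
(* Both sides are continuous at [u], the left one because the coefficients are C^1 on [V]; it
   remains to find a point of equality in each neighbourhood [Q] of [u]. *)
apply: (@eq_near_dense R _ (fun u => ext_deriv (in_chart (pullback f w) j) u A)
  (fun u => in_chart (pullback f eta) j u A)).
- apply: (@continuous_near_eq _ _ (fun u => \sum_(r < k.+1) 'D_(row r A)
    (fun u => (-1) ^+ r * in_chart (pullback f w) j u (row' r A) : R^o) u : R)).
    have : nbhs u V by exact: open_nbhs_nbhs.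
    by apply: filterS => v Vv; exact: Da.
  apply: continuous_sumr => r; exact: (Ca r).2.
- apply: continuous_alt => [K|a b]; last exact: cst_continuous.
  exact: (E0_continuous Epe (Vj u Vu)).
move=> Q oQ Qu.
have [i Vi] := chart_overlap_cover f (Vj u Vu).
(* [local_pullback] asks for a total definable map. Extension by zero changes neither the
   representative nor its Jacobian on the open overlap. *)
pose h v := \row_l extend0 (chart_overlap f j i) (fun v => chart_rep f j i v 0 l) v.
have oVi := open_chart_overlap hf (j := j) (i := i).
have hE v : chart_overlap f j i v -> h v = chart_rep f j i v.
  by move=> Vv; apply/rowP => l; rewrite mxE extend0E.
have Jh v : chart_overlap f j i v -> jacobian (chart_rep f j i) v = jacobian h v.
  move=> Vv; apply: (jacobian_near_eq _ (chart_rep_differentiable hf Vv)).2.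
  have : nbhs v (chart_overlap f j i) by exact: open_nbhs_nbhs.
  by apply: filterS => x Vx; rewrite hE.
pose V' := V `&` Q `&` chart_overlap f j i.
have oV' : open V' by apply: openI => //; exact: openI.
have V'V : V' `<=` V by move=> v [[]].
have V'i v : V' v -> chart_overlap f j i v by case.
have oW := chart_img_open (c := mchart i).
have oOi := open_chart_inv (c := mchart i) oU.
have [C1w Dw] := hD i.
have [||||||||||v [V'v Ev]] := @local_pullback R M hM k (mdim Y) (mdim X) h V'
  (chart_img (mchart i)) (chart_img (mchart i) `&` chart_inv (mchart i) @^-1` U)
  (in_chart (pullback f w) j) (in_chart (pullback f eta) j) (in_chart w i)
  (in_chart eta i) _ oV' _ oW oOi _ (@chart_inv_dense X U i dU) _ _ _ _ _ _ Dw _ A.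
- exact: (definable_map_dmap (chart_rep_definable hf j i)).
- by exists u.
- exact: hU.
- by move=> v /V'i Vv; rewrite hE//; exact: chart_overlap_img.
- by move=> v /V'i Vv; rewrite -Jh// hE//; exact: in_chart_pullback.
- by move=> v /V'i Vv; rewrite -Jh// hE//; exact: in_chart_pullback.
- by move=> y iy K; exact: (E0_continuous Ew iy).
- by move=> y iy K; exact: (E0_continuous Eeta iy).
- by apply: C1_on_coefs.
- by move=> K; apply: (C1_on_sub oV' oV V'V).
exists v; split; last exact: Ev.
by case: V'v => -[].
Qed.

Lemma D0_unique (Z : manifold M) k (w : kform Z k) eta : is_D M F w eta -> D0 M F w = eta.
Proof. by move=> D; apply: xget_unique => // eta' D'; exact: is_D_unique D' D. Qed.

Lemma Omega0_pullback k (w : kform X k) : Omega0 M F w ->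
  Omega0 M F (pullback f w) /\ D0 M F (pullback f w) = pullback f (D0 M F w).
Proof.
move=> [Ew [eta D]]; have D' := is_D_pullback Ew D; split.
  by split; [exact: E0_pullback|exists (pullback f eta)].
by rewrite (D0_unique D) (D0_unique D').
Qed.

End Differential.

Theorem theorem3p4 (R : realType) (M : structure R) (hM : o_minimal M)
    (k : nat) (Y X : manifold M) (f : Y -> X) (hf : definable_C1_map f) :
  (forall w : kform X k, Omega_def w ->
     Omega_def (pullback f w) /\
     D_def (pullback f w) = pullback f (D_def w)) /\
  (M = R_an R ->
   forall w : kform X k, Omega_con w ->
     Omega_con (pullback f w) /\
     D_con (pullback f w) = pullback f (D_con w)).
Proof.
split=> [w|MR].
  exact: (Omega0_pullback hM (definable_tame_class hM) hf).
(* With [M] equal to [R_an], the globally subanalytic sets demanded by [Omega_con] are the sets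
   definable in the structure of the manifolds, as [Omega0_pullback] requires. *)
subst M => w; exact: (Omega0_pullback hM (constructible_tame_class hM) hf).
Qed.
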